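(* Let $\kappa$ be an inaccessible cardinal and let $f$ be $V$-generic for the fast function forcing $\mathbb{F}_\kappa$. Then in $V[f]$ there is a function $\ell:\kappa\to (V[f])_\kappa$ with the following property. For any elementary embedding $j:V[f]\to M[j(f)]$ with critical point $\kappa$ (whether or not $j$ is definable in $V[f]$), and for any $z\in H(\lambda^+)^{M[j(f)]}$ where $\lambda=j(f)(\kappa)$, there is another elementary embedding $j^*:V[f]\to M[j^*(f)]$ such that: (1) $j^*(\ell)(\kappa)=z$; (2) $M[j^*(f)]=M[j(f)]$; (3) $j^*\upharpoonright V=j\upharpoonright V$; (4) if $j$ is the ultrapower by a standard measure $\eta$ concentrating on a set in $V$, then $j^*$ is the ultrapower by a standard measure $\eta^*$ concentrating on the same set, and moreover $\eta^*\cap V=\eta\cap V$ and $[\mathrm{id}]_{\eta^*}=[\mathrm{id}]_\eta$.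
   Context: Fast function forcing $\mathbb{F}_\kappa$: conditions are partial functions $p:\kappa\to\kappa$ such that $\mathrm{dom}(p)$ is a set of inaccessible cardinals below $\kappa$ of size less than $\kappa$, and for every $\gamma\in\mathrm{dom}(p)$, $p``\gamma\subseteq\gamma$ and $|p\upharpoonright\gamma|<\gamma$; ordered by inclusion; $f$ is the union of the generic. For an embedding $j$ of $V[f]$ into a transitive class, the target is written $M[j(f)]$ where $M=j(V)=\bigcup_\alpha j(V_\alpha)$ and $j(f)$ is $M$-generic for $j(\mathbb{F}_\kappa)$. A measure $\eta$ in $V[f]$ (an ultrafilter on some set $D$, with ultrapower embedding $j:V[f]\to M[j(f)]$) is standard when the critical point $\kappa$ of $j$ is definable in $M[j(f)]$ from $[\mathrm{id}]_\eta$ and parameters in the range of $j\upharpoonright V$. ''Concentrating on a set in $V$'' means $\eta$ contains some set $D\in V$. *)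

(* Defs.v *)
(* The universe of sets in which all the transitive classes of the theorem live.
   Only extensionality and foundation are imposed on it; classes are arbitrary
   predicates, so that neither embeddings nor their targets need be definable. *)
Record universe := Universe {
  carrier :> Type;
  mem : carrier -> carrier -> Prop;
  mem_ext : forall x y, (forall z, mem z x <-> mem z y) -> x = y;
  mem_wf : well_founded mem
}.

Arguments mem {u} x y.
Notation "x ∈ y" := (mem x y) (at level 70, no associativity).

Definition class (U : universe) := U -> Prop.

(* First-order formulas of set theory, with de Bruijn variables. *)
Inductive fm : Type :=
| FMem (i k : nat)
| FEq (i k : nat)
| FBot
| FImp (p q : fm)
| FAll (p : fm).

Definition scons {T : Type} (x : T) (e : nat -> T) (n : nat) : T :=
  match n with 0 => x | S m => e m end.

Section Sets.
Context {U : universe}.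
Implicit Types (C V W N G : class U).
Implicit Types (x y z a b p q g h : U).

Fixpoint sat C (e : nat -> U) (phi : fm) : Prop :=
  match phi with
  | FMem i k => e i ∈ e k
  | FEq i k => e i = e k
  | FBot => False
  | FImp p q => sat C e p -> sat C e q
  | FAll p => forall x, C x -> sat C (scons x e) p
  end.

Definition transitive_class C := forall x y, C x -> y ∈ x -> C y.

Definition subset x y := forall z, z ∈ x -> z ∈ y.

Record ZFC C : Prop := {
  zfc_extensionality : forall x y, C x -> C y ->
    (forall z, C z -> (z ∈ x <-> z ∈ y)) -> x = y;
  zfc_foundation : forall x, C x -> (exists y, C y /\ y ∈ x) ->
    exists y, C y /\ y ∈ x /\ ~ exists z, C z /\ z ∈ x /\ z ∈ y;
  zfc_pairing : forall a b, C a -> C b ->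
    exists x, C x /\ forall z, C z -> (z ∈ x <-> z = a \/ z = b);
  zfc_union : forall x, C x ->
    exists u, C u /\ forall z, C z -> (z ∈ u <-> exists y, C y /\ y ∈ x /\ z ∈ y);
  zfc_power : forall x, C x ->
    exists u, C u /\ forall z, C z ->
      (z ∈ u <-> forall y, C y -> y ∈ z -> y ∈ x);
  zfc_infinity : exists x, C x /\
    (exists y, C y /\ y ∈ x /\ forall z, C z -> ~ z ∈ y) /\
    (forall y, C y -> y ∈ x ->
       exists s, C s /\ s ∈ x /\ forall z, C z -> (z ∈ s <-> z ∈ y \/ z = y));
  zfc_separation : forall (phi : fm) (e : nat -> U) x, (forall n, C (e n)) -> C x ->
    exists u, C u /\ forall z, C z -> (z ∈ u <-> z ∈ x /\ sat C (scons z e) phi);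
  zfc_replacement : forall (phi : fm) (e : nat -> U) x, (forall n, C (e n)) -> C x ->
    (forall a, C a -> a ∈ x ->
       exists b, C b /\ forall b', C b' ->
         (sat C (scons a (scons b' e)) phi <-> b' = b)) ->
    exists u, C u /\ forall b, C b ->
      (b ∈ u <-> exists a, C a /\ a ∈ x /\ sat C (scons a (scons b e)) phi);
  zfc_choice : forall x, C x ->
    (forall y, C y -> y ∈ x -> exists z, C z /\ z ∈ y) ->
    (forall y y' z, C y -> C y' -> C z -> y ∈ x -> y' ∈ x ->
       z ∈ y -> z ∈ y' -> y = y') ->
    exists c, C c /\ forall y, C y -> y ∈ x ->
      exists z, C z /\ forall z', C z' -> (z' ∈ c /\ z' ∈ y <-> z' = z)
}.

(* The notions without a class argument are absolute for transitive classes. *)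

Definition is_upair x a b := forall z, z ∈ x <-> z = a \/ z = b.

Definition is_pair x a b :=
  exists s t, is_upair s a a /\ is_upair t a b /\ is_upair x s t.

Definition app g a b := exists x, x ∈ g /\ is_pair x a b.

Definition is_function g :=
  (forall x, x ∈ g -> exists a b, is_pair x a b) /\
  (forall a b b', app g a b -> app g a b' -> b = b').

Definition is_dom d g := forall a, a ∈ d <-> exists b, app g a b.

Definition is_restriction r g x :=
  forall y, y ∈ r <-> y ∈ g /\ exists a b, is_pair y a b /\ a ∈ x.

Definition maps g x C := is_function g /\ is_dom x g /\ forall a b, app g a b -> C b.

Definition transitive_set x := forall y, y ∈ x -> subset y x.

Definition ordinal x := transitive_set x /\ forall y, y ∈ x -> transitive_set y.

Definition limit x :=
  ordinal x /\ (exists y, y ∈ x) /\ forall y, y ∈ x -> exists z, z ∈ x /\ y ∈ z.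

Definition is_omega x := limit x /\ forall n, n ∈ x -> ~ limit n.

(* [in_rank x alpha]: x belongs to V_alpha, the union of the powersets of the
   V_beta for beta < alpha. *)
Inductive in_rank : U -> U -> Prop :=
| in_rank_intro x alpha beta :
    beta ∈ alpha -> (forall y, y ∈ x -> in_rank y beta) -> in_rank x alpha.

Definition is_level C alpha v := forall x, x ∈ v <-> C x /\ in_rank x alpha.

(* A class argument C means that the notion is computed in C. *)

Definition equinumerous C x y :=
  exists g, C g /\ maps g x (fun b => b ∈ y) /\
    (forall a a' b, app g a b -> app g a' b -> a = a') /\
    (forall b, b ∈ y -> exists a, app g a b).

Definition cardinal C k :=
  ordinal k /\ forall a, a ∈ k -> ~ equinumerous C a k.

(* |x| < k, for k a cardinal *)
Definition card_lt C x k := exists b, b ∈ k /\ equinumerous C x b.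

Definition is_power C u x := forall y, y ∈ u <-> C y /\ subset y x.

Definition regular C k :=
  limit k /\ forall a g, a ∈ k -> C g -> maps g a (fun b => b ∈ k) ->
    exists c, c ∈ k /\ forall x b, app g x b -> b ∈ c.

Definition strong_limit C k :=
  forall a u, a ∈ k -> C u -> is_power C u a -> card_lt C u k.

Definition inaccessible C k :=
  cardinal C k /\ (exists w, is_omega w /\ w ∈ k) /\ regular C k /\ strong_limit C k.

Definition is_succ_card C l t :=
  C t /\ cardinal C t /\ l ∈ t /\
  forall m, C m -> cardinal C m -> l ∈ m -> t = m \/ t ∈ m.

Definition is_trans_closure C z t :=
  subset z t /\ transitive_set t /\
  forall s, C s -> transitive_set s -> subset z s -> subset t s.

Definition hereditary C t z :=
  C z /\ exists c, C c /\ is_trans_closure C z c /\ card_lt C c t.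

(* Fast function forcing *)

Definition fast_condition C k p :=
  is_function p /\
  (forall a b, app p a b -> a ∈ k /\ b ∈ k /\ inaccessible C a) /\
  (exists d, C d /\ is_dom d p /\ card_lt C d k) /\
  (forall c b, app p c b ->
     (forall a b', a ∈ c -> app p a b' -> b' ∈ c) /\
     (exists r, C r /\ is_restriction r p c /\ card_lt C r c)).

Definition is_fast_forcing C k P :=
  C P /\ forall p, p ∈ P <-> C p /\ fast_condition C k p.

(* For posets of partial functions ordered by inclusion (larger is stronger),
   the generic filter is recovered from its union f. *)
Definition filter_of P f : class U := fun p => p ∈ P /\ subset p f.

Definition dense P D :=
  subset D P /\ forall p, p ∈ P -> exists d, d ∈ D /\ subset p d.

Definition generic C P f :=
  (exists p, filter_of P f p) /\
  (forall p q, filter_of P f p -> filter_of P f q ->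
     exists r, filter_of P f r /\ subset p r /\ subset q r) /\
  (forall D, C D -> dense P D -> exists p, p ∈ D /\ filter_of P f p) /\
  (forall x, x ∈ f <-> exists p, filter_of P f p /\ x ∈ p).

(* [val G s x]: x = { val_G(t) | exists p in G, (t, p) in s }.  Members of s that
   are not pairs (t, p) with p in G are ignored, so any set may serve as a name. *)
Inductive val G : U -> U -> Prop :=
| val_intro s x :
    (forall u t p, u ∈ s -> is_pair u t p -> G p -> exists y, y ∈ x /\ val G t y) ->
    (forall y, y ∈ x -> exists u t p, u ∈ s /\ is_pair u t p /\ G p /\ val G t y) ->
    val G s x.

(* C[f] *)
Definition extension C P f : class U :=
  fun x => exists s, C s /\ val (filter_of P f) s x.

(* Every name in C has a value in the ambient universe. *)
Definition extension_exists C P f :=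
  forall s, C s -> exists x, val (filter_of P f) s x.

(* Embeddings.  Only the values of [j] on the source class are relevant. *)

Definition elementary W N (j : U -> U) :=
  (forall x, W x -> N (j x)) /\
  forall (phi : fm) (e : nat -> U), (forall n, W (e n)) ->
    (sat W e phi <-> sat N (fun n => j (e n)) phi).

Definition critical_point W (j : U -> U) k :=
  W k /\ ordinal k /\ j k <> k /\ forall a, a ∈ k -> j a = a.

(* j(V), the union of the sets j(V_alpha) *)
Definition image_class V (j : U -> U) : class U :=
  fun x => exists alpha v, V alpha /\ ordinal alpha /\ V v /\ is_level V alpha v /\ x ∈ j v.

(* Measures *)

Definition ultrafilter W D eta :=
  W D /\ W eta /\ D ∈ eta /\
  (forall X, X ∈ eta -> subset X D) /\
  (forall X, X ∈ eta -> exists x, x ∈ X) /\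
  (forall X Y, X ∈ eta -> W Y -> subset X Y -> subset Y D -> Y ∈ eta) /\
  (forall X Y Z, X ∈ eta -> Y ∈ eta -> (forall x, x ∈ Z <-> x ∈ X /\ x ∈ Y) -> Z ∈ eta) /\
  (forall X Y, W X -> subset X D -> (forall x, x ∈ Y <-> x ∈ D /\ ~ x ∈ X) ->
     X ∈ eta \/ Y ∈ eta).

(* eta is an ultrafilter in W, N is the transitive collapse of the ultrapower of W
   by eta, j is the canonical embedding and a = [id]_eta; [cl g] is the collapse of
   the class of the function g. *)
Definition is_ultrapower W N (j : U -> U) eta a :=
  exists (D : U) (cl : U -> U),
    let Fn g := W g /\ maps g D W in
    ultrafilter W D eta /\
    (forall g, Fn g -> N (cl g)) /\
    (forall y, N y -> exists g, Fn g /\ cl g = y) /\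
    (forall g h, Fn g -> Fn h ->
       (cl g = cl h <->
        exists X, X ∈ eta /\
          forall x, x ∈ X <-> x ∈ D /\ exists b, app g x b /\ app h x b)) /\
    (forall g h, Fn g -> Fn h ->
       (cl g ∈ cl h <->
        exists X, X ∈ eta /\
          forall x, x ∈ X <-> x ∈ D /\ exists b c, app g x b /\ app h x c /\ b ∈ c)) /\
    (forall x, W x -> exists c, Fn c /\ (forall d, d ∈ D -> app c d x) /\ cl c = j x) /\
    (exists i, Fn i /\ (forall d, d ∈ D -> app i d d) /\ cl i = a).

(* The critical point of j is definable in N from a and parameters in the range of j on V. *)
Definition standard V W N (j : U -> U) a :=
  exists c, critical_point W j c /\ N c /\
    exists (phi : fm) (e : nat -> U), (forall n, V (e n)) /\
      forall x, N x -> (sat N (scons x (scons a (fun n => j (e n)))) phi <-> x = c).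

End Sets.

(* Main.v *)
From Corelib Require Import ssreflect.
From Stdlib Require Import Classical ClassicalEpsilon FunctionalExtensionality
  PropExtensionality Relations Wellfounded PeanoNat Lia.
Require Import Defs.

(** The generic function [f] may be modified at a single point gamma, from lambda to
    alpha: if no inaccessible cardinal above gamma separates lambda from alpha, then
    exchanging the two values in the conditions shows that the modified function is
    again generic, with the same extension.  The function of the theorem decodes
    [f(gamma)] as [((b, s), w)] and evaluates the name [s].  An element of H(lambda^+)
    has a name of rank below the next inaccessible cardinal, because the part of the
    forcing above gamma is distributive, and Cantor's argument yields an alpha outside
    lambda coding [((lambda, s), w)] for some padding [w].  These facts are proved in
    V[f] about all modifications at once and are carried to M[j(f)] by the elementarity
    of [j], with gamma = kappa.  If [f*] is the resulting modification of [j(f)], then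
    [j'] maps the value of [s] at [f] to the value of [j s] at [f*].  The new measure
    consists of the X such that [id] belongs to [j' X].  Its ultrapower is all of
    M[j(f)] because kappa is definable from [id], and lambda, hence [j(f)], can be read
    off the code [f*(kappa)]. *)

(** The coded name has to be evaluated at [f*], although [f*] depends on the code. The circle is
    broken by names that hereditarily mention only conditions with domain contained in gamma: a
    change at gamma does not affect them, so the name is found before its code. The exchange
    preserves conditions because the value at gamma is bounded by every later element of the domain,
    and these are inaccessible. An alpha that is at least lambda but below the least inaccessible
    above gamma and lambda leaves none in between. The embedding may be external, kappa is not in
    its range, and no definition of [M] in [M[j(f)]] is assumed. Hence facts are first put into the
    form of one formula about all modifications, with quantifiers over names or dense sets bounded
    by a set of [V] and with valuations witnessed by sets. The map [j'] is well defined and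
    elementary because a condition [p] in the filter has its domain bounded below kappa: [j p] says
    nothing about the value at kappa and is still contained in [f*]. *)

Set Implicit Arguments.
Unset Strict Implicit.

(** * Basic facts about pairs, functions and ordinals *)

Section Basics.
Context {U : universe}.
Implicit Types (x y z a b u v w g h alpha beta : U).

Lemma upair_unique x y a b : is_upair x a b -> is_upair y a b -> x = y.
Proof. by move=> Hx Hy; apply: mem_ext => z; rewrite Hx Hy. Qed.

Lemma upair_inj x a b a' b' : is_upair x a b -> is_upair x a' b' ->
  (a = a' /\ b = b') \/ (a = b' /\ b = a').
Proof.
move=> H H'.
have /H' Ha : a ∈ x by apply/H; left.
have /H' Hb : b ∈ x by apply/H; right.
have /H Ha' : a' ∈ x by apply/H'; left.
have /H Hb' : b' ∈ x by apply/H'; right.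
by case: Ha; case: Hb; case: Ha'; case: Hb'; intuition congruence.
Qed.

Lemma pair_unique x y a b : is_pair x a b -> is_pair y a b -> x = y.
Proof.
move=> [s [t [Hs [Ht Hx]]]] [s' [t' [Hs' [Ht' Hy]]]].
have e := upair_unique Hs Hs'; have e' := upair_unique Ht Ht'; subst s' t'.
exact: upair_unique Hx Hy.
Qed.

Lemma pair_inj x a b a' b' : is_pair x a b -> is_pair x a' b' -> a = a' /\ b = b'.
Proof.
move=> [s [t [Hs [Ht Hx]]]] [s' [t' [Hs' [Ht' Hx']]]].
case: (upair_inj Hx Hx') => [[e1 e2]|[e1 e2]]; subst s' t';
  case: (upair_inj Hs Hs') || case: (upair_inj Hs Ht'); case: (upair_inj Ht Ht') || case: (upair_inj Ht Hs');
  intuition congruence.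
Qed.

Lemma pair_fst_mem x a b : is_pair x a b -> exists s, s ∈ x /\ a ∈ s.
Proof.
move=> [s [t [Hs [Ht Hx]]]]; exists s; split; [by apply/Hx; left|by apply/Hs; left].
Qed.

Lemma pair_snd_mem x a b : is_pair x a b -> exists s, s ∈ x /\ b ∈ s.
Proof.
move=> [s [t [Hs [Ht Hx]]]]; exists t; split; [by apply/Hx; right|by apply/Ht; right].
Qed.

Lemma app_pair g x a b : x ∈ g -> is_pair x a b -> app g a b.
Proof. by move=> *; exists x. Qed.

Lemma app_mem g x a b : app g a b -> is_pair x a b -> x ∈ g.
Proof. by move=> [y [Hy Py]] Px; rewrite (pair_unique Px Py). Qed.

Lemma app_sub g h a b : subset g h -> app g a b -> app h a b.
Proof. by move=> S [x [Hx Px]]; exists x; split=> //; apply: S. Qed.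

(** A name [t] occurring in a pair [(t, p)] of [s] is several membership steps below [s], so
    inductions on names use the transitive closure of membership. *)
Definition below : U -> U -> Prop := clos_trans U mem.

Lemma below_ind (Q : U -> Prop) :
  (forall x, (forall y, below y x -> Q y) -> Q x) -> forall x, Q x.
Proof. exact: (well_founded_ind (wf_clos_trans _ _ (@mem_wf U))). Qed.

Lemma below_fst s u t p : u ∈ s -> is_pair u t p -> below t s.
Proof.
move=> Hu /pair_fst_mem [d [Hd Ht]]; apply: (t_trans _ _ _ d); first exact: t_step.
by apply: (t_trans _ _ _ u); apply: t_step.
Qed.

Lemma mem_irrefl x : ~ x ∈ x.
Proof. elim/(well_founded_ind (@mem_wf U)): x => x IH H; exact: (IH _ H H). Qed.

Lemma mem_asym x y : x ∈ y -> ~ y ∈ x.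
Proof.
elim/(well_founded_ind (@mem_wf U)): x y => x IH y Hxy Hyx; exact: (IH y Hyx x Hyx Hxy).
Qed.

Lemma below_min (Q : U -> Prop) : (exists x, Q x) -> exists x, Q x /\ forall y, y ∈ x -> ~ Q y.
Proof.
move=> [x Hx]; apply: NNPP => N; suff : forall x, ~ Q x by move/(_ x).
elim/(well_founded_ind (@mem_wf U)) => {Hx}x IH Hx; apply: N; exists x; split=> // y /IH.
Qed.

Lemma ordinal_mem x y : ordinal x -> y ∈ x -> ordinal y.
Proof.
move=> [T H] Hy; split; first exact: H.
by move=> z Hz; apply: H; apply: (T y).
Qed.

Lemma ordinal_trans x y z : ordinal x -> y ∈ x -> z ∈ y -> z ∈ x.
Proof. by move=> [T _] Hy Hz; apply: (T y). Qed.

Lemma ordinal_total x y : ordinal x -> ordinal y -> x ∈ y \/ x = y \/ y ∈ x.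
Proof.
elim/(well_founded_ind (@mem_wf U)): x y => x IHx y.
elim/(well_founded_ind (@mem_wf U)): y => y IHy Ox Oy.
case: (classic (x ∈ y)); first by left.
case: (classic (y ∈ x)); first by right; right.
move=> N1 N2; right; left; apply: mem_ext => z; split=> Hz.
- case: (IHx z Hz y (ordinal_mem Ox Hz) Oy) => [//|[E|H]]; first by subst.
  by case: N1; apply: (ordinal_trans Ox Hz).
- case: (IHy z Hz Ox (ordinal_mem Oy Hz)) => [H|[E|//]]; last by subst.
  by case: N2; apply: (ordinal_trans Oy Hz).
Qed.

Lemma ordinal_of_set x : transitive_set x -> (forall y, y ∈ x -> ordinal y) -> ordinal x.
Proof. by move=> T H; split=> // y /H []. Qed.

Lemma ordinal_subset x y : ordinal x -> ordinal y -> subset x y -> x = y \/ x ∈ y.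
Proof.
move=> Ox Oy S; case: (ordinal_total Ox Oy) => [|[|H]]; [by right|by left|].
by case: (mem_irrefl (S _ H)).
Qed.

Lemma ordinal_not_mem x y : ordinal x -> ordinal y -> ~ y ∈ x -> subset x y.
Proof.
move=> Ox Oy N z Hz; case: (ordinal_total Ox Oy) => [H|[<- //|//]].
exact: (ordinal_trans Oy H).
Qed.

Lemma in_rank_sub x y alpha : in_rank x alpha -> subset y x -> in_rank y alpha.
Proof. by case=> {}x {}alpha beta Hb H S; apply: (in_rank_intro _ _ _ Hb) => z /S /H. Qed.

Lemma in_rank_le x alpha beta : in_rank x alpha -> subset alpha beta -> in_rank x beta.
Proof. by case=> {}x {}alpha d Hb H S; apply: (in_rank_intro _ _ _ (S _ Hb)). Qed.

Lemma in_rank_mem x y alpha : transitive_set alpha -> in_rank x alpha -> y ∈ x -> in_rank y alpha.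
Proof.
move=> T R; case: R T => {}x {}alpha d Hb H T Hy; apply: (in_rank_le (H _ Hy)); exact: T.
Qed.

Lemma in_rank_irrefl alpha : ~ in_rank alpha alpha.
Proof.
move=> R; suff K : forall x a : U, in_rank x a -> x = a -> False by exact: (K _ _ R).
move=> x a; elim=> {alpha R a}x alpha beta Hb _ IH E; subst x.
exact: (IH beta Hb).
Qed.

End Basics.

(** * Definability over families of transitive classes *)

(* A predicate is definable over a frame when a single formula, with admissible
   families of constants, expresses it in all the classes of the frame at once.  A one-class
   frame gives definability with constants; the two-class frame of an elementary
   embedding [j], with the families [x, j x] as constants, gives transfer along [j]. *)
Record frame (U : universe) := Frame {
  ix : Type;
  cl : ix -> class U;
  par : (ix -> U) -> Prop;
  fr_trans : forall i, transitive_class (cl i);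
  par_in : forall c i, par c -> cl i (c i);
  par_ex : exists c, par c
}.
Arguments ix {U} f.
Arguments cl {U} f i x.
Arguments par {U} f c.

Fixpoint ren (r : nat -> nat) (phi : fm) : fm :=
  match phi with
  | FMem i k => FMem (r i) (r k)
  | FEq i k => FEq (r i) (r k)
  | FBot => FBot
  | FImp p q => FImp (ren r p) (ren r q)
  | FAll p => FAll (ren (fun n => match n with 0 => 0 | S m => S (r m) end) p)
  end.

Lemma sat_ext {U : universe} (C : class U) e e' phi :
  (forall n, e n = e' n) -> (sat C e phi <-> sat C e' phi).
Proof. by move=> /functional_extensionality ->. Qed.

Lemma sat_ren {U : universe} (C : class U) phi : forall e r,
  sat C e (ren r phi) <-> sat C (fun n => e (r n)) phi.
Proof.
elim: phi => //= [p IHp q IHq|p IH] e r; first by rewrite IHp IHq.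
have E x : sat C (scons x e) (ren (fun n => match n with 0 => 0 | S m => S (r m) end) p) <->
  sat C (scons x (fun n => e (r n))) p by rewrite IH; apply: sat_ext; case.
by split=> H x Cx; apply/E/H.
Qed.

(** Variables occupy the even places and constants the odd ones, so that both sequences can be
    infinite without renumbering each other. *)
Fixpoint mix {T : Type} (e c : nat -> T) (n : nat) : T :=
  match n with
  | 0 => e 0
  | 1 => c 0
  | S (S m) => mix (fun k => e (S k)) (fun k => c (S k)) m
  end.

Lemma mix_even {T : Type} n : forall (e c : nat -> T), mix e c (n + n) = e n.
Proof. by elim: n => [|n IH] e c //; rewrite Nat.add_succ_r /= IH. Qed.

Lemma mix_odd {T : Type} n : forall (e c : nat -> T), mix e c (S (n + n)) = c n.
Proof. by elim: n => [|n IH] e c //; rewrite Nat.add_succ_r; have := IH (fun k => e (S k)) (fun k => c (S k)). Qed.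

Lemma even_odd n : exists k, n = k + k \/ n = S (k + k).
Proof.
elim: n => [|n [k [->|->]]]; [by exists 0; left|by exists k; right|].
by exists (S k); left; rewrite Nat.add_succ_r.
Qed.

Lemma mix_map {T T' : Type} (F : T -> T') n : forall (e c : nat -> T),
  F (mix e c n) = mix (fun k => F (e k)) (fun k => F (c k)) n.
Proof.
move=> e c; case: (even_odd n) => k [->|->]; first by rewrite !mix_even.
by rewrite !mix_odd.
Qed.

Section Definable.
Context {U : universe} (F : frame U).
Implicit Types (Q : ix F -> (nat -> U) -> Prop).
Implicit Types (t : ix F -> (nat -> U) -> U).

Definition dfn Q := exists phi (c : nat -> ix F -> U), (forall n, par F (c n)) /\
  forall i e, (forall n, cl F i (e n)) -> (Q i e <-> sat (cl F i) (mix e (fun n => c n i)) phi).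

Inductive tm : (ix F -> (nat -> U) -> U) -> Prop :=
| tm_var n : tm (fun i e => e n)
| tm_par c : par F c -> tm (fun i e => c i).

Lemma tm_in t i e : tm t -> (forall n, cl F i (e n)) -> cl F i (t i e).
Proof. by case=> [n|c Hc] He //; apply: par_in. Qed.

Lemma tm_shift t : tm t -> tm (fun i e => t i (fun n => e (S n))).
Proof. by case=> [n|c Hc]; [exact: (tm_var (S n))|exact: tm_par]. Qed.

Lemma tm_ren r t : tm t -> tm (fun i e => t i (fun n => e (r n))).
Proof. by case=> [n|c Hc]; [exact: (tm_var (r n))|exact: tm_par]. Qed.

Lemma d_ext Q Q' : (forall i e, (forall n, cl F i (e n)) -> (Q i e <-> Q' i e)) -> dfn Q' -> dfn Q.
Proof.
by move=> E [phi [c [Hc H]]]; exists phi, c; split=> // i e He; rewrite E //; apply: H.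
Qed.

Lemma d_atom (at_ : nat -> nat -> fm) (R : U -> U -> Prop) t1 t2 :
  (forall C e i k, sat C e (at_ i k) <-> R (e i) (e k)) ->
  tm t1 -> tm t2 -> dfn (fun i e => R (t1 i e) (t2 i e)).
Proof.
move=> HR; case: (par_ex F) => c0 Hc0.
have ix1 t : tm t -> forall m, exists n (c : ix F -> U), par F c /\
  forall i e d, d m = c i -> t i e = mix e d n.
{ case=> [n|c Hc] m.
  + by exists (n + n), c0; split=> // i e d _; rewrite mix_even.
  + by exists (S (m + m)), c; split=> // i e d <-; rewrite mix_odd. }
move=> /ix1 /(_ 0) [n1 [c1 [H1 E1]]] /ix1 /(_ 1) [n2 [c2 [H2 E2]]].
exists (at_ n1 n2), (fun n => match n with 0 => c1 | _ => c2 end); split; first by case.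
by move=> i e He; rewrite HR -(E1 i e) // -(E2 i e).
Qed.

Lemma d_mem t1 t2 : tm t1 -> tm t2 -> dfn (fun i e => t1 i e ∈ t2 i e).
Proof. exact: (d_atom (at_ := FMem)). Qed.

Lemma d_eq t1 t2 : tm t1 -> tm t2 -> dfn (fun i e => t1 i e = t2 i e).
Proof. exact: (d_atom (at_ := FEq)). Qed.

Lemma d_bot : dfn (fun _ _ => False).
Proof. by case: (par_ex F) => c Hc; exists FBot, (fun _ => c). Qed.

Lemma d_imp Q Q' : dfn Q -> dfn Q' -> dfn (fun i e => Q i e -> Q' i e).
Proof.
move=> [p [c [Hc H]]] [p' [c' [Hc' H']]].
(* The renaming keeps the variables and sends the constants of the two formulas to the even and odd
   places of the merged sequence [mix c c']. *)
pose r (par : nat -> nat) n := mix (fun k => k + k) (fun k => S (par k + par k)) n.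
exists (FImp (ren (r (fun k => k + k)) p) (ren (r (fun k => S (k + k))) p')), (mix c c'); split.
  move=> n; case: (even_odd n) => k [->|->]; [by rewrite mix_even|by rewrite mix_odd].
move=> i e He /=; rewrite !sat_ren (H i e He) (H' i e He).
suff E : forall (g : nat -> nat) d, (forall k, mix c c' (g k) i = d k i) -> forall q,
  sat (cl F i) (fun n => mix e (fun n0 => mix c c' n0 i) (r g n)) q <->
  sat (cl F i) (mix e (fun n => d n i)) q.
  rewrite (E _ c) ?(E _ c') // => k; [by rewrite mix_even|by rewrite mix_odd].
move=> g d Hd q; apply: sat_ext => n; case: (even_odd n) => k [->|->].
- by rewrite /r !mix_even.
- by rewrite /r !mix_odd.
Qed.

Lemma d_all (Q : ix F -> U -> (nat -> U) -> Prop) :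
  dfn (fun i e => Q i (e 0) (fun n => e (S n))) -> dfn (fun i e => forall x, cl F i x -> Q i x e).
Proof.
move=> [p [c [Hc H]]].
(* Variable 0 becomes the bound variable; all the other variables and the constants move to their
   places in [mix e c], shifted by one. *)
pose r := mix (fun k => match k with 0 => 0 | S k => S (k + k) end) (fun k => S (S (k + k))).
exists (FAll (ren r p)), c; split=> // i e He /=.
have E x : cl F i x -> (Q i x e <-> sat (cl F i) (scons x (mix e (fun n => c n i))) (ren r p)).
{ move=> Hx; rewrite sat_ren.
  have K := H i (scons x e) (fun n => match n with 0 => Hx | S m => He m end).
  apply: (iff_trans K); apply: sat_ext => n; rewrite /r; case: (even_odd n) => k [->|->].
  - by rewrite !mix_even; case: k => [|k] //=; rewrite mix_even.
  - by rewrite !mix_odd; change (c k i = mix e (fun n => c n i) (S (k+k))); rewrite mix_odd. }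
by split=> K x Hx; apply/(E x Hx)/K.
Qed.

Lemma d_not Q : dfn Q -> dfn (fun i e => ~ Q i e).
Proof. by move=> H; apply: d_imp H d_bot. Qed.

Lemma d_or Q Q' : dfn Q -> dfn Q' -> dfn (fun i e => Q i e \/ Q' i e).
Proof.
move=> H H'; apply: (d_ext (Q' := fun i e => ~ Q i e -> Q' i e)); last by apply: d_imp H'; apply: d_not.
by move=> i e _; case: (classic (Q i e)); tauto.
Qed.

Lemma d_and Q Q' : dfn Q -> dfn Q' -> dfn (fun i e => Q i e /\ Q' i e).
Proof.
move=> H H'; apply: (d_ext (Q' := fun i e => ~ (Q i e -> ~ Q' i e))).
  by move=> i e _; case: (classic (Q i e)); case: (classic (Q' i e)); tauto.
by apply/d_not/d_imp => //; apply: d_not.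
Qed.

Lemma d_iff Q Q' : dfn Q -> dfn Q' -> dfn (fun i e => Q i e <-> Q' i e).
Proof. by move=> H H'; apply: d_and; apply: d_imp. Qed.

Lemma d_ex (Q : ix F -> U -> (nat -> U) -> Prop) :
  dfn (fun i e => Q i (e 0) (fun n => e (S n))) -> dfn (fun i e => exists x, cl F i x /\ Q i x e).
Proof.
move=> H; apply: (d_ext (Q' := fun i e => ~ forall x, cl F i x -> ~ Q i x e)).
  move=> i e _; split; first by move=> [x [Cx Qx]] /(_ x Cx).
  by move=> N; apply: NNPP => N'; apply: N => x Cx Qx; apply: N'; exists x.
by apply: d_not; apply: (d_all (Q := fun i x e => ~ Q i x e)); apply: d_not.
Qed.

(** By transitivity a quantifier bounded by a term may range over the whole universe, so absolute
    notions are definable without being relativized. *)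
Lemma d_ball t (Q : ix F -> U -> (nat -> U) -> Prop) : tm t ->
  dfn (fun i e => Q i (e 0) (fun n => e (S n))) -> dfn (fun i e => forall x, x ∈ t i e -> Q i x e).
Proof.
move=> Ht H; apply: (d_ext (Q' := fun i e => forall x, cl F i x -> x ∈ t i e -> Q i x e)).
  move=> i e He; split=> K x; first by move=> _; apply: K.
  by move=> Hx; apply: (K x) => //; apply: fr_trans Hx; apply: tm_in.
apply: (d_all (Q := fun i x e => x ∈ t i e -> Q i x e)); apply: d_imp => //.
by apply: d_mem; [exact: tm_var|exact: tm_shift].
Qed.

Lemma d_bex t (Q : ix F -> U -> (nat -> U) -> Prop) : tm t ->
  dfn (fun i e => Q i (e 0) (fun n => e (S n))) -> dfn (fun i e => exists x, x ∈ t i e /\ Q i x e).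
Proof.
move=> Ht H; apply: (d_ext (Q' := fun i e => exists x, cl F i x /\ x ∈ t i e /\ Q i x e)).
  move=> i e He; split; last by move=> [x [_ K]]; exists x.
  by move=> [x [Hx K]]; exists x; split=> //; apply: fr_trans Hx; apply: tm_in.
apply: (d_ex (Q := fun i x e => x ∈ t i e /\ Q i x e)); apply: d_and => //.
by apply: d_mem; [exact: tm_var|exact: tm_shift].
Qed.

(** This serves when the formula itself is arbitrary, as in the schema of elementarity and in the
    formula that defines the critical point for a standard measure. *)
Lemma d_sat phi : forall T : nat -> ix F -> (nat -> U) -> U, (forall n, tm (T n)) ->
  dfn (fun i e => sat (cl F i) (fun n => T n i e) phi).
Proof.
elim: phi => /= [i k|i k||p IHp q IHq|p IH] T HT.
- exact: d_mem.
- exact: d_eq.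
- exact: d_bot.
- by apply: d_imp; [exact: IHp|exact: IHq].
- apply: (d_all (Q := fun i x e => sat (cl F i) (scons x (fun n => T n i e)) p)).
  pose T' n := match n with 0 => fun (i : ix F) (e : nat -> U) => e 0
    | S n => fun i e => T n i (fun n => e (S n)) end.
  have /IH : forall n, tm (T' n).
    by case=> [|n]; [exact: (tm_var 0)|exact: tm_shift].
  apply: d_ext => i e He; apply: sat_ext; by case.
Qed.

End Definable.


Create HintDb dpar.

Ltac tm_solve :=
  cbv beta;
  first [ assumption
        | apply tm_var
        | apply tm_ren; assumption
        | apply tm_par; cbn; first [ assumption | solve [eauto 6 with dpar] ] ].

Ltac ap1 H := apply H; [tm_solve].
Ltac ap2 H := apply H; [tm_solve | tm_solve].
Ltac ap3 H := apply H; [tm_solve | tm_solve | tm_solve].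
Ltac apq H := apply H; [tm_solve | ].
Ltac apqq H := apply H; [tm_solve | tm_solve | ].

(* Slots that are filled as the definability lemmas become available. *)
Ltac d_nt1 := fail.
Ltac d_nt2 := fail.
Ltac d_nt3 := fail.
Ltac d_nt4 := fail.
Ltac d_nt5 := fail.
Ltac d_nt6 := fail.
Ltac d_nt7 := fail.
Ltac d_nt8 := fail.
Ltac d_nt9 := fail.
Ltac d_notion :=
  first [d_nt1 | d_nt2 | d_nt3 | d_nt4 | d_nt5 | d_nt6 | d_nt7 | d_nt8 | d_nt9].

Ltac dstep :=
  cbv beta;
  first [ assumption
        | d_notion
        | apply d_mem; [tm_solve | tm_solve]
        | apply d_eq; [tm_solve | tm_solve]
        | apply d_bot
        | apply d_ball; [tm_solve | ]
        | apply d_bex; [tm_solve | ]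
        | apply d_all
        | apply d_ex
        | apply d_iff
        | apply d_and
        | apply d_or
        | apply d_not
        | apply d_imp ].

Ltac dsolve := repeat dstep.

Section Notions.
Context {U : universe} (F : frame U).
Implicit Types (t : ix F -> (nat -> U) -> U).

Lemma pair_in (C : class U) x a b : transitive_class C -> C x -> is_pair x a b -> C a /\ C b.
Proof.
move=> T Cx P; split.
- by case: (pair_fst_mem P) => s [Hs Ha]; apply: (T s) => //; apply: (T x).
- by case: (pair_snd_mem P) => s [Hs Ha]; apply: (T s) => //; apply: (T x).
Qed.

Lemma app_in (C : class U) g a b : transitive_class C -> C g -> app g a b -> C a /\ C b.
Proof. by move=> T Cg [x [Hx P]]; apply: (pair_in T (x := x)) => //; apply: (T g). Qed.

Lemma d_subset t1 t2 : tm t1 -> tm t2 -> dfn (fun i e => subset (t1 i e) (t2 i e)).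
Proof. move=> H1 H2; rewrite /subset; dsolve. Qed.

Lemma d_upair t1 t2 t3 : tm t1 -> tm t2 -> tm t3 ->
  dfn (fun i e => is_upair (t1 i e) (t2 i e) (t3 i e)).
Proof.
move=> H1 H2 H3; apply: (d_ext (Q' := fun i e => forall z, cl F i z ->
  (z ∈ t1 i e <-> z = t2 i e \/ z = t3 i e))); last by dsolve.
move=> i e He; split=> H z; first by move=> _; apply: H.
split=> K; first by apply/H => //; apply: fr_trans K; apply: tm_in.
apply/H => //; by case: K => ->; apply: tm_in.
Qed.

Ltac d_nt1 ::= first [ap2 @d_subset | ap3 @d_upair].

Lemma d_pair t1 t2 t3 : tm t1 -> tm t2 -> tm t3 ->
  dfn (fun i e => is_pair (t1 i e) (t2 i e) (t3 i e)).
Proof.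
move=> H1 H2 H3; apply: (d_ext (Q' := fun i e => exists s, s ∈ t1 i e /\ exists s', s' ∈ t1 i e /\
  is_upair s (t2 i e) (t2 i e) /\ is_upair s' (t2 i e) (t3 i e) /\ is_upair (t1 i e) s s')); last by dsolve.
move=> i e He; split; last by move=> [s [_ [t [_ H]]]]; exists s, t.
move=> [s [t [A [B D]]]]; exists s; split; first by apply/D; left.
by exists t; split; first by apply/D; right.
Qed.

Ltac d_nt2 ::= ap3 @d_pair.

Lemma d_app t1 t2 t3 : tm t1 -> tm t2 -> tm t3 ->
  dfn (fun i e => app (t1 i e) (t2 i e) (t3 i e)).
Proof. move=> H1 H2 H3; rewrite /app; dsolve. Qed.

Lemma d_all_pair t (Q : ix F -> U -> U -> (nat -> U) -> Prop) : tm t ->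
  dfn (fun i e => Q i (e 1) (e 0) (fun n => e (S (S n)))) ->
  dfn (fun i e => forall a b, is_pair (t i e) a b -> Q i a b e).
Proof.
move=> Ht H; apply: (d_ext (Q' := fun i e => forall a, cl F i a -> forall b, cl F i b ->
   is_pair (t i e) a b -> Q i a b e)); last by dsolve.
move=> i e He; split=> K a; first by move=> _ b _; apply: K.
move=> b P; case: (pair_in (@fr_trans _ F i) (tm_in Ht He) P) => Ca Cb; exact: K.
Qed.

Lemma d_ex_pair t (Q : ix F -> U -> U -> (nat -> U) -> Prop) : tm t ->
  dfn (fun i e => Q i (e 1) (e 0) (fun n => e (S (S n)))) ->
  dfn (fun i e => exists a b, is_pair (t i e) a b /\ Q i a b e).
Proof.
move=> Ht H; apply: (d_ext (Q' := fun i e => exists a, cl F i a /\ exists b, cl F i b /\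
   is_pair (t i e) a b /\ Q i a b e)); last by dsolve.
move=> i e He; split; last by move=> [a [_ [b [_ K]]]]; exists a, b.
move=> [a [b [P K]]]; exists a; case: (pair_in (@fr_trans _ F i) (tm_in Ht He) P) => Ca Cb.
by split=> //; exists b.
Qed.

Ltac d_nt3 ::= first [ap3 @d_app | apq @d_all_pair | apq @d_ex_pair].

Lemma d_all_app t (Q : ix F -> U -> U -> (nat -> U) -> Prop) : tm t ->
  dfn (fun i e => Q i (e 1) (e 0) (fun n => e (S (S n)))) ->
  dfn (fun i e => forall a b, app (t i e) a b -> Q i a b e).
Proof.
move=> Ht H; apply: (d_ext (Q' := fun i e => forall a, cl F i a -> forall b, cl F i b ->
   app (t i e) a b -> Q i a b e)); last by dsolve.
move=> i e He; split=> K a; first by move=> _ b _; apply: K.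
move=> b P; case: (app_in (@fr_trans _ F i) (tm_in Ht He) P) => Ca Cb; exact: K.
Qed.

Lemma d_ex_app t (Q : ix F -> U -> U -> (nat -> U) -> Prop) : tm t ->
  dfn (fun i e => Q i (e 1) (e 0) (fun n => e (S (S n)))) ->
  dfn (fun i e => exists a b, app (t i e) a b /\ Q i a b e).
Proof.
move=> Ht H; apply: (d_ext (Q' := fun i e => exists a, cl F i a /\ exists b, cl F i b /\
   app (t i e) a b /\ Q i a b e)); last by dsolve.
move=> i e He; split; last by move=> [a [_ [b [_ K]]]]; exists a, b.
move=> [a [b [P K]]]; exists a; case: (app_in (@fr_trans _ F i) (tm_in Ht He) P) => Ca Cb.
by split=> //; exists b.
Qed.

Lemma d_all_val t s (Q : ix F -> U -> (nat -> U) -> Prop) : tm t -> tm s ->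
  dfn (fun i e => Q i (e 0) (fun n => e (S n))) ->
  dfn (fun i e => forall b, app (t i e) (s i e) b -> Q i b e).
Proof.
move=> Ht Hs H; apply: (d_ext (Q' := fun i e => forall b, cl F i b ->
   app (t i e) (s i e) b -> Q i b e)); last by dsolve.
move=> i e He; split=> K a; first by move=> _; apply: K.
by move=> P; case: (app_in (@fr_trans _ F i) (tm_in Ht He) P) => Ca Cb; exact: K.
Qed.

Lemma d_ex_val t s (Q : ix F -> U -> (nat -> U) -> Prop) : tm t -> tm s ->
  dfn (fun i e => Q i (e 0) (fun n => e (S n))) ->
  dfn (fun i e => exists b, app (t i e) (s i e) b /\ Q i b e).
Proof.
move=> Ht Hs H; apply: (d_ext (Q' := fun i e => exists b, cl F i b /\
   app (t i e) (s i e) b /\ Q i b e)); last by dsolve.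
move=> i e He; split; last by move=> [a [_ K]]; exists a.
move=> [b [P K]]; exists b; by case: (app_in (@fr_trans _ F i) (tm_in Ht He) P).
Qed.

Lemma d_ex_arg t s (Q : ix F -> U -> (nat -> U) -> Prop) : tm t -> tm s ->
  dfn (fun i e => Q i (e 0) (fun n => e (S n))) ->
  dfn (fun i e => exists a, app (t i e) a (s i e) /\ Q i a e).
Proof.
move=> Ht Hs H; apply: (d_ext (Q' := fun i e => exists a, cl F i a /\
   app (t i e) a (s i e) /\ Q i a e)); last by dsolve.
move=> i e He; split; last by move=> [a [_ K]]; exists a.
move=> [b [P K]]; exists b; by case: (app_in (@fr_trans _ F i) (tm_in Ht He) P).
Qed.

Ltac d_nt4 ::= first [apq @d_all_app | apq @d_ex_app | apqq @d_all_val | apqq @d_ex_val | apqq @d_ex_arg].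

Lemma d_ispair t : tm t -> dfn (fun i e => exists a b, is_pair (t i e) a b).
Proof.
move=> H; apply: (d_ext (Q' := fun i e => exists a b, is_pair (t i e) a b /\ ~ False)); last by dsolve.
by move=> i e _; split=> [[a [b P]]|[a [b [P _]]]]; exists a, b; tauto.
Qed.

Lemma d_indom t s : tm t -> tm s -> dfn (fun i e => exists b, app (t i e) (s i e) b).
Proof.
move=> H H'; apply: (d_ext (Q' := fun i e => exists b, app (t i e) (s i e) b /\ ~ False)); last by dsolve.
by move=> i e _; split=> [[a P]|[a [P _]]]; exists a; tauto.
Qed.

Lemma d_inran t s : tm t -> tm s -> dfn (fun i e => exists a, app (t i e) a (s i e)).
Proof.
move=> H H'; apply: (d_ext (Q' := fun i e => exists a, cl F i a /\ app (t i e) a (s i e))); last by dsolve.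
move=> i e He; split=> [[a P]|[a [_ P]]]; exists a => //; split=> //.
by case: (app_in (@fr_trans _ F i) (tm_in H He) P).
Qed.

Ltac d_nt5 ::= first [ap1 @d_ispair | ap2 @d_indom | ap2 @d_inran].

Lemma d_function t : tm t -> dfn (fun i e => is_function (t i e)).
Proof.
move=> H; rewrite /is_function; apply: d_and; first by dsolve.
apply: (d_ext (Q' := fun i e => forall a b, app (t i e) a b -> forall b', app (t i e) a b' -> b = b')).
  by move=> i e _; split=> K a b *; [apply: (K a)|apply: (K a b)].
dsolve.
Qed.

Lemma d_transset t : tm t -> dfn (fun i e => transitive_set (t i e)).
Proof. move=> H; rewrite /transitive_set; dsolve. Qed.

Lemma d_dom t1 t2 : tm t1 -> tm t2 -> dfn (fun i e => is_dom (t1 i e) (t2 i e)).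
Proof.
move=> H1 H2; apply: (d_ext (Q' := fun i e => forall a, cl F i a -> (a ∈ t1 i e <-> exists b, app (t2 i e) a b)));
  last by dsolve.
move=> i e He; split=> H a; first by move=> _; apply: H.
split=> K; first by apply/H => //; apply: fr_trans K; apply: tm_in.
apply/H => //; by case: K => b /(app_in (@fr_trans _ F i) (tm_in H2 He)) [].
Qed.

Lemma d_restriction t1 t2 t3 : tm t1 -> tm t2 -> tm t3 ->
  dfn (fun i e => is_restriction (t1 i e) (t2 i e) (t3 i e)).
Proof.
move=> H1 H2 H3; apply: (d_ext (Q' := fun i e => forall y, cl F i y ->
  (y ∈ t1 i e <-> y ∈ t2 i e /\ exists a b, is_pair y a b /\ a ∈ t3 i e))); last by dsolve.
move=> i e He; split=> H a; first by move=> _; apply: H.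
split=> K; first by apply/H => //; apply: fr_trans K; apply: tm_in.
by apply/H => //; case: K => K _; apply: fr_trans K; apply: tm_in.
Qed.

Ltac d_nt6 ::= first [ap1 @d_function | ap1 @d_transset | ap2 @d_dom | ap3 @d_restriction].

Lemma d_ordinal t : tm t -> dfn (fun i e => ordinal (t i e)).
Proof. move=> H; rewrite /ordinal; dsolve. Qed.

Lemma d_maps t1 t2 t3 : tm t1 -> tm t2 -> tm t3 ->
  dfn (fun i e => maps (t1 i e) (t2 i e) (fun b => b ∈ t3 i e)).
Proof. move=> H1 H2 H3; rewrite /maps; dsolve. Qed.

Ltac d_nt7 ::= first [ap1 @d_ordinal | ap3 @d_maps].

Lemma d_equinumerous t1 t2 : tm t1 -> tm t2 ->
  dfn (fun i e => equinumerous (cl F i) (t1 i e) (t2 i e)).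
Proof.
move=> H1 H2; apply: (d_ext (Q' := fun i e => exists g, cl F i g /\
   maps g (t1 i e) (fun b => b ∈ t2 i e) /\
  (forall a b, app g a b -> forall a', cl F i a' -> app g a' b -> a = a') /\
    (forall b, b ∈ t2 i e -> exists a, app g a b))); last by dsolve.
move=> i e He; split; move=> [g [Cg [M [J K]]]]; exists g; split=> //; split=> //; split=> //.
- by move=> a b A a' _ B; apply: (J a a' b).
- by move=> a a' b A B; apply: (J a b) => //; case: (app_in (@fr_trans _ F i) Cg B).
Qed.

Ltac d_nt8 ::= ap2 @d_equinumerous.

Lemma d_card_lt t1 t2 : tm t1 -> tm t2 ->
  dfn (fun i e => card_lt (cl F i) (t1 i e) (t2 i e)).
Proof. move=> H1 H2; rewrite /card_lt; dsolve. Qed.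

Lemma d_cardinal t : tm t -> dfn (fun i e => cardinal (cl F i) (t i e)).
Proof. move=> H; rewrite /cardinal; dsolve. Qed.

Ltac d_nt8 ::= first [ap2 @d_equinumerous | ap2 @d_card_lt | ap1 @d_cardinal].

Lemma d_succ_card t1 t2 : tm t1 -> tm t2 ->
  dfn (fun i e => is_succ_card (cl F i) (t1 i e) (t2 i e)).
Proof.
move=> H1 H2; apply: (d_ext (Q' := fun i e => cardinal (cl F i) (t2 i e) /\ t1 i e ∈ t2 i e /\
  forall m, cl F i m -> cardinal (cl F i) m -> t1 i e ∈ m -> t2 i e = m \/ t2 i e ∈ m)).
  move=> i e He; rewrite /is_succ_card; split; first by case.
  by split=> //; apply: tm_in.
dsolve.
Qed.

Lemma d_hereditary t1 t2 : tm t1 -> tm t2 ->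
  dfn (fun i e => hereditary (cl F i) (t1 i e) (t2 i e)).
Proof.
move=> H1 H2; apply: (d_ext (Q' := fun i e => exists c, cl F i c /\ is_trans_closure (cl F i) (t2 i e) c /\
   card_lt (cl F i) c (t1 i e))).
  move=> i e He; rewrite /hereditary; split; first by case.
  by split=> //; apply: tm_in.
rewrite /is_trans_closure; dsolve.
Qed.

Lemma d_limit t : tm t -> dfn (fun i e => limit (t i e)).
Proof.
move=> H; apply: (d_ext (Q' := fun i e => ordinal (t i e) /\ (exists y, y ∈ t i e /\ ~ False) /\
  forall y, y ∈ t i e -> exists z, z ∈ t i e /\ y ∈ z)); last by dsolve.
move=> i e _; rewrite /limit; split=> [[A [[y B] D]]|[A [[y [B _]] D]]]; split=> //; split=> //; exists y; tauto.
Qed.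

Ltac d_nt8 ::= first [ap2 @d_equinumerous | ap2 @d_card_lt | ap1 @d_cardinal
  | ap2 @d_succ_card | ap2 @d_hereditary | ap1 @d_limit].

Lemma d_inaccessible t : tm t -> dfn (fun i e => inaccessible (cl F i) (t i e)).
Proof.
move=> H; rewrite /inaccessible; apply: d_and; first exact: d_cardinal.
apply: d_and.
  apply: (d_ext (Q' := fun i e => exists w, w ∈ t i e /\ is_omega w)).
    by move=> i e _; split=> [[w [A B]]|[w [A B]]]; exists w.
  rewrite /is_omega; dsolve.
apply: d_and.
  rewrite /regular; apply: d_and; first exact: d_limit.
  apply: (d_ext (Q' := fun i e => forall a, a ∈ t i e -> forall g, cl F i g ->
    maps g a (fun b => b ∈ t i e) -> exists c, c ∈ t i e /\ forall x b, app g x b -> b ∈ c)); last by dsolve.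
  by move=> i e _; split=> K a *; [apply: (K a)|apply: (K a)].
apply: (d_ext (Q' := fun i e => forall a, a ∈ t i e -> forall u, cl F i u ->
  (forall y, cl F i y -> (y ∈ u <-> subset y a)) -> card_lt (cl F i) u (t i e))).
{ move=> i e He; split=> K a.
  - move=> Ha u Cu Hu; apply: (K a) => // y; split=> [Hy|[Cy Hy]]; last by apply/Hu.
    have Cy : cl F i y by apply: fr_trans Hy.
    by split=> //; apply/Hu.
  - move=> u Ha Cu Hu; apply: (K a) => // y Cy; rewrite Hu; tauto. }
dsolve.
Qed.

End Notions.

Ltac d_nt1 ::= first [ap2 @d_subset | ap3 @d_upair].
Ltac d_nt2 ::= ap3 @d_pair.
Ltac d_nt3 ::= first [ap3 @d_app | apq @d_all_pair | apq @d_ex_pair].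
Ltac d_nt4 ::= first [apq @d_all_app | apq @d_ex_app | apqq @d_all_val | apqq @d_ex_val | apqq @d_ex_arg].
Ltac d_nt5 ::= first [ap1 @d_ispair | ap2 @d_indom | ap2 @d_inran].
Ltac d_nt6 ::= first [ap1 @d_function | ap1 @d_transset | ap2 @d_dom | ap3 @d_restriction].
Ltac d_nt7 ::= first [ap1 @d_ordinal | ap3 @d_maps].
Ltac d_nt8 ::= first [ap2 @d_equinumerous | ap2 @d_card_lt | ap1 @d_cardinal
  | ap2 @d_succ_card | ap2 @d_hereditary | ap1 @d_limit | ap1 @d_inaccessible].

(** * Set theory inside a transitive model *)

Definition frame1 {U : universe} (C : class U) (T : transitive_class C) (ne : exists x, C x) : frame U.
Proof.
refine (@Frame U unit (fun _ => C) (fun c => C (c tt)) _ _ _).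
- by [].
- by move=> c [].
- by case: ne => x Hx; exists (fun _ => x).
Defined.

Lemma d_subst {U : universe} (F : frame U) (Q : ix F -> (nat -> U) -> Prop) : dfn Q ->
  forall T : nat -> ix F -> (nat -> U) -> U, (forall n, tm (T n)) -> dfn (fun i e => Q i (fun n => T n i e)).
Proof.
move=> [phi [c [Hc H]]] T HT.
pose T' := mix T (fun n i (_ : nat -> U) => c n i).
have HT' n : tm (T' n).
  by rewrite /T'; case: (even_odd n) => k [->|->]; rewrite ?mix_even ?mix_odd //; apply: tm_par.
apply: (d_ext (Q' := fun i e => sat (cl F i) (fun n => T' n i e) phi)); last exact: d_sat.
move=> i e He; rewrite H; first by move=> n; apply: tm_in.
by apply: sat_ext => n; rewrite /T' (mix_map (fun t => t i e)).
Qed.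

Lemma d_subst4 {U : universe} (F : frame U) (Q : U -> U -> U -> U -> Prop) t1 t2 t3 t4 :
  dfn (F := F) (fun i e => Q (e 0) (e 1) (e 2) (e 3)) -> tm t1 -> tm t2 -> tm t3 -> tm t4 ->
  dfn (F := F) (fun i e => Q (t1 i e) (t2 i e) (t3 i e) (t4 i e)).
Proof.
move=> H H1 H2 H3 H4.
apply: (d_subst H (T := fun n => match n with 0 => t1 | 1 => t2 | 2 => t3 | _ => t4 end)).
by move=> [|[|[|n]]].
Qed.

Lemma d_subst2 {U : universe} (F : frame U) (Q : U -> U -> Prop) t1 t2 :
  dfn (F := F) (fun i e => Q (e 0) (e 1)) -> tm t1 -> tm t2 ->
  dfn (F := F) (fun i e => Q (t1 i e) (t2 i e)).
Proof.
move=> H H1 H2; apply: (d_subst H (T := fun n => match n with 0 => t1 | _ => t2 end)).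
by case.
Qed.

Lemma d_subst3 {U : universe} (F : frame U) (Q : U -> U -> U -> Prop) t1 t2 t3 :
  dfn (F := F) (fun i e => Q (e 0) (e 1) (e 2)) -> tm t1 -> tm t2 -> tm t3 ->
  dfn (F := F) (fun i e => Q (t1 i e) (t2 i e) (t3 i e)).
Proof.
move=> H H1 H2 H3; apply: (d_subst H (T := fun n => match n with 0 => t1 | 1 => t2 | _ => t3 end)).
by move=> [|[|n]].
Qed.

Fixpoint fbound (phi : fm) : nat :=
  match phi with
  | FMem i k | FEq i k => S (Nat.max i k)
  | FBot => 0
  | FImp p q => Nat.max (fbound p) (fbound q)
  | FAll p => Nat.pred (fbound p)
  end.

Lemma sat_bound {U : universe} (C : class U) phi : forall e e' : nat -> U,
  (forall n, n < fbound phi -> e n = e' n) -> (sat C e phi <-> sat C e' phi).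
Proof.
elim: phi => /= [i k|i k||p IHp q IHq|p IH] e e' H //.
- have -> : e i = e' i by apply: H; lia.
  by have -> : e k = e' k by apply: H; lia.
- have -> : e i = e' i by apply: H; lia.
  by have -> : e k = e' k by apply: H; lia.
- by rewrite (IHp e e') ?(IHq e e') // => n lt; apply: H; lia.
- have E x : sat C (scons x e) p <-> sat C (scons x e') p.
    by apply: IH => [[|n]] lt //=; apply: H; lia.
  by split=> K x Cx; apply/E/K.
Qed.

(** No formula quantifies over a whole assignment, but only finitely many variables occur in [phi].
    The first [n] are quantified, the [k]-th one over the elements satisfying [Q k], and [r] fills
    the rest. Together with [sat_bound] this makes statements about all assignments transferable. *)
Fixpoint alln {U : universe} (C : class U) (Q : nat -> U -> Prop) (phi : fm) (n : nat) (r : nat -> U) : Prop :=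
  match n with
  | 0 => sat C r phi
  | S n => forall x, C x -> Q n x -> alln C Q phi n (fun m => if Nat.eqb m n then x else r m)
  end.

Lemma alln_intro {U : universe} (C : class U) Q phi n : forall r,
  (forall x : nat -> U, (forall k, k < n -> C (x k) /\ Q k (x k)) ->
     sat C (fun m => if Nat.ltb m n then x m else r m) phi) -> alln C Q phi n r.
Proof.
elim: n => [|n IH] r H /=; first by apply: (H r) => k; lia.
move=> x0 Cx Qx; apply: IH => x Hx.
apply: (proj1 (sat_ext _ _ _) (H (fun m => if Nat.eqb m n then x0 else x m) _)).
- move=> m; case: (Nat.ltb_spec m (S n)); case: (Nat.eqb_spec m n); case: (Nat.ltb_spec m n) => //; lia.
- by move=> k lt; case: (Nat.eqb_spec k n) => [->//|ne]; apply: Hx; lia.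
Qed.

Lemma alln_elim {U : universe} (C : class U) Q phi n : forall r, alln C Q phi n r ->
  forall x : nat -> U, (forall k, k < n -> C (x k) /\ Q k (x k)) ->
     sat C (fun m => if Nat.ltb m n then x m else r m) phi.
Proof.
elim: n => [|n IH] r /= H x Hx; first exact: (proj1 (sat_ext _ _ _) H).
have [Cn Qn] := Hx n (Nat.lt_succ_diag_r n).
have Hx' k : k < n -> C (x k) /\ Q k (x k) by move=> lt; apply: Hx; lia.
apply: (proj1 (sat_ext _ _ _) (IH _ (H (x n) Cn Qn) x Hx')) => m.
case: (Nat.ltb_spec m (S n)); case: (Nat.ltb_spec m n); case: (Nat.eqb_spec m n) => //; try lia.
by move=> ->.
Qed.

Lemma d_alln {U : universe} (F : frame U) (Q : ix F -> (nat -> U) -> nat -> U -> Prop) phi n :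
  forall (r : nat -> nat) (T : nat -> ix F -> (nat -> U) -> U), (forall m, tm (T m)) ->
  (forall k r, dfn (F := F) (fun i e => Q i (fun m => e (r m)) k (e 0))) ->
  dfn (F := F) (fun i e => alln (cl F i) (Q i (fun m => e (r m))) phi n (fun m => T m i e)).
Proof.
elim: n => [|n IH] r T HT dQ /=; first exact: d_sat.
apply d_all; apply d_imp; first exact: (dQ n (fun m => S (r m))).
pose T' m := if Nat.eqb m n then fun (i : ix F) (e : nat -> U) => e 0 else fun i e => T m i (fun k => e (S k)).
have HT' m : tm (T' m) by rewrite /T'; case: (Nat.eqb m n); [exact: (@tm_var U F 0)|exact: tm_shift].
apply: d_ext (IH (fun m => S (r m)) T' HT' dQ) => i e _.
suff -> : (fun m => if Nat.eqb m n then e 0 else T m i (fun k => e (S k))) = fun m => T' m i e by [].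
by apply: functional_extensionality => m; rewrite /T'; case: (Nat.eqb m n).
Qed.

Definition pick {U : universe} (j : U -> U) (x : U) (i : bool) : U := if i then x else j x.
Arguments pick {U} j x i : simpl never.

Definition par_pick {U : universe} (W : class U) (j : U -> U) (c : bool -> U) :=
  exists x, W x /\ c = pick j x.

Lemma par_pick_intro {U : universe} (W : class U) (j : U -> U) x : W x -> par_pick W j (pick j x).
Proof. by exists x. Qed.

Definition frame2 {U : universe} (W N : class U) (j : U -> U) (TW : transitive_class W)
  (TN : transitive_class N) (ne : exists x, W x) (Hj : forall x, W x -> N (j x)) : frame U.
Proof.
refine (@Frame U bool (fun i => if i then W else N) (par_pick W j) _ _ _).
- by case.
- by move=> c [] [x [Wx ->]] //; apply: Hj.
- by case: ne => x Wx; exists (pick j x), x.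
Defined.

(** The formula that expresses [Q] is the same for both classes and its constants are [x] in [W] and
    [j x] in [N], so elementarity applies. As [Q] ignores the assignment, the variables may be given
    any values. *)
Lemma transfer {U : universe} (W N : class U) (j : U -> U) TW TN ne (El : elementary W N j) (Q : bool -> Prop) :
  dfn (F := @frame2 U W N j TW TN ne (proj1 El)) (fun i _ => Q i) -> (Q true <-> Q false).
Proof.
move=> [phi [c [Hc H]]]; have [x0 W0] := ne.
have /choice [d Hd] : forall n, exists x, W x /\ c n = pick j x by move=> n; exact (Hc n).
rewrite (H true (fun _ => x0)) //= (H false (fun _ => j x0)) /=; first by move=> n; apply: (proj1 El).
rewrite (proj2 El phi); first by move=> n; case: (even_odd n) => k [->|->]; rewrite ?mix_even ?mix_odd //;
  case: (Hd k) => Wd ->.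
apply: sat_ext => n; case: (even_odd n) => k [->|->]; rewrite ?mix_even ?mix_odd //; by case: (Hd k) => Wd ->.
Qed.

(** What is definable over both classes at once is definable over the first alone, where separation
    is available. *)
Lemma d_proj {U : universe} (W N : class U) (j : U -> U) TW TN ne Hj (Q : bool -> (nat -> U) -> Prop) :
  dfn (F := @frame2 U W N j TW TN ne Hj) Q -> dfn (F := frame1 TW ne) (fun _ e => Q true e).
Proof.
move=> [phi [c [Hc H]]]; exists phi, (fun n _ => c n true); split=> [n|i e He]; last exact: (H true e He).
by case: (Hc n) => x [Wx ->].
Qed.

Lemma zfc_ne {U : universe} (C : class U) : ZFC C -> exists x, C x.
Proof. by move=> /zfc_infinity [x [Hx _]]; exists x. Qed.

(** Separation is a hypothesis because the lemma is applied both to [V], where it is an axiom, and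
    to the extension, where it comes from the truth lemma. *)
Lemma dfn_sep {U : universe} (C : class U) (T : transitive_class C) (ne : exists x, C x) :
  (forall phi e x, (forall n, C (e n)) -> C x ->
    exists u, C u /\ forall z, C z -> (z ∈ u <-> z ∈ x /\ sat C (scons z e) phi)) ->
  forall x (Q : U -> Prop), C x -> dfn (F := frame1 T ne) (fun _ e => Q (e 0)) ->
  exists u, C u /\ forall z, z ∈ u <-> z ∈ x /\ Q z.
Proof.
move=> S x Q Vx [phi [c [Hc H]]].
case: (S (ren (mix (fun _ => 0) Datatypes.S) phi) (fun n => c n tt) x) => //.
move=> u [Vu Hu]; exists u; split=> // z.
have E : C z -> (Q z <-> sat C (scons z (fun n => c n tt)) (ren (mix (fun _ => 0) Datatypes.S) phi)).
  move=> Vz; rewrite sat_ren (H tt (fun _ => z)) //=; apply: sat_ext => n.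
  by case: (even_odd n) => k [->|->]; rewrite ?mix_even ?mix_odd.
split=> [Hz|[Hz Qz]]; have Vz : C z by apply: (T _ _ _ Hz).
- by case/(Hu z Vz): Hz => Hz /E Qz; split=> //; apply: Qz.
- by apply/(Hu z Vz); split=> //; apply/E.
Qed.

Section Model.
Context {U : universe} (V : class U) (V_trans : transitive_class V) (V_ZFC : ZFC V).
Implicit Types (x y z a b c d u v w g h : U).

Local Notation FV := (frame1 V_trans (zfc_ne V_ZFC)).

Lemma V_in x y : V x -> y ∈ x -> V y.
Proof. exact: V_trans. Qed.

Lemma sep x (Q : U -> Prop) : V x -> dfn (F := FV) (fun _ e => Q (e 0)) ->
  exists u, V u /\ forall z, z ∈ u <-> z ∈ x /\ Q z.
Proof. exact: (dfn_sep (zfc_separation _ V_ZFC)). Qed.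

Lemma repl x (Q : U -> U -> Prop) : V x -> dfn (F := FV) (fun _ e => Q (e 0) (e 1)) ->
  (forall a, a ∈ x -> exists b, V b /\ Q a b /\ forall b', V b' -> Q a b' -> b' = b) ->
  exists u, V u /\ forall b, b ∈ u <-> V b /\ exists a, a ∈ x /\ Q a b.
Proof.
move=> Vx [phi [c [Hc H]]] fnl.
pose phi' := ren (mix (fun k => match k with 0 => 0 | _ => 1 end) (fun k => S (S k))) phi.
have E a b : V a -> V b -> (Q a b <-> sat V (scons a (scons b (fun n => c n tt))) phi').
  move=> Va Vb; rewrite sat_ren (H tt (fun n => match n with 0 => a | _ => b end)) /=; first by case.
  by apply: sat_ext => n; case: (even_odd n) => k [->|->]; rewrite ?mix_even ?mix_odd //; case: k.
case: (zfc_replacement _ V_ZFC phi' (fun n => c n tt) x) => //.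
  move=> a Va Ha; case: (fnl a Ha) => b [Vb [Qab uniq]]; exists b; split=> // b' Vb'.
  by rewrite -E //; split=> [|->] //; apply: uniq.
move=> u [Vu Hu]; exists u; split=> // b; split=> [Hb|[Vb [a [Ha Qab]]]].
- have Vb : V b by apply: V_in Hb.
  by split=> //; case/(Hu b Vb): Hb => a [Va [Ha /E Qab]]; exists a; split=> //; apply: Qab.
- have Va : V a by apply: V_in Ha.
  by apply/(Hu b Vb); exists a; split=> //; split=> //; apply/E.
Qed.

Lemma V_empty : exists o, V o /\ forall z, ~ z ∈ o.
Proof.
case: (zfc_ne V_ZFC) => x Vx; case: (sep (x := x) (Q := fun _ => False)) => //; first exact: d_bot.
by move=> o [Vo Ho]; exists o; split=> // z /Ho [].
Qed.

Lemma V_upair a b : V a -> V b -> exists x, V x /\ is_upair x a b.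
Proof.
move=> Va Vb; case: (zfc_pairing _ V_ZFC _ _ Va Vb) => x [Vx Hx]; exists x; split=> // z.
split=> [Hz|Hz]; first by apply/Hx => //; apply: V_in Hz.
by apply/Hx => //; case: Hz => ->.
Qed.

Lemma V_pair a b : V a -> V b -> exists x, V x /\ is_pair x a b.
Proof.
move=> Va Vb; case: (V_upair Va Va) => s [Vs Hs]; case: (V_upair Va Vb) => t [Vt Ht].
by case: (V_upair Vs Vt) => x [Vx Hx]; exists x; split=> //; exists s, t.
Qed.

Lemma V_union x : V x -> exists u, V u /\ forall z, z ∈ u <-> exists y, y ∈ x /\ z ∈ y.
Proof.
move=> Vx; case: (zfc_union _ V_ZFC _ Vx) => u [Vu Hu]; exists u; split=> // z; split=> [Hz|[y [Hy Hz]]].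
- have Vz : V z by apply: V_in Hz.
  by case/(Hu z Vz): Hz => y [_ H]; exists y.
- have Vy := V_in Vx Hy; apply/(Hu z (V_in Vy Hz)); by exists y.
Qed.

Lemma V_cup a b : V a -> V b -> exists u, V u /\ forall z, z ∈ u <-> z ∈ a \/ z ∈ b.
Proof.
move=> Va Vb; case: (V_upair Va Vb) => x [Vx Hx]; case: (V_union Vx) => u [Vu Hu]; exists u; split=> // z.
rewrite Hu; split=> [[y [/Hx [->|->]]]|[H|H]]; [by left|by right| |].
- by exists a; split=> //; apply/Hx; left.
- by exists b; split=> //; apply/Hx; right.
Qed.

Lemma V_single a : V a -> exists u, V u /\ forall z, z ∈ u <-> z = a.
Proof.
by move=> Va; case: (V_upair Va Va) => u [Vu Hu]; exists u; split=> // z; rewrite Hu; tauto.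
Qed.

Lemma V_adjoin a b : V a -> V b -> exists u, V u /\ forall z, z ∈ u <-> z ∈ a \/ z = b.
Proof.
move=> Va Vb; case: (V_single Vb) => s [Vs Hs]; case: (V_cup Va Vs) => u [Vu Hu]; exists u.
by split=> // z; rewrite Hu Hs.
Qed.

Lemma V_power x : V x -> exists u, V u /\ forall z, z ∈ u <-> V z /\ subset z x.
Proof.
move=> Vx; case: (zfc_power _ V_ZFC _ Vx) => u [Vu Hu]; exists u; split=> // z; split=> [Hz|[Vz S]].
- have Vz : V z by apply: V_in Hz.
  by split=> // y Hy; apply: (proj1 (Hu z Vz) Hz y) => //; apply: V_in Hy.
- by apply/(Hu z Vz) => y _; apply: S.
Qed.

Lemma V_prod a b : V a -> V b ->
  exists u, V u /\ forall z, z ∈ u <-> exists x y, x ∈ a /\ y ∈ b /\ is_pair z x y.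
Proof.
move=> Va Vb; case: (V_cup Va Vb) => c [Vc Hc]; case: (V_power Vc) => p [Vp Hp].
case: (V_power Vp) => q [Vq Hq].
case: (sep (x := q) (Q := fun z => exists x, x ∈ a /\ exists y, y ∈ b /\ is_pair z x y)) => //; first by dsolve.
move=> u [Vu Hu]; exists u; split=> // z; rewrite Hu; split.
  by move=> [_ [x [Hx [y H]]]]; exists x, y.
move=> [x [y [Hx [Hy P]]]]; split; last by exists x; split=> //; exists y.
have Vx := V_in Va Hx; have Vy := V_in Vb Hy; case: (V_pair Vx Vy) => z' [Vz' P'].
have E := pair_unique P P'; subst z'; apply/Hq; split=> // s Hs.
have Vs := V_in Vz' Hs; apply/Hp; split=> // v Hv; apply/Hc.
case: P => s1 [s2 [H1 [H2 H3]]]; case/H3: Hs => E; subst s.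
- by left; case/H1: Hv => ->.
- by case/H2: Hv => ->; tauto.
Qed.

Lemma V_func x (Q : U -> U -> Prop) : V x -> dfn (F := FV) (fun _ e => Q (e 0) (e 1)) ->
  (forall a b b', a ∈ x -> V b -> V b' -> Q a b -> Q a b' -> b = b') ->
  exists g, V g /\ is_function g /\ forall a b, app g a b <-> a ∈ x /\ V b /\ Q a b.
Proof.
move=> Vx dQ uniq.
case: (sep (x := x) (Q := fun a => exists b, V b /\ Q a b)) => //.
  by apply: d_ex; apply: (d_subst2 dQ); tm_solve.
move=> x' [Vx' Hx'].
case: (repl (x := x') (Q := fun a z => exists b, V b /\ Q a b /\ is_pair z a b)) => //.
{ apply: d_ex; apply: d_and; last by dsolve.
  by apply: (d_subst2 dQ); tm_solve. }
{ move=> a /Hx' [Ha [b [Vb Qab]]]; case: (V_pair (V_in Vx Ha) Vb) => z [Vz Pz].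
  exists z; split=> //; split; first by exists b.
  move=> z' Vz' [b' [Vb' [Qab' P']]]; rewrite (uniq _ _ _ Ha Vb' Vb Qab' Qab) in P'.
  exact: pair_unique P' Pz. }
move=> g [Vg Hg]; exists g; split=> //.
have A a b : app g a b <-> a ∈ x /\ V b /\ Q a b.
{ split=> [[z [/Hg [Vz [a' [/Hx' [Ha' _] [b' [Vb' [Qb' Pz]]]]]] P]]|[Ha [Vb Qab]]].
  - by case: (pair_inj P Pz) => -> ->.
  - case: (V_pair (V_in Vx Ha) Vb) => z [Vz Pz]; exists z; split=> //; apply/Hg; split=> //.
    by exists a; split; [apply/Hx'; split=> //; exists b|exists b]. }
split=> //; split=> [z /Hg [Vz [a [_ [b [_ [_ P]]]]]]|a b b' /A [Ha [Vb Qb]] /A [_ [Vb' Qb']]].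
- by exists a, b.
- exact: (uniq a).
Qed.

(** The induction along membership collects transitive sets around the elements. Replacement
    requires unique witnesses, hence the detour through the least such set [M]. *)
Lemma V_trans_ex x : V x -> exists t, V t /\ transitive_set t /\ x ∈ t.
Proof.
pose L x t := V t /\ transitive_set t /\ x ∈ t.
pose M x t := L x t /\ forall t', V t' -> transitive_set t' -> x ∈ t' -> subset t t'.
have LM y : V y -> (exists t, L y t) -> exists t, M y t.
{ move=> Vy [t [Vt [Tt yt]]].
  case: (sep (x := t) (Q := fun z => forall t', V t' -> transitive_set t' -> y ∈ t' -> z ∈ t')) => //; first by dsolve.
  move=> m [Vm Hm]; exists m; split.
  - split=> //; split; last by apply/Hm.
    move=> z /Hm [zt Hz] v vz; apply/Hm; split; first exact: (Tt z).
    by move=> t' Vt' Tt' yt'; apply: (Tt' z) => //; apply: Hz.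
  - by move=> t' Vt' Tt' yt' z /Hm [_]; apply. }
elim/(well_founded_ind (@mem_wf U)): x => x IH Vx.
case: (repl (x := x) (Q := M)) => //.
{ rewrite /M /L; apply: d_and; last by dsolve.
  by apply: (d_ext (Q' := fun _ e => transitive_set (e 1) /\ e 0 ∈ e 1)); [move=> i e /(_ 1) /= He; tauto|dsolve]. }
{ move=> a Ha; case: (LM a (V_in Vx Ha) (IH a Ha (V_in Vx Ha))) => t Mt; exists t.
  split; first by case: Mt => [[]].
  split=> // t' Vt' [[_ [T' a']] m']; case: Mt => [[Vt [T at_]] m].
  by apply: mem_ext => z; split; [apply: m'|apply: m]. }
move=> s [Vs Hs]; case: (V_union Vs) => u [Vu Hu]; case: (V_adjoin Vu Vx) => t [Vt Ht].
exists t; split=> //; split; last by apply/Ht; right.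
move=> z /Ht [/Hu [m [ms zm]]|->] v vz; apply/Ht; left; apply/Hu.
- exists m; split=> //; case/Hs: ms => _ [a [_ [[_ [T _]] _]]]; exact: (T z).
- case: (LM v (V_in Vx vz) (IH v vz (V_in Vx vz))) => m Mm; exists m; split; last by case: Mm => [[_ []]].
  by apply/Hs; split; [case: Mm => [[]]|exists v].
Qed.

(** ** Recursion *)

(* [F p x h y]: the value at [x] is [y] when [h] is the restriction of the
   function being defined to the elements of [x]; [p] is a parameter. *)
Section Recursion.
Context (F : U -> U -> U -> U -> Prop).
Context (F_dfn : dfn (F := FV) (fun _ e => F (e 0) (e 1) (e 2) (e 3))).
Context (F_tot : forall p x h, V p -> V x -> V h -> exists y, V y /\ F p x h y).
Context (F_fun : forall p x h y y', V p -> V x -> V h -> V y -> V y' -> F p x h y -> F p x h y' -> y = y').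

Definition attempt p g := is_function g /\ forall z w, app g z w ->
  (forall u, u ∈ z -> exists w', app g u w') /\
  exists h, V h /\ is_restriction h g z /\ F p z h w.

Definition Rec p x y := exists g, V g /\ attempt p g /\ app g x y.

Lemma restriction_unique h h' g g' z : V g -> V g' ->
  is_restriction h g z -> is_restriction h' g' z ->
  (forall u w, u ∈ z -> (app g u w <-> app g' u w)) -> h = h'.
Proof.
move=> Vg Vg' R R' E; apply: mem_ext => y; rewrite R R'; split=> [[yg [a [b [P az]]]]|[yg [a [b [P az]]]]].
- split; last by exists a, b. apply: (app_mem _ P); apply/E => //; exact: app_pair yg P.
- split; last by exists a, b. apply: (app_mem _ P); apply/E => //; exact: app_pair yg P.
Qed.

Lemma attempt_unique p g g' : V p -> V g -> V g' -> attempt p g -> attempt p g' ->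
  forall x y y', app g x y -> app g' x y' -> y = y'.
Proof.
move=> Vp Vg Vg' [fg A] [fg' A']; elim/(well_founded_ind (@mem_wf U)) => x IH y y' gy gy'.
case: (A _ _ gy) => D [h [Vh [R Fy]]]; case: (A' _ _ gy') => D' [h' [Vh' [R' Fy']]].
have E : h = h'.
{ apply: (restriction_unique Vg Vg' R R') => u w ux; split=> H.
  - by case: (D' u ux) => w' H'; rewrite (IH u ux w w').
  - by case: (D u ux) => w' H'; rewrite -(IH u ux w' w). }
subst h'; have [Vx Vy] := app_in V_trans Vg gy; have [_ Vy'] := app_in V_trans Vg' gy'.
exact: (F_fun Vp Vx Vh Vy Vy').
Qed.

Lemma Rec_fun p x y y' : V p -> Rec p x y -> Rec p x y' -> y = y'.
Proof. by move=> Vp [g [Vg [A H]]] [g' [Vg' [A' H']]]; apply: (attempt_unique Vp Vg Vg' A A' H H'). Qed.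

Lemma d_attempt t1 t2 : tm (F := FV) t1 -> tm (F := FV) t2 ->
  dfn (F := FV) (fun i e => attempt (t1 i e) (t2 i e)).
Proof.
move=> H1 H2; rewrite /attempt; dsolve; apply: (d_subst4 F_dfn); tm_solve.
Qed.

Lemma d_Rec t1 t2 t3 : tm (F := FV) t1 -> tm (F := FV) t2 -> tm (F := FV) t3 ->
  dfn (F := FV) (fun i e => Rec (t1 i e) (t2 i e) (t3 i e)).
Proof.
move=> H1 H2 H3; rewrite /Rec; apply: d_ex; apply: d_and; first by apply: d_attempt; tm_solve.
dsolve.
Qed.

Lemma Rec_in p x y : Rec p x y -> V x /\ V y.
Proof. by move=> [g [Vg [A H]]]; apply: (app_in V_trans Vg H). Qed.

Lemma Rec_restr p x : V p -> V x -> (forall z, z ∈ x -> exists w, Rec p z w) ->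
  exists h, V h /\ is_function h /\ forall z w, app h z w <-> z ∈ x /\ Rec p z w.
Proof.
move=> Vp Vx D; case: (V_func (x := x) (Q := fun z w => Rec p z w)) => //.
{ by apply: d_Rec; tm_solve. }
{ by move=> a b b' _ _ _; apply: Rec_fun. }
move=> h [Vh [fh Hh]]; exists h; split=> //; split=> // z w; rewrite Hh.
by split=> [[H [_ R]]|[H R]]; split=> //; split=> //; case: (Rec_in R).
Qed.

(** The domain of an attempt must be closed under members. So the values are collected over a
    transitive set around [x]: those of its elements that have a value form such a domain, and [x]
    is adjoined if it is missing. *)
Lemma Rec_total p x : V p -> V x -> exists y, Rec p x y.
Proof.
move=> Vp; elim/(well_founded_ind (@mem_wf U)): x => x IH Vx.
case: (V_trans_ex Vx) => d [Vd [Td xd]].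
case: (sep (x := d) (Q := fun z => exists w, V w /\ Rec p z w)) => //.
  by apply: d_ex; apply: d_Rec; tm_solve.
move=> d' [Vd' Hd'].
have D' z : z ∈ d' -> exists w, Rec p z w by move=> /Hd' [_ [w [_ R]]]; exists w.
case: (Rec_restr Vp Vd' D') => g [Vg [fg Hg]].
have Ag : attempt p g.
{ split=> // z w /Hg [zd' R]; case: (R) => g0 [Vg0 [A0 g0z]]; case: (A0) => f0 /(_ _ _ g0z) [D0 [h [Vh [Rh Fh]]]].
  have sub u w' : u ∈ z -> (app g u w' <-> app g0 u w').
  { move=> uz; case: (D0 u uz) => w0 g0u; split=> [/Hg [_ Ru]|H].
    - have -> : w' = w0 by apply: (Rec_fun Vp Ru); exists g0.
      by [].
    - apply/Hg; have Ru : Rec p u w' by exists g0.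
      split=> //; apply/Hd'; split; first by apply: (Td z) => //; case/Hd': zd'.
      by exists w'; split=> //; case: (Rec_in Ru). }
  split=> [u uz|]; first by case: (D0 u uz) => w0 g0u; exists w0; apply/sub.
  exists h; split=> //; split=> // y; rewrite Rh.
  split=> [[yg [a [b [P az]]]]|[yg [a [b [P az]]]]]; split; try by exists a, b.
  - by apply: (app_mem _ P); apply/sub => //; apply: app_pair yg P.
  - by apply: (app_mem _ P); apply/sub => //; apply: app_pair yg P. }
case: (classic (x ∈ d')) => [/D' //|xd'].
have dz z : z ∈ x -> z ∈ d'.
  move=> zx; apply/Hd'; split; first exact: (Td x).
  by case: (IH z zx (V_in Vx zx)) => w Rw; exists w; split=> //; case: (Rec_in Rw).
case: (sep (x := g) (Q := fun y => exists a b, is_pair y a b /\ a ∈ x)) => //; first by dsolve.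
move=> h [Vh Hh]; case: (F_tot Vp Vx Vh) => y [Vy Fy].
case: (V_pair Vx Vy) => q [Vq Pq]; case: (V_adjoin Vg Vq) => g1 [Vg1 Hg1].
have A1 a b : app g1 a b <-> app g a b \/ (a = x /\ b = y).
{ split=> [[z [/Hg1 [zg|->] P]]|[[z [zg P]]|[-> ->]]].
  - by left; exists z.
  - by case: (pair_inj P Pq) => -> ->; right.
  - by exists z; split=> //; apply/Hg1; left.
  - by exists q; split=> //; apply/Hg1; right. }
have xg b : ~ app g x b by move=> /Hg [].
exists y, g1; split=> //; split; last by apply/A1; right.
split; first (split; first by move=> z /Hg1 [zg|->]; [case: fg => fg _; apply: fg|exists x, y]).
{ move=> a b b' /A1 [H|[? ?]] /A1 [H'|[? ?]]; subst.
  + by case: fg => _; apply; eassumption.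
  + by case: (xg _ H).
  + by case: (xg _ H').
  + by []. }
move=> z w /A1 [H|[? ?]]; last first.
- subst; split=> [u ux|].
    by case: (D' u (dz u ux)) => w' R; exists w'; apply/A1; left; apply/Hg; split=> //; apply: dz.
  exists h; split=> //; split=> // v; rewrite Hh; split=> [[vg [a [b [P ax]]]]|[/Hg1 [vg|E] [a [b [P ax]]]]].
  + by split; [apply/Hg1; left|exists a, b].
  + by split=> //; exists a, b.
  + by subst v; case: (pair_inj P Pq) => E _; subst a; case: (mem_irrefl ax).
- case: (Ag) => _ /(_ _ _ H) [D [h' [Vh' [Rh' Fh']]]]; split=> [u uz|].
    by case: (D u uz) => w' ?; exists w'; apply/A1; left.
  exists h'; split=> //; split=> // v; rewrite Rh'; split=> [[vg [a [b [P ax]]]]|[/Hg1 [vg|E] [a [b [P ax]]]]].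
  + by split; [apply/Hg1; left|exists a, b].
  + by split=> //; exists a, b.
  + subst v; case: (pair_inj P Pq) => E _; subst a; case: (D _ ax) => w' /xg; by [].
Qed.

Lemma Rec_eq p x y : V p -> V x -> V y -> (Rec p x y <-> exists h, V h /\ is_function h /\
  (forall z w, app h z w <-> z ∈ x /\ Rec p z w) /\ F p x h y).
Proof.
move=> Vp Vx Vy.
have K y' : Rec p x y' -> exists h, V h /\ is_function h /\
  (forall z w, app h z w <-> z ∈ x /\ Rec p z w) /\ F p x h y'.
{ move=> [g [Vg [A gx]]]; case: (A) => fg /(_ _ _ gx) [D [h [Vh [Rh Fh]]]]; exists h; split=> //.
  have E z w : app h z w <-> z ∈ x /\ Rec p z w.
  { split=> [[v [/Rh [vg [a [b [P ax]]]] P']]|[zx R]].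
    - case: (pair_inj P P') => ? ?; subst; split=> //; exists g; split=> //; split=> //; exact: app_pair vg P.
    - case: (D z zx) => w' gw'; have -> : w = w' by apply: (Rec_fun Vp R); exists g.
      by case: gw' => v [vg P]; exists v; split=> //; apply/Rh; split=> //; exists z, w'. }
  split=> //; split=> [v /Rh [vg _]|a b b' /E [_ R] /E [_ R']].
  - by case: fg => fg _; apply: fg.
  - exact: (Rec_fun Vp R). }
split=> [/K //|[h [Vh [fh [Eh Fh]]]]].
case: (Rec_total Vp Vx) => y' R'; case: (K _ R') => h' [Vh' [fh' [Eh' Fh']]].
have E : h = h'.
{ apply: mem_ext => v; split=> H.
  - by case: fh => /(_ v H) [a [b P]] _; apply: (app_mem _ P); apply/Eh'/Eh; apply: app_pair H P.
  - by case: fh' => /(_ v H) [a [b P]] _; apply: (app_mem _ P); apply/Eh/Eh'; apply: app_pair H P. }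
subst h'; rewrite (F_fun Vp Vx Vh Vy (proj2 (Rec_in R')) Fh Fh'); exact: R'.
Qed.

Lemma recursion_Rec :
  dfn (F := FV) (fun _ e => Rec (e 0) (e 1) (e 2)) /\
  (forall p x, V p -> V x -> exists y, Rec p x y) /\
  (forall p x y y', V p -> Rec p x y -> Rec p x y' -> y = y') /\
  (forall p x y, Rec p x y -> V x /\ V y) /\
  (forall p x y, V p -> V x -> V y -> (Rec p x y <-> exists h, V h /\ is_function h /\
     (forall z w, app h z w <-> z ∈ x /\ Rec p z w) /\ F p x h y)).
Proof.
split; first by apply: d_Rec; tm_solve.
split; first exact: Rec_total.
split; first exact: Rec_fun.
split; [exact: Rec_in|exact: Rec_eq].
Qed.

Lemma recursion : exists R : U -> U -> U -> Prop,
  dfn (F := FV) (fun _ e => R (e 0) (e 1) (e 2)) /\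
  (forall p x, V p -> V x -> exists y, R p x y) /\
  (forall p x y y', V p -> R p x y -> R p x y' -> y = y') /\
  (forall p x y, R p x y -> V x /\ V y) /\
  (forall p x y, V p -> V x -> V y -> (R p x y <-> exists h, V h /\ is_function h /\
     (forall z w, app h z w <-> z ∈ x /\ R p z w) /\ F p x h y)).
Proof. by exists Rec; apply: recursion_Rec. Qed.

End Recursion.

(** ** The cumulative hierarchy, collection and choice *)

Lemma in_rank_iff x alpha : in_rank x alpha <-> exists beta, beta ∈ alpha /\ forall y, y ∈ x -> in_rank y beta.
Proof.
split=> [[{}x {}alpha beta Hb H]|[beta [Hb H]]]; first by exists beta.
exact: (in_rank_intro _ _ _ Hb).
Qed.

Lemma app_union3 h : V h -> exists b, V b /\ forall z w, app h z w ->
  w ∈ b /\ (forall u, u ∈ w -> u ∈ b).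
Proof.
move=> Vh; case: (V_union Vh) => h1 [V1 H1]; case: (V_union V1) => h2 [V2 H2]; case: (V_union V2) => h3 [V3 H3].
case: (V_cup V2 V3) => b [Vb Hb]; exists b; split=> // z w [q [qh P]].
have w2 : w ∈ h2.
  by case: (pair_snd_mem P) => s [sq ws]; apply/H2; exists s; split=> //; apply/H1; exists q.
split=> [|u uw]; apply/Hb; [by left|by right; apply/H3; exists w].
Qed.

(** The predicate [in_rank] is inductive and lives outside [V]. Recursion inside [V] on the ordinal,
    taking all subsets of earlier levels, bounds it by a set and at the same time makes it
    definable. *)
Lemma levels : (forall alpha, V alpha -> exists v, V v /\ is_level V alpha v) /\
  dfn (F := FV) (fun _ e => in_rank (e 0) (e 1)).
Proof.
pose F (p x h y : U) := forall u, V u -> (u ∈ y <-> exists z w, app h z w /\ subset u w).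
case: (@recursion F).
{ rewrite /F; dsolve. }
{ move=> p x h Vp Vx Vh; case: (app_union3 Vh) => b [Vb Hb]; case: (V_power Vb) => b' [Vb' Hb'].
  case: (sep (x := b') (Q := fun u => exists z w, app h z w /\ subset u w)) => //; first by dsolve.
  move=> y [Vy Hy]; exists y; split=> // u Vu; rewrite Hy; split=> [[]//|H]; split=> //.
  case: H => z [w [A S]]; apply/Hb'; split=> // v /S; by case: (Hb z w A) => _; apply. }
{ move=> p x h y y' Vp Vx Vh Vy Vy' H H'; apply: mem_ext => u; split=> K.
  - by apply/H'; [apply: V_in K|apply/H => //; apply: V_in K].
  - by apply/H; [apply: V_in K|apply/H' => //; apply: V_in K]. }
move=> R [dR [Rtot [Rfun [Rin Req]]]]; case: V_empty => o [Vo _].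
have L alpha v : R o alpha v -> is_level V alpha v.
{ elim/(well_founded_ind (@mem_wf U)): alpha v => alpha IH v Rv; case: (Rin _ _ _ Rv) => Va Vv.
  case/(Req _ _ _ Vo Va Vv): (Rv) => h [Vh [fh [Eh Fh]]] u; split.
  - move=> uv; have Vu := V_in Vv uv; split=> //; case/(Fh u Vu): uv => z [w [/Eh [za Rz] S]].
    by apply/in_rank_iff; exists z; split=> // y /S; case/(IH z za w Rz y).
  - move=> [Vu /in_rank_iff [z [za H]]]; apply/(Fh u Vu); case: (Rtot o z Vo (V_in Va za)) => w Rz.
    exists z, w; split; first by apply/Eh.
    by move=> y yu; apply/(IH z za w Rz); split; [apply: V_in yu|apply: H]. }
split=> [alpha Va|].
  by case: (Rtot o alpha Vo Va) => v Rv; exists v; split; [case: (Rin _ _ _ Rv)|apply: L].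
apply: (d_ext (Q' := fun _ e => exists v, V v /\ R o (e 1) v /\ e 0 ∈ v)).
{ move=> i e He; have V0 : V (e 0) by apply: (He 0). have V1 : V (e 1) by apply: (He 1).
  split=> [H|[v [Vv [Rv /(L _ _ Rv) []]]]] //; case: (Rtot o (e 1) Vo V1) => v Rv; exists v.
  by split; [case: (Rin _ _ _ Rv)|split=> //; apply/(L _ _ Rv)]. }
apply: d_ex; apply: d_and; last by dsolve.
by apply: (d_subst3 dR); tm_solve.
Qed.

Lemma V_level alpha : V alpha -> exists v, V v /\ is_level V alpha v.
Proof. exact: (proj1 levels). Qed.

Lemma d_in_rank t1 t2 : tm (F := FV) t1 -> tm (F := FV) t2 -> dfn (F := FV) (fun i e => in_rank (t1 i e) (t2 i e)).
Proof. by move=> H1 H2; apply: (d_subst2 (proj2 levels)). Qed.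

Lemma V_rank x : V x -> exists alpha, V alpha /\ ordinal alpha /\ in_rank x alpha.
Proof.
pose F (p x h y : U) := forall u, V u -> (u ∈ y <-> exists z w, app h z w /\ (u ∈ w \/ u = w)).
case: (@recursion F).
{ rewrite /F; dsolve. }
{ move=> p y h Vp Vy Vh; case: (app_union3 Vh) => b [Vb Hb].
  case: (sep (x := b) (Q := fun u => exists z w, app h z w /\ (u ∈ w \/ u = w))) => //; first by dsolve.
  move=> y' [Vy' Hy]; exists y'; split=> // u Vu; rewrite Hy; split=> [[]//|H]; split=> //.
  by case: H => z [w [A [S|->]]]; case: (Hb z w A) => // _; apply. }
{ move=> p z h y y' Vp Vz Vh Vy Vy' H H'; apply: mem_ext => u; split=> K.
  - by apply/H'; [apply: V_in K|apply/H => //; apply: V_in K].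
  - by apply/H; [apply: V_in K|apply/H' => //; apply: V_in K]. }
move=> R [dR [Rtot [Rfun [Rin Req]]]]; case: V_empty => o [Vo _].
have L y r : R o y r -> ordinal r /\ forall z, z ∈ y -> in_rank z r.
{ elim/(well_founded_ind (@mem_wf U)): y r => y IH r Rr; case: (Rin _ _ _ Rr) => Vy Vr.
  case/(Req _ _ _ Vo Vy Vr): (Rr) => h [Vh [fh [Eh Fh]]]; split.
  - apply: ordinal_of_set.
    + move=> u ur v vu; have Vu := V_in Vr ur; have Vv := V_in Vu vu; apply/(Fh v Vv).
      case/(Fh u Vu): ur => z [w [A H]]; exists z, w; split=> //; left.
      case/Eh: A => zy Rz; case: (IH z zy w Rz) => Ow _; case: H => [uw|<- //].
      exact: (ordinal_trans Ow uw).
    + move=> u ur; case/(Fh u (V_in Vr ur)): (ur) => z [w [/Eh [zy Rz] H]]; case: (IH z zy w Rz) => Ow _.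
      by case: H => [H|-> //]; apply: ordinal_mem H.
  - move=> z zy; case: (Rtot o z Vo (V_in Vy zy)) => w Rw; case: (IH z zy w Rw) => _ H; apply/in_rank_iff.
    exists w; split=> //; apply/Fh; first by case: (Rin _ _ _ Rw).
    by exists z, w; split; [apply/Eh|right]. }
move=> Vx; case: (Rtot o x Vo Vx) => r Rr; case: (L _ _ Rr) => Or H; case: (Rin _ _ _ Rr) => _ Vr.
(* All elements of [x] have rank below [r], so [x] itself appears one level later. *)
case: (V_adjoin Vr Vr) => s [Vs Hs]; exists s; split=> //; split.
- apply: ordinal_of_set => [u /Hs [ur|->] v vu|u /Hs [ur|->] //]; last exact: ordinal_mem ur.
  + by apply/Hs; left; apply: (ordinal_trans Or ur).
  + by apply/Hs; left.
- by apply/in_rank_iff; exists r; split=> //; apply/Hs; right.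
Qed.

(** Scott's trick: replacement is applied to the least level that contains a witness, which is
    unique. The union of these levels gives a whole level as bound, and hence a transitive one. *)
Lemma collection x (Q : U -> U -> Prop) : V x -> dfn (F := FV) (fun _ e => Q (e 0) (e 1)) ->
  exists B, V B /\ transitive_set B /\ forall a b, a ∈ x -> V b -> Q a b -> exists b', b' ∈ B /\ Q a b'.
Proof.
move=> Vx dQ.
pose N a alpha := exists b, V b /\ in_rank b alpha /\ Q a b.
have dN t1 t2 : tm (F := FV) t1 -> tm (F := FV) t2 -> dfn (F := FV) (fun i e => N (t1 i e) (t2 i e)).
{ move=> H1 H2; apply: d_ex; apply: d_and; first by apply: d_in_rank; tm_solve.
  by apply: (d_subst2 dQ); tm_solve. }
pose L a alpha := ordinal alpha /\ N a alpha /\ forall beta, beta ∈ alpha -> ~ N a beta.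
case: (sep (x := x) (Q := fun a => exists b, V b /\ Q a b)) => //.
  by apply: d_ex; apply: (d_subst2 dQ); tm_solve.
move=> x' [Vx' Hx']; case: (repl (x := x') (Q := L)) => //.
{ rewrite /L; apply: d_and; first by dsolve. 
  apply: d_and; first by apply: dN; tm_solve.
  apply: d_ball; first by tm_solve.
  by apply: d_not; apply: dN; tm_solve. }
{ move=> a /Hx' [ax [b [Vb Qb]]]; case: (V_rank Vb) => r [Vr [Or br]].
  case: (below_min (Q := fun alpha => V alpha /\ ordinal alpha /\ N a alpha)).
    by exists r; split=> //; split=> //; exists b.
  move=> alpha [[Va [Oa Na]] m]; exists alpha; split=> //; split.
    split=> //; split=> // beta ba Nb; apply: (m beta ba); split; first by apply: V_in ba.
    by split=> //; apply: ordinal_mem ba.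
  move=> alpha' Va' [Oa' [Na' m']]; case: (ordinal_total Oa Oa') => [H|[//|H]].
  - by case: (m' _ H).
  - by case: (m _ H); split=> //; split. }
move=> u [Vu Hu]; case: (V_union Vu) => g [Vg Hg].
case: (V_level Vg) => B [VB HB]; exists B; split=> //; split.
  move=> y /HB [Vy ry] z zy; apply/HB; split; first by apply: V_in zy.
  apply: in_rank_mem ry zy => v /Hg [al [alu val]] w wv; apply/Hg; exists al; split=> //.
  by case/Hu: alu => _ [a [_ [Oal _]]]; apply: (ordinal_trans Oal val).
move=> a b ax Vb Qab; have /Hx' : a ∈ x /\ exists b, V b /\ Q a b by split=> //; exists b.
move=> ax'; case: (V_rank Vb) => r [Vr [Or br]].
case: (below_min (Q := fun alpha => V alpha /\ ordinal alpha /\ N a alpha)).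
  by exists r; split=> //; split=> //; exists b.
move=> alpha [[Va [Oa Na]] m]; case: (Na) => b' [Vb' [rb' Qb']]; exists b'; split=> //; apply/HB; split=> //.
apply: (in_rank_le rb') => z za; apply/Hg; exists alpha; split=> //; apply/Hu; split=> //; exists a; split=> //.
split=> //; split=> // beta ba Nb; apply: (m beta ba); split; first by apply: V_in ba.
by split=> //; apply: ordinal_mem ba.
Qed.

(** The axiom selects from disjoint families only. The products of the singleton of [y] with [y] are
    disjoint, and a selector for them is a choice function. *)
Lemma choice_function x : V x -> exists c, V c /\ is_function c /\
  forall y, V y -> subset y x -> (exists z, z ∈ y) -> exists z, z ∈ y /\ app c y z.
Proof.
move=> Vx; case: (V_power Vx) => px [Vpx Hpx].
case: (sep (x := px) (Q := fun y => exists z, z ∈ y /\ ~ False)) => //; first by dsolve.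
move=> X [VX HX].
pose T y s := forall q, V q -> (q ∈ s <-> exists z, z ∈ y /\ is_pair q y z).
have Tq y s : V s -> T y s -> forall q, q ∈ s <-> V q /\ exists z, z ∈ y /\ is_pair q y z.
{ move=> Vs H q; split=> [K|[Vq K]]; last by apply/H.
  by have Vq := V_in Vs K; split=> //; apply/H. }
have Tex y : V y -> exists s, V s /\ T y s.
{ move=> Vy; case: (V_single Vy) => sy [Vsy Hsy]; case: (V_prod Vsy Vy) => s [Vs Hs]; exists s; split=> // q Vq.
  rewrite Hs; split=> [[a [b [/Hsy -> [H P]]]]|[z [zy P]]]; first by exists b.
  by exists y, z; split=> //; apply/Hsy. }
case: (repl (x := X) (Q := T)) => //.
{ rewrite /T; dsolve. }
{ move=> y /HX [/Hpx [Vy _] _]; case: (Tex y Vy) => s [Vs Hs]; exists s; split=> //; split=> // s' Vs' Hs'.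
  by apply: mem_ext => q; rewrite (Tq y s) // (Tq y s'). }
move=> fam [Vfam Hfam].
case: (zfc_choice _ V_ZFC fam Vfam).
{ move=> s Vs /Hfam [_ [y [/HX [/Hpx [Vy _] [z [zy _]]] Ts]]]; case: (V_pair Vy (V_in Vy zy)) => q [Vq P].
  by exists q; split=> //; apply/Ts => //; exists z. }
{ move=> s s' q Vs Vs' Vq /Hfam [_ [y [_ Ts]]] /Hfam [_ [y' [_ Ts']]] /(Ts q Vq) [z [_ P]] /(Ts' q Vq) [z' [_ P']].
  case: (pair_inj P P') => ? _; subst y'; by apply: mem_ext => r; rewrite (Tq y s) // (Tq y s'). }
move=> c0 [Vc0 Hc0]; case: (V_union Vfam) => uf [Vuf Huf].
case: (sep (x := uf) (Q := fun q => q ∈ c0)) => //; first by dsolve.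
move=> c [Vc Hc]; exists c; split=> //; split; first split.
- move=> q /Hc [/Huf [s [sf qs]] _]; have Vs := V_in Vfam sf; case/Hfam: sf => _ [y [_ Ts]].
  by case/(Ts q (V_in Vs qs)): qs => z [_ P]; exists y, z.
- move=> y z z' [q [/Hc [/Huf [s [sf qs]] qc] P]] [q' [/Hc [/Huf [s' [sf' qs']] qc'] P']].
  have Vs := V_in Vfam sf; have Vs' := V_in Vfam sf'; have Vq := V_in Vs qs; have Vq' := V_in Vs' qs'.
  case/Hfam: (sf) => _ [y1 [_ Ts]]; case/Hfam: (sf') => _ [y2 [_ Ts']].
  case/(Ts q Vq): (qs) => z1 [_ P1]; case/(Ts' q' Vq'): (qs') => z2 [_ P2].
  case: (pair_inj P P1) => ? ?; case: (pair_inj P' P2) => ? ?; subst y1 y2 z1 z2.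
  have E : s = s' by apply: mem_ext => r; rewrite (Tq y s) // (Tq y s').
  subst s'; case: (Hc0 s Vs sf) => r [_ Hr]; have E1 := proj1 (Hr q Vq) (conj qc qs).
  have E2 := proj1 (Hr q' Vq') (conj qc' qs'); subst q q'; by case: (pair_inj P P').
- move=> y Vy S [z zy]; have yX : y ∈ X by apply/HX; split; [apply/Hpx|exists z; split=> //; tauto].
  case: (Tex y Vy) => s [Vs Ts]; have sf : s ∈ fam by apply/Hfam; split=> //; exists y.
  case: (Hc0 s Vs sf) => q [Vq Hq]; case: (proj2 (Hq q Vq) eq_refl) => qc qs.
  case/(Ts q Vq): (qs) => z' [z'y P]; exists z'; split=> //; exists q; split=> //; apply/Hc; split=> //.
  by apply/Huf; exists s.
Qed.

Ltac d_nt9 ::= ap2 @d_in_rank.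

(** ** Small sets and inaccessible cardinals *)

(** Being a partial image of some [b] in [a] replaces cardinality below [a]: it makes sense for
    predicates that are not yet known to be sets, and it passes to images without constructing
    bijections. *)
Definition small (X : U -> Prop) a := exists b, b ∈ a /\ exists g, V g /\ is_function g /\
  (forall xi v, app g xi v -> xi ∈ b) /\ forall v, X v -> exists xi, app g xi v.

Lemma small_sub (X Y : U -> Prop) a : (forall v, X v -> Y v) -> small Y a -> small X a.
Proof.
move=> S [b [ba [g [Vg [fg [D C]]]]]]; exists b; split=> //; exists g; split=> //; split=> //; split=> //.
by move=> v /S /C.
Qed.

Lemma small_le (X : U -> Prop) a a' : subset a a' -> small X a -> small X a'.
Proof. by move=> S [b [ba H]]; exists b; split=> //; apply: S. Qed.

Lemma small_image (X Y : U -> Prop) a (Q : U -> U -> Prop) : V a ->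
  dfn (F := FV) (fun _ e => Q (e 0) (e 1)) ->
  (forall x y y', V x -> V y -> V y' -> Q x y -> Q x y' -> y = y') ->
  (forall y, Y y -> V y /\ exists x, V x /\ X x /\ Q x y) -> small X a -> small Y a.
Proof.
move=> Va dQ fQ sQ [b [ba [g [Vg [fg [D C]]]]]]; exists b; split=> //.
case: (V_func (x := b) (Q := fun xi y => exists x, app g xi x /\ Q x y)); first exact: V_in Va ba.
{ apply: d_ex_val; try tm_solve. by apply: (d_subst2 dQ); tm_solve. }
{ move=> xi y y' xib Vy Vy' [x [gx Qx]] [x' [gx' Qx']]; have E : x = x' by case: fg => _; apply; eassumption.
  by subst x'; apply: (fQ x) => //; case: (app_in V_trans Vg gx). }
move=> g' [Vg' [fg' Hg']]; exists g'; split=> //; split=> //; split=> [xi y /Hg' []//|y Yy].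
case: (sQ y Yy) => Vy [x [Vx [Xx Qx]]]; case: (C x Xx) => xi gx; exists xi; apply/Hg'.
by split; [apply: D gx|split=> //; exists x].
Qed.

Lemma small_card x a : V x -> V a -> card_lt V x a -> small (fun v => v ∈ x) a.
Proof.
move=> Vx Va [b [ba [g [Vg [[fg [Dg Rg]] [inj sur]]]]]]; exists b; split=> //.
case: (V_func (x := b) (Q := fun xi v => app g v xi)); [exact: V_in Va ba|by dsolve| |].
  by move=> xi v v' _ _ _ H H'; apply: inj H H'.
move=> g' [Vg' [fg' Hg']]; exists g'; split=> //; split=> //; split=> [xi y /Hg' []//|y yx].
by case/Dg: (yx) => xi gx; exists xi; apply/Hg'; split; [apply: Rg gx|split=> //; apply: V_in yx].
Qed.

(** Restricting a partial surjection to least preimages makes it injective; the recursion [R] is the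
    transitive collapse of the set [b0] of these preimages, and its value at [b] is their order
    type. *)
Lemma card_small x a : V x -> V a -> ordinal a -> small (fun v => v ∈ x) a -> card_lt V x a.
Proof.
move=> Vx Va Oa [b [ba [g [Vg [fg [D C]]]]]].
pose F (p x h y : U) := forall u, V u -> (u ∈ y <-> exists z, z ∈ p /\ app h z u).
case: (@recursion F).
{ rewrite /F; dsolve. }
{ move=> p y h Vp Vy Vh; case: (app_union3 Vh) => B [VB HB].
  case: (sep (x := B) (Q := fun u => exists z, z ∈ p /\ app h z u)) => //; first by dsolve.
  move=> y' [Vy' Hy]; exists y'; split=> // u Vu; rewrite Hy; split=> [[]//|H]; split=> //.
  by case: H => z [_ A]; case: (HB z u A). }
{ move=> p z h y y' Vp Vz Vh Vy Vy' H H'; apply: mem_ext => u; split=> K.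
  - by apply/H'; [apply: V_in K|apply/H => //; apply: V_in K].
  - by apply/H; [apply: V_in K|apply/H' => //; apply: V_in K]. }
move=> R [dR [Rtot [Rfun [Rin Req]]]].
have Vb := V_in Va ba; have Ob := ordinal_mem Oa ba.
pose M xi v := app g xi v /\ forall xi', xi' ∈ xi -> ~ app g xi' v.
case: (sep (x := b) (Q := fun xi => exists v, v ∈ x /\ M xi v)) => //; first by rewrite /M; dsolve.
move=> b0 [Vb0 Hb0].
have E xi r : R b0 xi r -> forall u, u ∈ r <-> exists z, z ∈ b0 /\ z ∈ xi /\ R b0 z u.
{ move=> H; case: (Rin _ _ _ H) => Vxi Vr; case/(Req _ _ _ Vb0 Vxi Vr): H => h [Vh [fh [Eh Fh]]] u.
  split=> [ur|[z [zb [zx Rz]]]].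
  - by case/(Fh u (V_in Vr ur)): ur => z [zb /Eh [zx Rz]]; exists z.
  - by apply/Fh; [case: (Rin _ _ _ Rz)|exists z; split=> //; apply/Eh]. }
have L xi r : ordinal xi -> R b0 xi r -> ordinal r /\ subset r xi.
{ elim/(well_founded_ind (@mem_wf U)): xi r => xi IH r Oxi Rr; split; last first.
  - move=> u /(E _ _ Rr) [z [zb [zx Rz]]]; case: (IH z zx u (ordinal_mem Oxi zx) Rz) => Ou S.
    case: (ordinal_subset Ou (ordinal_mem Oxi zx) S) => [-> //|H]; exact: (ordinal_trans Oxi zx).
  - apply: ordinal_of_set.
    + move=> u /(E _ _ Rr) [z [zb [zx Rz]]] v /(E _ _ Rz) [z' [zb' [zx' Rz']]]; apply/(E _ _ Rr).
      by exists z'; split=> //; split=> //; apply: (ordinal_trans Oxi zx).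
    + by move=> u /(E _ _ Rr) [z [zb [zx Rz]]]; case: (IH z zx u (ordinal_mem Oxi zx) Rz). }
case: (Rtot b0 b Vb0 Vb) => beta Rb; case: (L _ _ Ob Rb) => Obeta Sb.
exists beta; split.
  by case: (ordinal_subset Obeta Ob Sb) => [-> //|H]; apply: (ordinal_trans Oa ba).
have Mex v : v ∈ x -> exists xi, xi ∈ b0 /\ M xi v.
{ move=> vx; case: (below_min (C v vx)) => xi [gx m]; exists xi; split=> //; apply/Hb0; split; first exact: D gx.
  by exists v. }
have Mun v xi xi' : M xi v -> M xi' v -> xi = xi'.
{ move=> [g1 m1] [g2 m2]; have O1 := ordinal_mem Ob (D _ _ g1); have O2 := ordinal_mem Ob (D _ _ g2).
  by case: (ordinal_total O1 O2) => [H|[//|H]]; [case: (m2 _ H)|case: (m1 _ H)]. }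
case: (V_func (x := x) (Q := fun v w => exists xi, xi ∈ b0 /\ M xi v /\ R b0 xi w)) => //.
{ rewrite /M; apply: d_bex; first tm_solve. apply: d_and; first by dsolve.
  by apply: (d_subst3 dR); tm_solve. }
{ move=> v w w' _ _ _ [xi [_ [M1 R1]]] [xi' [_ [M2 R2]]]; rewrite (Mun _ _ _ M2 M1) in R2; exact: (Rfun b0 xi). }
move=> G [VG [fG HG]]; exists G; split=> //; split; first split=> //; first split.
- move=> v; split=> [vx|[w /HG [] //]]; case: (Mex v vx) => xi [xb Mx]; case: (Rtot b0 xi Vb0 (V_in Vb0 xb)) => w Rw.
  by exists w; apply/HG; split=> //; split; [case: (Rin _ _ _ Rw)|exists xi].
- move=> v w /HG [vx [Vw [xi [xb [Mx Rw]]]]]; apply/(E _ _ Rb); exists xi; split=> //; split=> //.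
  by case/Hb0: xb.
- split=> [v v' w /HG [_ [_ [xi [xb [Mx Rw]]]]] /HG [_ [_ [xi' [xb' [Mx' Rw']]]]]|w].
  + suff E' : xi = xi' by subst xi'; case: Mx => g1 _; case: Mx' => g2 _; case: fg => _; apply; eassumption.
    have O1 := ordinal_mem Ob (D _ _ (proj1 Mx)); have O2 := ordinal_mem Ob (D _ _ (proj1 Mx')).
    case: (ordinal_total O1 O2) => [H|[//|H]].
    * by case: (@mem_irrefl U w); apply/(E _ _ Rw'); exists xi.
    * by case: (@mem_irrefl U w); apply/(E _ _ Rw); exists xi'.
  + move=> /(E _ _ Rb) [xi [xb [_ Rw]]]; case/Hb0: (xb) => _ [v [vx Mx]]; exists v; apply/HG; split=> //.
    by split; [case: (Rin _ _ _ Rw)|exists xi].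
Qed.

Section Inaccessible.
Context (a : U) (Va : V a) (Ia : inaccessible V a).

Lemma inacc_ordinal : ordinal a.
Proof. by case: Ia => [[]]. Qed.

Lemma inacc_limit y : y ∈ a -> exists z, z ∈ a /\ y ∈ z.
Proof. by case: Ia => _ [_ [[[_ [_ H]] _] _]]; apply: H. Qed.

Lemma inacc_zero o : (forall z, ~ z ∈ o) -> o ∈ a.
Proof.
move=> Ho; have Oo : ordinal o by split=> y /Ho.
case: (ordinal_total Oo inacc_ordinal) => [//|[E|H]]; last by case: (Ho _ H).
by subst o; case: Ia => _ [[w [_ /Ho]]].
Qed.

Lemma inacc_bound b (Q : U -> U -> Prop) : b ∈ a -> dfn (F := FV) (fun _ e => Q (e 0) (e 1)) ->
  (forall xi y y', V y -> V y' -> Q xi y -> Q xi y' -> y = y') ->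
  exists c, c ∈ a /\ forall xi y, xi ∈ b -> y ∈ a -> Q xi y -> y ∈ c.
Proof.
move=> ba dQ fQ; case: V_empty => o [Vo Ho]; have oa := inacc_zero Ho; have Vb := V_in Va ba.
have dQ' : dfn (F := FV) (fun _ e => exists y, y ∈ a /\ Q (e 0) y).
  by apply: d_bex; [tm_solve|apply: (d_subst2 dQ); tm_solve].
(* Regularity speaks of total functions, so missing values are replaced by zero. *)
case: (V_func (x := b) (Q := fun xi y => (y ∈ a /\ Q xi y) \/ (~ (exists y, y ∈ a /\ Q xi y) /\ y = o))) => //.
{ apply: d_or; first by dsolve. by apply: d_and; [apply: d_not|dsolve]. }
{ move=> xi y y' _ Vy Vy' [[ya Qy]|[N ->]] [[ya' Qy']|[N' ->]] //; first exact: (fQ xi).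
  - by case: N'; exists y.
  - by case: N; exists y'. }
move=> g [Vg [fg Hg]]; case: Ia => _ [_ [[_ reg] _]]; case: (reg b g ba Vg).
{ split=> //; split=> [xi|xi y /Hg [_ [_ [[]|[_ ->]]]] //].
  split=> [xb|[y /Hg [] //]]; case: (classic (exists y, y ∈ a /\ Q xi y)) => [[y [ya Qy]]|N].
  - by exists y; apply/Hg; split=> //; split; [apply: V_in ya|left].
  - by exists o; apply/Hg; split=> //; split=> //; right. }
move=> c [ca Hc]; exists c; split=> // xi y xb ya Qy; apply: (Hc xi); apply/Hg; split=> //.
by split; [apply: V_in ya|left].
Qed.

Lemma small_bound (X : U -> Prop) (Q : U -> U -> Prop) : small X a ->
  dfn (F := FV) (fun _ e => Q (e 0) (e 1)) ->
  (forall x y y', V y -> V y' -> Q x y -> Q x y' -> y = y') ->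
  exists c, c ∈ a /\ forall x y, X x -> y ∈ a -> Q x y -> y ∈ c.
Proof.
move=> [b [ba [g [Vg [fg [D C]]]]]] dQ fQ.
case: (inacc_bound (b := b) (Q := fun xi y => exists x, app g xi x /\ Q x y)) => //.
{ apply: d_ex_val; try tm_solve. by apply: (d_subst2 dQ); tm_solve. }
{ move=> xi y y' Vy Vy' [x [gx Qx]] [x' [gx' Qx']]; have E : x = x' by case: fg => _; apply; eassumption.
  by subst x'; apply: (fQ x). }
move=> c [ca Hc]; exists c; split=> // x y Xx ya Qy; case: (C x Xx) => xi gx.
by apply: (Hc xi) => //; [apply: D gx|exists x].
Qed.

Lemma small_mem b : b ∈ a -> small (fun v => v ∈ b) a.
Proof.
move=> ba; exists b; split=> //.
case: (V_func (x := b) (Q := fun xi v => xi = v)); [exact: V_in Va ba|by dsolve|by move=> xi v v' _ _ _ <- <-|].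
move=> g [Vg [fg Hg]]; exists g; split=> //; split=> //; split=> [xi v /Hg []//|v vb].
by exists v; apply/Hg; split=> //; split=> //; apply: V_in vb; apply: V_in ba.
Qed.

Lemma not_small_self : ~ small (fun v => v ∈ a) a.
Proof.
move=> S; case: (small_bound (Q := fun x y => x = y) S); [by dsolve|by move=> x y y' _ _ <- <-|].
by move=> c [ca H]; case: (@mem_irrefl U c); apply: (H c c).
Qed.

Lemma small_power x : V x -> small (fun v => v ∈ x) a -> small (fun v => V v /\ subset v x) a.
Proof.
move=> Vx /(card_small Vx Va inacc_ordinal) [c [ca [G [VG [[fG [DG RG]] [inj sur]]]]]].
have Vc := V_in Va ca; case: (V_power Vc) => pc [Vpc Hpc].
have Spc : small (fun v => v ∈ pc) a.
  by apply: small_card => //; case: Ia => _ [_ [_ sl]]; apply: (sl c pc).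
apply: (small_image (Q := fun t s => forall v, V v -> (v ∈ s <-> v ∈ x /\ exists w, app G v w /\ w ∈ t)) Va _ _ _ Spc).
{ dsolve. }
{ move=> t s s' _ Vs Vs' H H'; apply: mem_ext => v; split=> K.
  - by apply/H'; [apply: V_in K|apply/H => //; apply: V_in K].
  - by apply/H; [apply: V_in K|apply/H' => //; apply: V_in K]. }
move=> s [Vs Ss]; split=> //.
case: (sep (x := c) (Q := fun w => exists v, v ∈ s /\ app G v w)) => //; first by dsolve.
move=> t [Vt Ht]; exists t; split=> //; split; first by apply/Hpc; split=> // w /Ht [].
move=> v Vv; split=> [vs|[vx [w [Gw /Ht [_ [v' [vs' Gw']]]]]]].
- split; first exact: Ss. case/DG: (Ss _ vs) => w Gw; exists w; split=> //; apply/Ht; split; first exact: RG Gw.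
  by exists v.
- by rewrite (inj _ _ _ Gw Gw').
Qed.

Lemma small_square b : b ∈ a -> small (fun z => exists x y, x ∈ b /\ y ∈ b /\ is_pair z x y) a.
Proof.
move=> ba; have Vb := V_in Va ba; case: (V_power Vb) => p [Vp Hp].
have Sp : small (fun v => v ∈ p) a.
  by apply: small_sub (small_power Vb (small_mem ba)) => v /Hp.
apply: small_sub (small_power Vp Sp) => z [x [y [xb [yb P]]]].
case: (V_pair (V_in Vb xb) (V_in Vb yb)) => z' [Vz' P']; have E := pair_unique P P'; subst z'.
split=> // s sz; have Vs := V_in Vz' sz; apply/Hp; split=> // v vs.
case: P => s1 [s2 [H1 [H2 H3]]]; case/H3: sz => E; subst s; first by case/H1: vs => ->.
by case/H2: vs => ->.
Qed.

(** An enumeration [gam] is chosen for each index by collection followed by a choice function, as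
    [Gam]. Regularity bounds the least lengths of these enumerations, so that the union is an image
    of the square of some [m] in [a]. *)
Lemma small_union (X : U -> Prop) (Y : U -> U -> Prop) : small X a ->
  (forall i, X i -> V i) ->
  dfn (F := FV) (fun _ e => Y (e 0) (e 1)) ->
  (forall i, X i -> small (fun v => V v /\ Y i v) a) -> small (fun v => V v /\ exists i, X i /\ Y i v) a.
Proof.
move=> SX VX dY SY; case: (SX) => b [ba [g [Vg [fg [D C]]]]].
have Vb := V_in Va ba.
pose N gam b' := forall eta v, app gam eta v -> eta ∈ b'.
pose Q0 i gam := is_function gam /\ (exists b', b' ∈ a /\ N gam b') /\
  forall v, V v -> Y i v -> exists eta, app gam eta v.
have dQ0 t1 t2 : tm (F := FV) t1 -> tm (F := FV) t2 -> dfn (F := FV) (fun i e => Q0 (t1 i e) (t2 i e)).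
{ move=> H1 H2; rewrite /Q0 /N; apply: d_and; first by dsolve.
  apply: d_and; first by dsolve. apply: d_all; apply: d_imp; last by dsolve.
  by apply: (d_subst2 dY); tm_solve. }
case: (V_union Vg) => g1 [Vg1 Hg1]; case: (V_union Vg1) => g2 [Vg2 Hg2].
have Xg2 i : X i -> i ∈ g2.
{ move=> /C [xi [q [qg P]]]; case: (pair_snd_mem P) => s [sq js]; apply/Hg2; exists s; split=> //.
  by apply/Hg1; exists q. }
case: (collection (x := g2) (Q := Q0)) => //; first by apply: dQ0; tm_solve.
move=> B [VB [_ HB]]; case: (choice_function VB) => c [Vc [fc Hc]].
pose Gam i gam := exists Z, V Z /\ (forall z, V z -> (z ∈ Z <-> z ∈ B /\ Q0 i z)) /\ gam ∈ Z /\ app c Z gam.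
have dGam t1 t2 : tm (F := FV) t1 -> tm (F := FV) t2 -> dfn (F := FV) (fun i e => Gam (t1 i e) (t2 i e)).
{ move=> H1 H2; apply: d_ex; apply: d_and; last by dsolve. apply: d_all; apply: d_iff; first by dsolve.
  by apply: d_and; [dsolve|apply: dQ0; tm_solve]. }
have Gfun i gam gam' : Gam i gam -> Gam i gam' -> gam = gam'.
{ move=> [Z [VZ [HZ [_ cZ]]]] [Z' [VZ' [HZ' [_ cZ']]]]; suff E : Z = Z' by subst Z'; case: fc => _; apply; eassumption.
  apply: mem_ext => z; split=> K; have Vz : V z by [apply: V_in VZ K|apply: V_in VZ' K].
  - by apply/HZ' => //; apply/HZ.
  - by apply/HZ => //; apply/HZ'. }
have Gex i : X i -> exists gam, Gam i gam /\ V gam /\ Q0 i gam.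
{ move=> Xi; case: (sep (x := B) (Q := fun z => Q0 i z)) => //.
    by apply: dQ0; [apply: tm_par; exact: VX|tm_solve].
  move=> Z [VZ HZ]; case: (Hc Z VZ); first by move=> z /HZ [].
    case: (SY i Xi) => b' [ba' [g' [Vg' [fg' [D' C']]]]].
    case: (HB i g' (Xg2 i Xi) Vg') => [|z [zB Qz]]; last by exists z; apply/HZ.
    by split=> //; split; [exists b'|move=> v Vv Yv; apply: C'].
  move=> gam [gZ cg]; exists gam; split; first by exists Z; split=> //; split=> // z _; apply: HZ.
  by split; [apply: V_in gZ|case/HZ: gZ]. }
case: (small_bound (Q := fun i b' => exists gam, V gam /\ Gam i gam /\ ordinal b' /\ N gam b' /\
     forall b'', b'' ∈ b' -> ~ N gam b'') SX).
{ apply: d_ex; apply: d_and; first by apply: dGam; tm_solve. rewrite /N; dsolve. }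
{ move=> i b1 b2 _ _ [gam [_ [G1 [O1 [N1 m1]]]]] [gam' [_ [G2 [O2 [N2 m2]]]]].
  rewrite (Gfun _ _ _ G2 G1) in N2 m2; case: (ordinal_total O1 O2) => [H|[//|H]].
  - by case: (m2 _ H).
  - by case: (m1 _ H). }
move=> c0 [ca Hc0].
have Oc := ordinal_mem inacc_ordinal ca; have Ob := ordinal_mem inacc_ordinal ba.
have [m [ma [bm cm]]] : exists m, m ∈ a /\ subset b m /\ subset c0 m.
{ case: (ordinal_total Ob Oc) => [H|[E|H]].
  - by exists c0; split=> //; split=> // z; apply: (ordinal_trans Oc H).
  - by exists c0; split=> //; rewrite E; split.
  - by exists b; split=> //; split=> // z; apply: (ordinal_trans Ob H). }
apply: (small_image (Q := fun z v => exists xi eta, is_pair z xi eta /\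
   exists i, app g xi i /\ exists gam, V gam /\ Gam i gam /\ app gam eta v) Va _ _ _ (small_square ma)).
{ apply: d_ex_pair; first by tm_solve. apply: d_ex_val; try tm_solve.
  apply: d_ex; apply: d_and; [by apply: dGam; tm_solve|dsolve]. }
{ move=> z v v' _ _ _ [xi [eta [P [i [gi [gam [Vgam [Gi gv]]]]]]]] [xi' [eta' [P' [i' [gi' [gam' [Vgam' [Gi' gv']]]]]]]].
  case: (pair_inj P P') => ? ?; subst xi' eta'.
  have E : i = i' by case: fg => _; apply; eassumption.
  subst i'; have E := Gfun _ _ _ Gi Gi'; subst gam'.
  case: Gi => Z [VZ [HZ [gZ _]]]; case/(HZ _ (V_in VZ gZ)): gZ => _ [[_ ff] _]; exact: ff gv gv'. }
move=> v [Vv [i [Xi Yv]]]; split=> //; case: (Gex i Xi) => gam [Gi [Vgam [fgam [[b' [ba' Nb']] Cg]]]].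
case: (C i Xi) => xi gxi; case: (Cg v Vv Yv) => eta geta.
case: (below_min (Q := fun b' => b' ∈ a /\ N gam b')); first by exists b'.
move=> b1 [[b1a N1] m1].
have eta_m : eta ∈ m.
{ apply: cm; apply: (ordinal_trans Oc _ (N1 _ _ geta)); apply: (Hc0 i) => //; exists gam; split=> //; split=> //.
  split; first exact: ordinal_mem inacc_ordinal b1a. split=> // b'' H Nb''; apply: (m1 b'' H); split=> //.
  exact: ordinal_trans inacc_ordinal b1a H. }
have xi_m : xi ∈ m by apply: bm; apply: D gxi.
have Vm := V_in Va ma; case: (V_pair (V_in Vm xi_m) (V_in Vm eta_m)) => z [Vz P].
exists z; split=> //; split; first by exists xi, eta.
by exists xi, eta; split=> //; exists i; split=> //; exists gam.
Qed.

Lemma inacc_max x y : x ∈ a -> y ∈ a -> exists m, m ∈ a /\ subset x m /\ subset y m.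
Proof.
move=> xa ya; have Ox := ordinal_mem inacc_ordinal xa; have Oy := ordinal_mem inacc_ordinal ya.
case: (ordinal_total Ox Oy) => [H|[E|H]].
- by exists y; split=> //; split=> // z; apply: (ordinal_trans Oy H).
- by exists y; split=> //; rewrite E; split.
- by exists x; split=> //; split=> // z; apply: (ordinal_trans Ox H).
Qed.

Lemma small_cup (X Y : U -> Prop) : small X a -> small Y a -> small (fun v => X v \/ Y v) a.
Proof.
move=> [b1 [b1a [g1 [Vg1 [fg1 [D1 C1]]]]]] [b2 [b2a [g2 [Vg2 [fg2 [D2 C2]]]]]].
(* The ordinals [o] and [z], with [o] in [z], serve as tags for the two parts. *)
case: V_empty => o [Vo Ho]; have oa := inacc_zero Ho; case: (inacc_limit oa) => z [za oz].
case: (inacc_limit za) => z' [za' zz']; have Vz := V_in Va za.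
case: (inacc_max b1a b2a) => m1 [m1a [S1 S2]]; case: (inacc_max m1a za') => m [ma [Sm Sz]].
apply: (small_image (Q := fun p v => exists e xi, is_pair p e xi /\
  ((e = o /\ app g1 xi v) \/ (e = z /\ app g2 xi v))) Va _ _ _ (small_square ma)); first by dsolve.
{ move=> p v v' _ _ _ [e [xi [P H]]] [e' [xi' [P' H']]]; case: (pair_inj P P') => ? ?; subst e' xi'.
  have N : o <> z by move=> E; subst z; apply: Ho oz.
  case: H H' => [[? ?]|[? ?]] [[? ?]|[? ?]]; subst; try congruence.
  - by case: fg1 => _; apply; eassumption.
  - by case: fg2 => _; apply; eassumption. }
have Vm := V_in Va ma; have zm : z ∈ m by apply: Sz.
have om : o ∈ m by apply: (ordinal_trans (ordinal_mem inacc_ordinal ma) zm).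
move=> v [/C1|/C2] [xi gv].
- split; first by case: (app_in V_trans Vg1 gv).
  have xm : xi ∈ m by apply/Sm/S1; apply: D1 gv.
  case: (V_pair Vo (V_in Vm xm)) => p [Vp P]; exists p; split=> //; split; first by exists o, xi.
  by exists o, xi; split=> //; left.
- split; first by case: (app_in V_trans Vg2 gv).
  have xm : xi ∈ m by apply/Sm/S2; apply: D2 gv.
  case: (V_pair Vz (V_in Vm xm)) => p [Vp P]; exists p; split=> //; split; first by exists z, xi.
  by exists z, xi; split=> //; right.
Qed.

Lemma small_single u : V u -> small (fun v => v = u) a.
Proof.
move=> Vu; case: V_empty => o [Vo Ho]; have oa := inacc_zero Ho; case: (inacc_limit oa) => z [za oz].
exists z; split=> //; case: (V_func (x := z) (Q := fun xi v => v = u)); [exact: V_in Va za|by dsolve| |].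
  by move=> xi v v' _ _ _ -> ->.
move=> g [Vg [fg Hg]]; exists g; split=> //; split=> //; split=> [xi v /Hg []//|v ->].
by exists o; apply/Hg.
Qed.

Lemma small_level beta : beta ∈ a -> small (fun u => V u /\ in_rank u beta) a.
Proof.
elim/(well_founded_ind (@mem_wf U)): beta => beta IH ba; have Vb := V_in Va ba.
have := small_union (X := fun i => i ∈ beta) (Y := fun g u => forall y, y ∈ u -> in_rank y g) (small_mem ba).
case.
- by move=> i; apply: V_in Vb.
- dsolve.
- move=> g gb; have ga : g ∈ a by apply: (ordinal_trans inacc_ordinal ba).
  case: (V_level (V_in Vb gb)) => L [VL HL].
  have SL : small (fun v => v ∈ L) a by apply: small_sub (IH g gb ga) => v /HL.
  apply: small_sub (small_power VL SL) => v [Vv H]; split=> // y yv; apply/HL; split; last exact: H.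
  exact: V_in yv.
- move=> m [ma H]; exists m; split=> //; case: H => g [Vg [fg [D C]]]; exists g; split=> //; split=> //; split=> //.
  by move=> v [Vv /in_rank_iff K]; apply: C.
Qed.

Lemma small_in_rank x : V x -> in_rank x a -> small (fun v => v ∈ x) a.
Proof.
move=> Vx /in_rank_iff [beta [ba H]]; apply: small_sub (small_level ba) => v vx.
by split; [apply: V_in vx|apply: H].
Qed.

(** Regularity bounds the least levels containing the elements of [x]. *)
Lemma in_rank_small x : V x -> (forall v, v ∈ x -> in_rank v a) -> small (fun v => v ∈ x) a -> in_rank x a.
Proof.
move=> Vx H S.
case: (small_bound (Q := fun v beta => ordinal beta /\ in_rank v beta /\ forall b', b' ∈ beta -> ~ in_rank v b') S).
{ dsolve. }
{ move=> v b1 b2 _ _ [O1 [N1 m1]] [O2 [N2 m2]]; case: (ordinal_total O1 O2) => [K|[//|K]].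
  - by case: (m2 _ K).
  - by case: (m1 _ K). }
move=> c [ca Hc]; apply/in_rank_iff; exists c; split=> // v vx; case/in_rank_iff: (H v vx) => b [ba _].
have [beta [[ba' rv] m]] : exists beta, (beta ∈ a /\ in_rank v beta) /\ forall y, y ∈ beta -> ~ (y ∈ a /\ in_rank v y).
{ apply: below_min; case/in_rank_iff: (H v vx) => b' [b'a K]; case: (inacc_limit b'a) => b'' [b''a b'b].
  by exists b''; split=> //; apply/in_rank_iff; exists b'. }
have Oc := ordinal_mem inacc_ordinal ca.
apply: (in_rank_le rv); apply: (proj1 Oc); apply: (Hc v) => //; split; first exact: ordinal_mem inacc_ordinal ba'.
split=> // b' b'b K; apply: (m b' b'b); split=> //; exact: ordinal_trans inacc_ordinal ba' b'b.
Qed.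

Lemma in_rank_upair x y u : V x -> V y -> in_rank x a -> in_rank y a -> is_upair u x y -> in_rank u a.
Proof.
move=> Vx Vy rx ry Hu; have Vu : V u by case: (V_upair Vx Vy) => u' [Vu' Hu']; rewrite (upair_unique Hu Hu').
apply: in_rank_small => //; first by move=> v /Hu [->|->].
by apply: small_sub (small_cup (small_single Vx) (small_single Vy)) => v /Hu.
Qed.

Lemma in_rank_pair x y u : V x -> V y -> in_rank x a -> in_rank y a -> is_pair u x y -> in_rank u a.
Proof.
move=> Vx Vy rx ry P; have Vu : V u by case: (V_pair Vx Vy) => u' [Vu' Hu']; rewrite (pair_unique P Hu').
case: P => s [t [Hs [Ht Hu]]].
apply: (in_rank_upair _ _ _ _ Hu); [by apply: (V_in Vu); apply/Hu; left|by apply: (V_in Vu); apply/Hu; right| |].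
- exact: in_rank_upair Hs.
- exact: in_rank_upair Ht.
Qed.

Lemma in_rank_ordinal x : ordinal x -> x ∈ a -> in_rank x a.
Proof.
elim/(well_founded_ind (@mem_wf U)): x => x IH Ox xa; apply/in_rank_iff; exists x; split=> // y yx.
have K z : ordinal z -> forall w, w ∈ z -> in_rank w z.
{ elim/(well_founded_ind (@mem_wf U)): z => z IHz Oz w wz; apply/in_rank_iff; exists w; split=> // v vw.
  by apply: IHz => //; apply: ordinal_mem wz. }
exact: K.
Qed.

End Inaccessible.

(* The value at alpha is an element of V_kappa of least possible rank that was
   not used before; otherwise V_beta would be exhausted below delta. *)
Lemma enumeration kappa : V kappa -> inaccessible V kappa -> exists h, V h /\ is_function h /\
  (forall alpha y, app h alpha y -> alpha ∈ kappa /\ in_rank y kappa) /\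
  forall delta x, V delta -> inaccessible V delta -> subset delta kappa -> V x -> in_rank x delta ->
    exists alpha, alpha ∈ delta /\ app h alpha x.
Proof.
move=> Vk Ik; have Ok := inacc_ordinal Ik; case: (V_level Vk) => K [VK HK]; case: (choice_function VK) => c [Vc [fc Hc]].
case: V_empty => o [Vo Ho].
pose fresh (h u : U) := u ∈ K /\ ~ exists z, app h z u.
pose best (h u : U) := fresh h u /\ forall u', u' ∈ K -> fresh h u' -> forall beta, beta ∈ kappa -> in_rank u' beta -> in_rank u beta.
pose F (p x h y : U) := (exists Z, V Z /\ (forall u, V u -> (u ∈ Z <-> best h u)) /\ y ∈ Z /\ app c Z y) \/
  ((forall u, u ∈ K -> ~ best h u) /\ y = o).
have bestV h u : best h u -> V u by move=> [[uK _] _]; apply: V_in uK.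
case: (@recursion F).
{ rewrite /F /best /fresh; dsolve. }
{ move=> p x h Vp Vx Vh; case: (sep (x := K) (Q := best h)) => //; first by rewrite /best /fresh; dsolve.
  move=> Z [VZ HZ]; case: (classic (exists u, best h u)) => [[u bu]|N]; last first.
    by exists o; split=> //; right; split=> // u _ bu; apply: N; exists u.
  case: (Hc Z VZ); [by move=> z /HZ []|by exists u; apply/HZ; split=> //; case: bu => [[]]|].
  move=> y [yZ cy]; exists y; split; first exact: V_in yZ.
  left; exists Z; split=> //; split=> // v Vv; rewrite HZ; split=> [[]//|bv]; split=> //; by case: bv => [[]]. }
{ move=> p x h y y' Vp Vx Vh Vy Vy' H H'.
  case: H H' => [[Z [VZ [HZ [yZ cZ]]]]|[N ->]] [[Z' [VZ' [HZ' [yZ' cZ']]]]|[N' ->]] //.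
  - suff E : Z = Z' by subst Z'; case: fc => _; apply; eassumption.
    apply: mem_ext => z; split=> H; have Vz : V z by [apply: V_in VZ H|apply: V_in VZ' H].
    + by apply/HZ' => //; apply/HZ.
    + by apply/HZ => //; apply/HZ'.
  - have b := proj1 (HZ y Vy) yZ; by case: (N' y) => //; case: b => [[]].
  - have b := proj1 (HZ' y' Vy') yZ'; by case: (N y') => //; case: b => [[]]. }
move=> R [dR [Rtot [Rfun [Rin Req]]]].
case: (V_func (x := kappa) (Q := fun al y => R o al y)) => //; first by apply: (d_subst3 dR); tm_solve.
  by move=> al y y' _ _ _; apply: Rfun.
move=> h [Vh [fh Hh]]; exists h; split=> //; split=> //; split.
{ move=> al y /Hh [ak [Vy Ry]]; split=> //; case: (Rin _ _ _ Ry) => Val _.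
  case/(Req _ _ _ Vo Val Vy): Ry => g [_ [_ [_ [[Z [VZ [HZ [yZ _]]]]|[_ ->]]]]].
  - by case/(HZ y Vy): yZ => [[/HK []]].
  - by apply: in_rank_ordinal => //; [split=> z /Ho|apply: inacc_zero]. }
move=> delta x Vd Id dk Vx rx; apply: NNPP => N.
have N' al y : al ∈ delta -> R o al y -> y <> x.
{ move=> ad Ry E; subst y; apply: N; exists al; split=> //; apply/Hh; split=> //; exact: dk. }
case/in_rank_iff: (rx) => b0 [b0d Hb0]; case: (inacc_limit Id b0d) => beta [bd b0b].
have rxb : in_rank x beta by apply/in_rank_iff; exists b0.
have xK : x ∈ K by apply/HK; split=> //; apply: in_rank_le rx dk.
have vals al y : al ∈ delta -> R o al y -> in_rank y beta /\ forall al' y', al' ∈ al -> R o al' y' -> y' <> y.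
{ move=> ad Ry; case: (Rin _ _ _ Ry) => Val Vy; case/(Req _ _ _ Vo Val Vy): Ry => g [Vg [fg [Eg Fg]]].
  have fx : fresh g x by split=> // [[z /Eg [za Rz]]]; apply: (N' z x) => //; apply: ordinal_trans (inacc_ordinal Id) ad za.
  case: Fg => [[Z [VZ [HZ [yZ _]]]]|[Nb _]].
  - case/(HZ y Vy): yZ => [[yK fy] m]; split; first by apply: (m x) => //; apply: dk.
    by move=> al' y' aa Ry' E; subst y'; apply: fy; exists al'; apply/Eg.
  (* The default value does not occur here: [x] is fresh, so some fresh set has least rank. *)
  - case: (below_min (Q := fun b => b ∈ kappa /\ exists u, fresh g u /\ in_rank u b)).
      by exists beta; split; [apply: dk|exists x].
    move=> b [[bk [u [fu ru]]] m]; case: (Nb u); first by case: fu.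
    split=> // u' _ fu' b' bk' ru'; apply: (in_rank_le ru).
    have Ob := ordinal_mem Ok bk; have Ob' := ordinal_mem Ok bk'.
    apply: (ordinal_not_mem Ob Ob') => b'b; apply: (m b' b'b); split=> //; by exists u'. }
apply: (not_small_self Vd Id).
apply: (small_image (Q := fun y al => al ∈ delta /\ R o al y) Vd _ _ _ (small_level Vd Id bd)).
{ apply: d_and; first by dsolve. by apply: (d_subst3 dR); tm_solve. }
{ move=> y al al' _ _ _ [ad R1] [ad' R2]; have Od := inacc_ordinal Id.
  case: (ordinal_total (ordinal_mem Od ad) (ordinal_mem Od ad')) => [H|[//|H]].
  - by case: (vals _ _ ad' R2) => _ /(_ al y H R1).
  - by case: (vals _ _ ad R1) => _ /(_ al' y H R2). }
move=> al ad; have Val := V_in Vd ad; split=> //; case: (Rtot o al Vo Val) => y Ry; exists y.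
by case: (Rin _ _ _ Ry) => _ Vy; split=> //; split; [split=> //; case: (vals al y ad Ry)|].
Qed.

(** ** The forcing relation *)

Implicit Types (s p q r B f R P : U).

Lemma app_below s t p : app s t p -> below t s.
Proof. by move=> [u [us P]]; apply: below_fst us P. Qed.

Lemma val_iff (G : class U) s x : val G s x <->
  (forall t p, app s t p -> G p -> exists y, y ∈ x /\ val G t y) /\
  (forall y, y ∈ x -> exists t p, app s t p /\ G p /\ val G t y).
Proof.
split=> [[{}s {}x H1 H2]|[H1 H2]].
- split=> [t p [u [us P]] Gp|y /H2 [u [t [p [us [P H]]]]]]; first exact: (H1 u t p).
  by exists t, p; split=> //; exists u.
- apply: val_intro => [u t p us P Gp|y /H2 [t [p [[u [us P]] H]]]]; first by apply: (H1 t p) => //; exists u.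
  by exists u, t, p.
Qed.

Lemma val_fun (G : class U) s x y : val G s x -> val G s y -> x = y.
Proof.
elim/(@below_ind U): s x y => s IH x y /val_iff [H1 H2] /val_iff [K1 K2]; apply: mem_ext => z; split.
- move=> /H2 [t [p [A [Gp v]]]]; case: (K1 t p A Gp) => z' [zy v']; by rewrite (IH t (app_below A) z z').
- move=> /K2 [t [p [A [Gp v]]]]; case: (H1 t p A Gp) => z' [zy v']; by rewrite (IH t (app_below A) z z').
Qed.

(* [R] is a set of pairs on which it behaves like the valuation of names; unlike [val] this
   is a first-order property of sets, so it transfers along embeddings. *)
Definition valrel R P f := forall s x, app R s x ->
  (forall t p, app s t p -> p ∈ P -> subset p f -> exists y, y ∈ x /\ app R t y) /\
  (forall y, y ∈ x -> exists t p, app s t p /\ (p ∈ P /\ subset p f) /\ app R t y).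

Lemma valrel_sound R P f s x : valrel R P f -> app R s x -> val (filter_of P f) s x.
Proof.
move=> H; elim/(@below_ind U): s x => s IH x /H [H1 H2]; apply/val_iff; split.
- move=> t p A [pP pf]; case: (H1 t p A pP pf) => y [yx B]; exists y; split=> //; exact: IH (app_below A) _ B.
- move=> y /H2 [t [p [A [Gp B]]]]; exists t, p; split=> //; split=> //; exact: IH (app_below A) _ B.
Qed.

Section Forcing.
Context (P : U) (VP : V P).

Definition inB B p s t := exists v, V v /\ is_pair v s t /\ app B p v.

Definition sim (E : U -> U -> U -> Prop) p s t :=
  (forall s' r, app s s' r -> r ∈ P -> forall q, q ∈ P -> subset p q -> subset r q ->
     exists q', q' ∈ P /\ subset q q' /\ exists t' r', app t t' r' /\ r' ∈ P /\ subset r' q' /\ E q' s' t') /\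
  (forall t' r, app t t' r -> r ∈ P -> forall q, q ∈ P -> subset p q -> subset r q ->
     exists q', q' ∈ P /\ subset q q' /\ exists s' r', app s s' r' /\ r' ∈ P /\ subset r' q' /\ E q' s' t').

(* [p] forces [s = t].  By well-foundedness the greatest relation that is
   stable under [sim] is also the least one, which makes recursion unnecessary. *)
Definition feq p s t := exists B, V B /\
  (forall q v, app B q v -> forall s' t', is_pair v s' t' -> sim (inB B) q s' t') /\ inB B p s t.

Lemma d_feq t1 t2 t3 : tm (F := FV) t1 -> tm (F := FV) t2 -> tm (F := FV) t3 ->
  dfn (F := FV) (fun i e => feq (t1 i e) (t2 i e) (t3 i e)).
Proof. move=> H1 H2 H3; rewrite /feq /sim /inB; dsolve. Qed.

Lemma sim_mono (E E' : U -> U -> U -> Prop) p s t : sim E p s t ->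
  (forall q s' t' r r', q ∈ P -> app s s' r -> app t t' r' -> E q s' t' -> E' q s' t') -> sim E' p s t.
Proof.
move=> [H1 H2] EE; split=> x r A rP q qP pq rq.
- case: (H1 x r A rP q qP pq rq) => q' [qP' [qq [t' [r' [A' [rP' [rq' e]]]]]]].
  exists q'; split=> //; split=> //; exists t', r'; do 3 (split=> //); exact: EE A A' e.
- case: (H2 x r A rP q qP pq rq) => q' [qP' [qq [t' [r' [A' [rP' [rq' e]]]]]]].
  exists q'; split=> //; split=> //; exists t', r'; do 3 (split=> //); exact: EE A' A e.
Qed.

Lemma feq_sim p s t : feq p s t -> sim feq p s t.
Proof.
move=> [B [VB [HB [v [Vv [Pv A]]]]]]; apply: (sim_mono (HB p v A s t Pv)).
by move=> q s' t' r r' _ _ _ H; exists B.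
Qed.

(** Coinduction: the forced equalities between elements of a transitive set around [s] and [t],
    together with the new triple, are stable under [sim]. *)
Lemma sim_feq p s t : p ∈ P -> V s -> V t -> sim feq p s t -> feq p s t.
Proof.
move=> pP Vs Vt S.
have [T [VT [TT [sT tT]]]] : exists T, V T /\ transitive_set T /\ s ∈ T /\ t ∈ T.
{ case: (V_pair Vs Vt) => w [Vw Pw]; case: (V_trans_ex Vw) => T [VT [TT wT]]; exists T; split=> //; split=> //.
  by split; [case: (pair_fst_mem Pw)|case: (pair_snd_mem Pw)] => d [dw sd]; apply: (TT d) => //; apply: (TT w). }
have Tin x x' r : x ∈ T -> app x x' r -> x' ∈ T.
{ move=> xT [u [ux Pu]]; case: (pair_fst_mem Pu) => d [du xd]; apply: (TT d) => //; apply: (TT u) => //.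
  exact: (TT x). }
case: (V_prod VT VT) => T2 [VT2 HT2]; case: (V_prod VP VT2) => T3 [VT3 HT3].
case: (sep (x := T3) (Q := fun u => exists q v, is_pair u q v /\ exists s' t', is_pair v s' t' /\
   (feq q s' t' \/ (q = p /\ s' = s /\ t' = t)))) => //.
{ apply: d_ex_pair; first tm_solve. apply: d_ex_pair; first tm_solve. apply: d_or; last by dsolve.
  by apply: d_feq; tm_solve. }
move=> B [VB HB].
have mB q s' t' : q ∈ P -> s' ∈ T -> t' ∈ T -> (feq q s' t' \/ (q = p /\ s' = s /\ t' = t)) -> inB B q s' t'.
{ move=> qP sT' tT' H; case: (V_pair (V_in VT sT') (V_in VT tT')) => v [Vv Pv].
  case: (V_pair (V_in VP qP) Vv) => u [Vu Pu]; exists v; split=> //; split=> //; exists u; split=> //; apply/HB.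
  split; last by exists q, v; split=> //; exists s', t'.
  apply/HT3; exists q, v; split=> //; split=> //; apply/HT2; by exists s', t'. }
exists B; split=> //; split; last by apply: mB => //; right.
move=> q v [u [/HB [/HT3 [q2 [v2 [qP2 [/HT2 [s2 [t2 [sT2 [tT2 Pv2]]]] Pu2]]]]]
  [q1 [v1 [Pu1 [s1 [t1 [Pv1 H]]]]]]] Pu] s' t' Pv.
case: (pair_inj Pu Pu1) => ? ?; case: (pair_inj Pu Pu2) => ? ?; subst q1 q2 v1 v2.
case: (pair_inj Pv Pv1) => ? ?; case: (pair_inj Pv Pv2) => ? ?; subst s1 s2 t1 t2.
have S' : sim feq q s' t' by case: H => [/feq_sim //|[-> [-> ->]]].
apply: (sim_mono S') => q' s2 t2 r r' qP' A A' e; apply: mB => //; [exact: Tin A|exact: Tin A'|by left].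
Qed.

Lemma feq_mono p q s t : q ∈ P -> V s -> V t -> subset p q -> feq p s t -> feq q s t.
Proof.
move=> qP Vs Vt pq /feq_sim [H1 H2]; apply: sim_feq => //; split=> x r A rP q' qP' qq' rq'.
- by apply: (H1 x r) => //; move=> z /pq /qq'.
- by apply: (H2 x r) => //; move=> z /pq /qq'.
Qed.

Lemma feq_regular p s t : p ∈ P -> V s -> V t ->
  (forall q, q ∈ P -> subset p q -> exists r, r ∈ P /\ subset q r /\ feq r s t) -> feq p s t.
Proof.
move=> pP Vs Vt D; apply: sim_feq => //; split=> x r A rP q qP pq rq;
  case: (D q qP pq) => q1 [qP1 [qq1 /feq_sim [H1 H2]]].
- case: (H1 x r A rP q1 qP1) => //; first by move=> z /rq /qq1.
  by move=> q' [qP' [qq' H]]; exists q'; split=> //; split=> // z /qq1 /qq'.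
- case: (H2 x r A rP q1 qP1) => //; first by move=> z /rq /qq1.
  by move=> q' [qP' [qq' H]]; exists q'; split=> //; split=> // z /qq1 /qq'.
Qed.

Definition fmem p s t := forall q, q ∈ P -> subset p q -> exists r, r ∈ P /\ subset q r /\
  exists t' r', app t t' r' /\ r' ∈ P /\ subset r' r /\ feq r s t'.

Lemma d_fmem t1 t2 t3 : tm (F := FV) t1 -> tm (F := FV) t2 -> tm (F := FV) t3 ->
  dfn (F := FV) (fun i e => fmem (t1 i e) (t2 i e) (t3 i e)).
Proof.
move=> H1 H2 H3; rewrite /fmem; repeat first [apply: d_feq; [tm_solve|tm_solve|tm_solve] | dstep].
Qed.

(** Formulas are built with falsity, implication and universal quantification only. For these,
    clauses in the style of Kripke already give a relation that is determined by dense sets, because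
    the atomic ones are; see [forces_regular]. *)
Fixpoint forces (phi : fm) (e : nat -> U) (p : U) : Prop :=
  match phi with
  | FMem i k => fmem p (e i) (e k)
  | FEq i k => feq p (e i) (e k)
  | FBot => False
  | FImp a b => forall q, q ∈ P -> subset p q -> forces a e q -> forces b e q
  | FAll a => forall x, V x -> forces a (scons x e) p
  end.

Lemma d_forces phi : forall (T : nat -> ix FV -> (nat -> U) -> U) (t : ix FV -> (nat -> U) -> U),
  (forall n, tm (T n)) -> tm t ->
  dfn (F := FV) (fun i e => forces phi (fun n => T n i e) (t i e)).
Proof.
elim: phi => /= [i k|i k||a IHa b IHb|a IH] T t HT Ht.
- exact: d_fmem.
- exact: d_feq.
- exact: d_bot.
- apply: (d_ball (F := FV) (t := fun _ _ => P)
    (Q := fun i q e => subset (t i e) q -> forces a (fun n => T n i e) q -> forces b (fun n => T n i e) q)).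
    by apply: (@tm_par U FV (fun _ => P)).
  apply: d_imp; first by dsolve.
  apply: d_imp.
  + by apply: (IHa (fun n i e => T n i (fun m => e (S m))) (fun i e => e 0)); [move=> n; apply: tm_shift|tm_solve].
  + by apply: (IHb (fun n i e => T n i (fun m => e (S m))) (fun i e => e 0)); [move=> n; apply: tm_shift|tm_solve].
- apply: (d_all (F := FV) (Q := fun i x e => forces a (scons x (fun n => T n i e)) (t i e))).
  pose T' n := match n with 0 => fun (i : ix FV) (e : nat -> U) => e 0
    | S n => fun i e => T n i (fun n => e (S n)) end.
  have HT' n : tm (T' n) by case: n => [|n]; [exact: (@tm_var U FV 0)|exact: tm_shift].
  apply: d_ext (IH T' _ HT' (tm_shift Ht)) => i e He.
  suff -> : scons (e 0) (fun n => T n i (fun n => e (S n))) = fun n => T' n i e by [].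
  by apply: functional_extensionality; case.
Qed.

Lemma forces_mono phi : forall e p q, (forall n, V (e n)) -> q ∈ P -> subset p q ->
  forces phi e p -> forces phi e q.
Proof.
elim: phi => /= [i k|i k||a IHa b IHb|a IH] e p q Ve qP pq //.
- by move=> H r rP qr; apply: H => // z /pq /qr.
- by apply: feq_mono.
- by move=> H r rP qr; apply: H => // z /pq /qr.
- by move=> H x Vx; apply: (IH _ p) => //; [case|apply: H].
Qed.

Lemma forces_regular phi : forall e p, (forall n, V (e n)) -> p ∈ P ->
  (forall q, q ∈ P -> subset p q -> exists r, r ∈ P /\ subset q r /\ forces phi e r) -> forces phi e p.
Proof.
elim: phi => /= [i k|i k||a IHa b IHb|a IH] e p Ve pP D.
- move=> q qP pq; case: (D q qP pq) => r [rP [qr H]]; case: (H r rP) => // r' [rP' [rr K]].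
  by exists r'; split=> //; split=> // z /qr /rr.
- exact: feq_regular.
- by case: (D p pP) => // r [_ [_ []]].
- move=> q qP pq Ha; apply: IHb => // q' qP' qq'; case: (D q' qP') => [z /pq /qq' //|r [rP [qr H]]].
  exists r; split=> //; split=> //; apply: H => //; apply: (forces_mono (p := q)) => // z /qq' /qr //.
- move=> x Vx; apply: IH => //; first by case.
  by move=> q qP pq; case: (D q qP pq) => r [rP [qr H]]; exists r; split=> //; split=> //; apply: H.
Qed.

(** ** Names *)

Context (o : U) (Ho : forall z, ~ z ∈ o) (oP : o ∈ P).

Lemma Vo : V o.
Proof. exact: V_in VP oP. Qed.
Hint Resolve Vo : dpar.

(** The empty condition [o] is contained in every condition and so belongs to every generic filter;
    hence the value of a check name does not depend on the filter. *)
Definition chkF (p x h y : U) := forall u, V u -> (u ∈ y <-> exists z w, app h z w /\ is_pair u w o).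

Definition chk x s := Rec chkF o x s.

Lemma chk_rec : dfn (F := FV) (fun _ e => chk (e 0) (e 1)) /\
  (forall x, V x -> exists s, chk x s) /\ (forall x s s', chk x s -> chk x s' -> s = s') /\
  (forall x s, chk x s -> V x /\ V s) /\
  (forall x s, chk x s -> forall u, u ∈ s <-> V u /\ exists z w, z ∈ x /\ chk z w /\ is_pair u w o).
Proof.
have Vo' := Vo.
case: (recursion_Rec (F := chkF)).
{ rewrite /chkF; dsolve. }
{ move=> p x h Vp Vx Vh; case: (app_union3 Vh) => b [Vb Hb]; case: (V_single Vo) => so [Vso Hso].
  case: (V_prod Vb Vso) => c [Vc Hc].
  case: (sep (x := c) (Q := fun u => exists z w, app h z w /\ is_pair u w o)) => //; first by dsolve.
  move=> y [Vy Hy]; exists y; split=> // u Vu; rewrite Hy; split=> [[]//|H]; split=> //.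
  by case: H => z [w [A Pu]]; apply/Hc; exists w, o; split; [case: (Hb z w A)|split=> //; apply/Hso]. }
{ move=> p z h y y' Vp Vz Vh Vy Vy' H H'; apply: mem_ext => u; split=> K.
  - by apply/H'; [apply: V_in K|apply/H => //; apply: V_in K].
  - by apply/H; [apply: V_in K|apply/H' => //; apply: V_in K]. }
move=> dR [Rtot [Rfun [Rin Req]]]; split; first by apply: (d_subst3 dR); tm_solve.
split; first by move=> x Vx; apply: Rtot.
split; first by move=> x s s'; apply: Rfun.
split; first by move=> x s; apply: Rin.
move=> x s H; case: (Rin _ _ _ H) => Vx Vs; case/(Req _ _ _ Vo Vx Vs): H => h [Vh [fh [Eh Fh]]] u.
split=> [us|[Vu [z [w [zx [R Pu]]]]]].
- have Vu := V_in Vs us; split=> //; case/(Fh u Vu): us => z [w [/Eh [zx R] Pu]]; by exists z, w.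
- by apply/(Fh u Vu); exists z, w; split=> //; apply/Eh.
Qed.

Lemma d_chk t1 t2 : tm (F := FV) t1 -> tm (F := FV) t2 -> dfn (F := FV) (fun i e => chk (t1 i e) (t2 i e)).
Proof. by move=> H1 H2; apply: (d_subst2 (proj1 chk_rec)). Qed.

Lemma chk_ex x : V x -> exists s, chk x s.
Proof. by case: chk_rec => _ [H _]; apply: H. Qed.

Lemma chk_fun x s s' : chk x s -> chk x s' -> s = s'.
Proof. by case: chk_rec => _ [_ [H _]]; apply: H. Qed.

Lemma chk_in x s : chk x s -> V x /\ V s.
Proof. by case: chk_rec => _ [_ [_ [H _]]]; apply: H. Qed.

Lemma chk_app x s t p : chk x s -> (app s t p <-> p = o /\ exists z, z ∈ x /\ chk z t).
Proof.
case: chk_rec => _ [_ [_ [Hin H]]] /H {}H; split=> [[u [/H [_ [z [w [zx [c Pu]]]]] Pu']]|[-> [z [zx c]]]].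
- by case: (pair_inj Pu Pu') => ? ?; subst; split=> //; exists z.
- case: (V_pair (proj2 (Hin _ _ c)) Vo) => u [Vu Pu]; exists u; split=> //; apply/H; split=> //; by exists z, t.
Qed.

Lemma chk_val (G : class U) x s : G o -> chk x s -> val G s x.
Proof.
move=> Go; elim/(well_founded_ind (@mem_wf U)): x s => x IH s c; apply/val_iff; split.
- by move=> t p /(chk_app _ _ c) [_ [z [zx cz]]] _; exists z; split=> //; apply: IH.
- move=> z zx; case: (chk_ex (V_in (proj1 (chk_in c)) zx)) => t ct; exists t, o.
  by split; [apply/(chk_app _ _ c); split=> //; exists z|split=> //; apply: IH].
Qed.

Definition upn s t m := forall u, V u -> (u ∈ m <-> is_pair u s o \/ is_pair u t o).

Lemma upn_ex s t : V s -> V t -> exists m, V m /\ upn s t m.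
Proof.
move=> Vs Vt; case: (V_pair Vs Vo) => a [Va Pa]; case: (V_pair Vt Vo) => b [Vb Pb].
case: (V_upair Va Vb) => m [Vm Hm]; exists m; split=> // u Vu; rewrite Hm.
by split=> [[->|->]|[H|H]]; [left|right|left; apply: pair_unique H Pa|right; apply: pair_unique H Pb].
Qed.

Lemma upn_val (G : class U) s t m x y z : G o -> V s -> V t -> V m -> upn s t m ->
  val G s x -> val G t y -> val G m z -> is_upair z x y.
Proof.
move=> Go Vs Vt Vm H vx vy /val_iff [Z1 Z2] w.
have A t' p : app m t' p <-> p = o /\ (t' = s \/ t' = t).
{ split=> [[u [um Pu]]|[-> [->|->]]].
  - by case/(H u (V_in Vm um)): um => Pu'; case: (pair_inj Pu Pu') => ? ?; subst; tauto.
  - by case: (V_pair Vs Vo) => u [Vu Pu]; exists u; split=> //; apply/H => //; left.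
  - by case: (V_pair Vt Vo) => u [Vu Pu]; exists u; split=> //; apply/H => //; right. }
split=> [/Z2 [t' [p [/A [_ [->|->]] [_ v]]]]|[->|->]].
- by left; apply: val_fun v vx.
- by right; apply: val_fun v vy.
- case: (Z1 s o) => //; first by apply/A; tauto.
  by move=> x' [x'z v]; rewrite (val_fun vx v).
- case: (Z1 t o) => //; first by apply/A; tauto.
  by move=> x' [x'z v]; rewrite (val_fun vy v).
Qed.

Definition opn s t n := exists m1, V m1 /\ upn s s m1 /\ exists m2, V m2 /\ upn s t m2 /\ upn m1 m2 n.

Lemma opn_ex s t : V s -> V t -> exists n, V n /\ opn s t n.
Proof.
move=> Vs Vt; case: (upn_ex Vs Vs) => m1 [V1 H1]; case: (upn_ex Vs Vt) => m2 [V2 H2].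
by case: (upn_ex V1 V2) => n [Vn Hn]; exists n; split=> //; exists m1; do 2 (split=> //); exists m2.
Qed.

Lemma opn_val (G : class U) s t n x y z : G o -> V s -> V t -> V n -> opn s t n ->
  val G s x -> val G t y -> val G n z -> is_pair z x y.
Proof.
move=> Go Vs Vt Vn [m1 [V1 [H1 [m2 [V2 [H2 Hn]]]]]] vx vy vz.
case/val_iff: (vz) => Z1 _.
have A m : (m = m1 \/ m = m2) -> app n m o.
{ move=> Hm; have Vm : V m by case: Hm => ->.
  case: (V_pair Vm Vo) => u [Vu Pu]; exists u; split=> //; apply/Hn => //; by case: Hm Pu => ->; tauto. }
case: (Z1 m1 o (A m1 (or_introl eq_refl)) Go) => z1 [_ v1]; case: (Z1 m2 o (A m2 (or_intror eq_refl)) Go) => z2 [_ v2].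
exists z1, z2; split; first exact: (upn_val Go Vs Vs V1 H1 vx vx v1).
split; first exact: (upn_val Go Vs Vt V2 H2 vx vy v2).
exact: (upn_val Go V1 V2 Vn Hn v1 v2 vz).
Qed.

(* [S * {o}] is a name for the set of the values of the elements of [S]. *)
Definition setn S n := forall u, V u -> (u ∈ n <-> exists s, s ∈ S /\ is_pair u s o).

Lemma setn_ex S : V S -> exists n, V n /\ setn S n.
Proof.
move=> VS; case: (V_single Vo) => so [Vso Hso]; case: (V_prod VS Vso) => n [Vn Hn]; exists n; split=> // u Vu.
rewrite Hn; split=> [[s [y [sS [/Hso -> Pu]]]]|[s [sS Pu]]]; first by exists s.
by exists s, o; split=> //; split=> //; apply/Hso.
Qed.

Lemma setn_val (G : class U) S n B : G o -> V S -> V n -> setn S n -> val G n B ->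
  (forall x, x ∈ B <-> exists s, s ∈ S /\ val G s x) /\ (forall s, s ∈ S -> exists x, val G s x).
Proof.
move=> Go VS Vn H /val_iff [B1 B2].
have A s p : app n s p <-> p = o /\ s ∈ S.
{ split=> [[u [un Pu]]|[-> sS]].
  - by case/(H u (V_in Vn un)): un => s' [sS Pu']; case: (pair_inj Pu Pu') => ? ?; subst.
  - by case: (V_pair (V_in VS sS) Vo) => u [Vu Pu]; exists u; split=> //; apply/H => //; exists s. }
have ex s : s ∈ S -> exists x, x ∈ B /\ val G s x by move=> sS; apply: (B1 s o) => //; apply/A.
split=> [x|s /ex [x [_ v]]]; last by exists x.
split=> [/B2 [s [p [/A [_ sS] [_ v]]]]|[s [sS v]]]; first by exists s.
by case: (ex s sS) => x' [xB v']; rewrite (val_fun v v').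
Qed.

(** The canonical name of [f], which is the union of the filter and not the filter itself. *)
Definition fdot n := forall u, V u -> (u ∈ n <-> exists p, p ∈ P /\ exists x, x ∈ p /\ exists s, V s /\ chk x s /\ is_pair u s p).

Lemma fdot_ex : exists n, V n /\ fdot n.
Proof.
case: (V_union VP) => X [VX HX].
case: (collection (x := X) (Q := chk)) => //; first by apply: d_chk; tm_solve.
move=> S [VS [_ HS]]; case: (V_prod VS VP) => SP [VSP HSP].
case: (sep (x := SP) (Q := fun u => exists p, p ∈ P /\ exists x, x ∈ p /\ exists s, V s /\ chk x s /\ is_pair u s p)) => //.
  by repeat first [apply: d_chk; tm_solve | dstep].
move=> n [Vn Hn]; exists n; split=> // u Vu; rewrite Hn; split=> [[]//|H]; split=> //.
case: H => p [pP [x [xp [s [Vs [c Pu]]]]]]; apply/HSP; exists s, p; split=> //.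
case: (HS x s) => //; first by apply/HX; exists p.
by move=> s' [sS c']; rewrite (chk_fun c c').
Qed.

Lemma fdot_val f n : V n -> fdot n -> (exists p, filter_of P f p) ->
  (forall x, x ∈ f <-> exists p, filter_of P f p /\ x ∈ p) -> val (filter_of P f) n f.
Proof.
move=> Vn H _ Hf; have Go : filter_of P f o by split=> // z /Ho.
apply/val_iff; split.
- move=> t p [u [un Pu]] Gp; case/(H u (V_in Vn un)): un => p' [pP' [x [xp [s [Vs [c Pu']]]]]].
  case: (pair_inj Pu Pu') => ? ?; subst t p'; exists x; split; first by apply/Hf; exists p.
  exact: chk_val.
- move=> x /Hf [p [Gp xp]]; have Vp := V_in VP (proj1 Gp); case: (chk_ex (V_in Vp xp)) => s c; exists s, p.
  have [_ Vs] := chk_in c; split; last by split=> //; apply: chk_val.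
  case: (V_pair Vs Vp) => u [Vu Pu]; exists u; split=> //; apply/H => //; exists p; split; first by case: Gp.
  by exists x; split=> //; exists s.
Qed.

(** * Generic extensions: the truth lemma and closure properties of [V[f]] *)

Section Generic.
Context (f : U) (f_gen : generic V P f) (f_ext : extension_exists V P f).
Local Notation G := (filter_of P f).
Local Notation W := (extension V P f).

Lemma gen_ex : exists p, G p.
Proof. by case: f_gen. Qed.

Lemma gen_dir p q : G p -> G q -> exists r, G r /\ subset p r /\ subset q r.
Proof. by case: f_gen => _ [H _]; apply: H. Qed.

(** Adding the conditions incompatible with [p] makes the set dense everywhere; the generic cannot
    meet it there, as it contains [p] and is directed. *)
Lemma gen_below p (Q : U -> Prop) : G p -> dfn (F := FV) (fun _ e => Q (e 0)) ->
  (forall q, q ∈ P -> subset p q -> exists r, r ∈ P /\ subset q r /\ Q r) ->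
  exists r, G r /\ subset p r /\ Q r.
Proof.
move=> Gp dQ D; have Vp : V p by apply: V_in VP (proj1 Gp).
case: (sep (x := P) (Q := fun r => (subset p r /\ Q r) \/ ~ exists r', r' ∈ P /\ subset p r' /\ subset r r')) => //.
{ apply: d_or; last by dsolve. by apply: d_and => //; dsolve. }
move=> D0 [VD0 HD0]; case: f_gen => _ [_ [/(_ D0 VD0) K _]]; case: K.
{ split=> [r /HD0 []//|q qP]; case: (classic (exists r', r' ∈ P /\ subset p r' /\ subset q r')) => [[r' [rP' [pr qr]]]|N].
  - case: (D r' rP' pr) => r [rP [rr Qr]]; exists r; split; last by move=> z /qr /rr.
    by apply/HD0; split=> //; left; split=> // z /pr /rr.
  - by exists q; split=> //; apply/HD0; split=> //; right. }
move=> r [/HD0 [rP [[pr Qr]|N]] Gr]; first by exists r.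
by case: (gen_dir Gp Gr) => r' [[rP' _] [pr rr]]; case: N; exists r'.
Qed.

Lemma gen_down p q : G q -> p ∈ P -> subset p q -> G p.
Proof. by move=> [qP qf] pP pq; split=> // z /pq /qf. Qed.

Lemma feq_sound s : forall t x y p, V s -> V t -> G p -> feq p s t -> val G s x -> val G t y -> x = y.
Proof.
elim/(@below_ind U): s => s IH t x y p Vs Vt Gp /feq_sim [H1 H2] /val_iff [X1 X2] /val_iff [Y1 Y2].
have key s' t' r r' q z z' : app s s' r -> app t t' r' -> G q -> feq q s' t' -> val G s' z -> val G t' z' -> z = z'.
{ move=> A A' Gq e v v'; apply: (IH s' (app_below A) t' z z' q) => //.
  - by case: (app_in V_trans Vs A).
  - by case: (app_in V_trans Vt A'). }
apply: mem_ext => z; split.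
- move=> /X2 [s' [r [A [Gr v]]]]; case: (gen_dir Gp Gr) => q [Gq [pq rq]].
  have [Vs' Vr] := app_in V_trans Vs A.
  case: (gen_below (p := q) (Q := fun q' => exists t' r', app t t' r' /\ r' ∈ P /\ subset r' q' /\ feq q' s' t')) => //.
  + by repeat first [apply: d_feq; [tm_solve|tm_solve|tm_solve] | dstep].
  + move=> q1 qP1 qq1; apply: (H1 s' r) => //; first by case: Gr.
      by move=> w /pq /qq1. by move=> w /rq /qq1.
  + move=> q' [Gq' [_ [t' [r' [A' [rP' [rq' e]]]]]]]; have Gr' := gen_down Gq' rP' rq'.
    case: (Y1 t' r' A' Gr') => z' [zy v']; by rewrite (key s' t' r r' q' z z').
- move=> /Y2 [t' [r [A [Gr v]]]]; case: (gen_dir Gp Gr) => q [Gq [pq rq]].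
  have [Vs' Vr] := app_in V_trans Vt A.
  case: (gen_below (p := q) (Q := fun q' => exists s' r', app s s' r' /\ r' ∈ P /\ subset r' q' /\ feq q' s' t')) => //.
  + by repeat first [apply: d_feq; [tm_solve|tm_solve|tm_solve] | dstep].
  + move=> q1 qP1 qq1; apply: (H2 t' r) => //; first by case: Gr.
      by move=> w /pq /qq1. by move=> w /rq /qq1.
  + move=> q' [Gq' [_ [s' [r' [A' [rP' [rq' e]]]]]]]; have Gr' := gen_down Gq' rP' rq'.
    case: (X1 s' r' A' Gr') => z' [zy v']; by rewrite -(key s' t' r' r q' z' z).
Qed.

(** A condition that does not force equality has an extension with property [neg1] or [neg2]: an
    element of one name which no extension identifies with an element of the other. The generic
    meets one of the three alternatives, and equal values exclude the last two by induction. *)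
Lemma feq_complete s : forall t x, V s -> V t -> val G s x -> val G t x -> exists p, G p /\ feq p s t.
Proof.
elim/(@below_ind U): s => s IH t x Vs Vt /val_iff [X1 X2] /val_iff [Y1 Y2].
pose neg1 r := exists s' r0, app s s' r0 /\ r0 ∈ P /\ subset r0 r /\
  forall q, q ∈ P -> subset r q -> forall t' r', app t t' r' -> r' ∈ P -> subset r' q -> ~ feq q s' t'.
pose neg2 r := exists t' r0, app t t' r0 /\ r0 ∈ P /\ subset r0 r /\
  forall q, q ∈ P -> subset r q -> forall s' r', app s s' r' -> r' ∈ P -> subset r' q -> ~ feq q s' t'.
case: gen_ex => p0 Gp0.
case: (gen_below (p := p0) (Q := fun r => feq r s t \/ neg1 r \/ neg2 r)) => //.
{ by rewrite /neg1 /neg2; repeat first [apply: d_feq; [tm_solve|tm_solve|tm_solve] | dstep]. }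
{ move=> q qP _; case: (classic (exists r, r ∈ P /\ subset q r /\ (neg1 r \/ neg2 r))) => [[r [rP [qr H]]]|N].
    by exists r; split=> //; split=> //; right.
  exists q; split=> //; split=> //; left; apply: sim_feq => //; split=> x' r0 A rP q1 qP1 qq1 rq1.
  - apply: NNPP => N'; apply: N; exists q1; split=> //; split=> //; left; exists x', r0; do 3 (split=> //).
    move=> q' qP' qq' t' r' A' rP' rq' e; apply: N'; exists q'; split=> //; split=> //; by exists t', r'.
  - apply: NNPP => N'; apply: N; exists q1; split=> //; split=> //; right; exists x', r0; do 3 (split=> //).
    move=> q' qP' qq' t' r' A' rP' rq' e; apply: N'; exists q'; split=> //; split=> //; by exists t', r'. }
have key s' t' r r' z : app s s' r -> app t t' r' -> val G s' z -> val G t' z -> exists p, G p /\ feq p s' t'.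
{ move=> A A' v v'; apply: (IH s' (app_below A) t' z) => //.
  - by case: (app_in V_trans Vs A).
  - by case: (app_in V_trans Vt A'). }
move=> r [Gr [_ [e|[]]]]; first by exists r.
- move=> [s' [r0 [A [rP0 [r0r N]]]]]; case: (X1 s' r0 A (gen_down Gr rP0 r0r)) => z [zx v].
  case: (Y2 z zx) => t' [r' [A' [Gr' v']]]; case: (key s' t' r0 r' z) => // p [Gp e].
  case: (gen_dir Gr Gp) => q [Gq [rq pq]]; case: (gen_dir Gq Gr') => q' [Gq' [qq' rq']].
  case: (N q' (proj1 Gq') (fun w H => qq' w (rq w H)) t' r' A' (proj1 Gr') rq').
  apply: (feq_mono (p := p)) => //; first exact: (proj1 Gq').
  + by case: (app_in V_trans Vs A).
  + by case: (app_in V_trans Vt A').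
  + by move=> w /pq /qq'.
- move=> [t' [r0 [A [rP0 [r0r N]]]]]; case: (Y1 t' r0 A (gen_down Gr rP0 r0r)) => z [zx v].
  case: (X2 z zx) => s' [r' [A' [Gr' v']]]; case: (key s' t' r' r0 z) => // p [Gp e].
  case: (gen_dir Gr Gp) => q [Gq [rq pq]]; case: (gen_dir Gq Gr') => q' [Gq' [qq' rq']].
  case: (N q' (proj1 Gq') (fun w H => qq' w (rq w H)) s' r' A' (proj1 Gr') rq').
  apply: (feq_mono (p := p)) => //; first exact: (proj1 Gq').
  + by case: (app_in V_trans Vs A').
  + by case: (app_in V_trans Vt A).
  + by move=> w /pq /qq'.
Qed.

(** For implications and quantifiers, the conditions that force the formula or a definite
    counterexample are dense: by [forces_regular], a condition not forcing a formula has an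
    extension none of whose extensions forces it. *)
Theorem truth phi : forall (e x : nat -> U), (forall n, V (e n)) -> (forall n, val G (e n) (x n)) ->
  (sat W x phi <-> exists p, G p /\ forces phi e p).
Proof.
elim: phi => /= [i k|i k||a IHa b IHb|a IH] e x Ve vx.
- split=> [H|[p [Gp H]]].
  + case/val_iff: (vx k) => _ /(_ _ H) [t' [r' [A [Gr' v]]]].
    have [Vt' _] := app_in V_trans (Ve k) A.
    case: (feq_complete (Ve i) Vt' (vx i) v) => p [Gp e0]; case: (gen_dir Gp Gr') => q [Gq [pq rq]].
    exists q; split=> // q1 qP1 qq1; exists q1; split=> //; split=> //; exists t', r'; split=> //.
    split; first by case: Gr'. split; first by move=> z /rq /qq1.
    by apply: (feq_mono (p := p)) => // z /pq /qq1.
  + case: (gen_below (p := p) (Q := fun r => exists t' r', app (e k) t' r' /\ r' ∈ P /\ subset r' r /\ feq r (e i) t')) => //.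
      have V1 := Ve i; have V2 := Ve k.
      by repeat first [apply: d_feq; [tm_solve|tm_solve|tm_solve] | dstep].
    move=> r [Gr [_ [t' [r' [A [rP' [rr' e0]]]]]]]; case/val_iff: (vx k) => /(_ _ _ A (gen_down Gr rP' rr')) [z [zx v]] _.
    have [Vt' _] := app_in V_trans (Ve k) A.
    by rewrite (feq_sound (Ve i) Vt' Gr e0 (vx i) v).
- split=> [H|[p [Gp H]]]; last exact: (feq_sound (Ve i) (Ve k) Gp H (vx i) (vx k)).
  by apply: (feq_complete (x := x i)) => //; rewrite H.
- by split=> // [[p [_ []]]].
- split=> [H|[p [Gp H]] Ha].
  + case: gen_ex => p0 Gp0.
    case: (gen_below (p := p0) (Q := fun p => (forall q, q ∈ P -> subset p q -> forces a e q -> forces b e q) \/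
       (forces a e p /\ forall q, q ∈ P -> subset p q -> ~ forces b e q))) => //.
    * have dF (c : fm) (t : ix FV -> (nat -> U) -> U) : tm t -> dfn (F := FV) (fun i0 e0 => forces c e (t i0 e0)).
        by move=> Ht; apply: (d_forces c (T := fun n _ _ => e n)) => // n; apply: tm_par; apply: Ve.
      by repeat first [apply: dF; tm_solve | dstep].
    * move=> q qP _; case: (classic (forall q', q' ∈ P -> subset q q' -> forces a e q' -> forces b e q')) => [K|K].
        by exists q; split=> //; split=> //; left.
      have [q' [qP' [qq' [Fa Fb]]]] : exists q', q' ∈ P /\ subset q q' /\ forces a e q' /\ ~ forces b e q'.
        by apply: NNPP => N; apply: K => q' qP' qq' Fa; apply: NNPP => Fb; apply: N; exists q'.
      have [q2 [qP2 [qq2 K2]]] : exists q2, q2 ∈ P /\ subset q' q2 /\ forall r, r ∈ P -> subset q2 r -> ~ forces b e r.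
        apply: NNPP => N; apply: Fb; apply: forces_regular => // q2 qP2 qq2; apply: NNPP => N'; apply: N.
        exists q2; split=> //; split=> // r rP qr Fr; apply: N'; by exists r.
      exists q2; split=> //; split; first by move=> z /qq' /qq2.
      right; split=> //; exact: (forces_mono (p := q')).
    * move=> r [Gr [_ [K|[Fa N]]]]; first by exists r.
      have /H /(IHb e x Ve vx) [q [Gq Fb]] : sat W x a by apply/(IHa e x Ve vx); exists r.
      case: (gen_dir Gr Gq) => q' [Gq' [rq qq]]; case: (N q' (proj1 Gq') rq).
      by apply: (forces_mono (p := q)) => //; case: Gq'.
  + case/(IHa e x Ve vx): Ha => q [Gq Fa]; case: (gen_dir Gp Gq) => r [Gr [pr qr]].
    apply/(IHb e x Ve vx); exists r; split=> //; apply: H => //; first by case: Gr.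
    by apply: (forces_mono (p := q)) => //; case: Gr.
- have E s y : V s -> val G s y -> (sat W (scons y x) a <-> exists p, G p /\ forces a (scons s e) p).
    by move=> Vs v; apply: IH; case.
  split=> [H|[p [Gp H]] y [s [Vs v]]]; last by apply/(E s y Vs v); exists p; split=> //; apply: H.
  case: gen_ex => p0 Gp0.
  case: (gen_below (p := p0) (Q := fun p => (forall s, V s -> forces a (scons s e) p) \/
     exists s, V s /\ forall q, q ∈ P -> subset p q -> ~ forces a (scons s e) q)) => //.
  + have dF (t0 t : ix FV -> (nat -> U) -> U) : tm t0 -> tm t ->
      dfn (F := FV) (fun i0 e0 => forces a (scons (t0 i0 e0) e) (t i0 e0)).
    { move=> Ht0 Ht; pose T n := match n with 0 => t0 | S n => fun (_ : ix FV) (_ : nat -> U) => e n end.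
      have HT n : tm (T n) by case: n => [|n] //; apply: tm_par; apply: Ve.
      apply: d_ext (d_forces a HT Ht) => i0 e0 _.
      suff -> : scons (t0 i0 e0) e = fun n => T n i0 e0 by [].
      by apply: functional_extensionality; case. }
    by repeat first [apply: dF; tm_solve | dstep].
  + move=> q qP _; case: (classic (forall s, V s -> forces a (scons s e) q)) => [K|K].
      by exists q; split=> //; split=> //; left.
    have [s [Vs Fs]] : exists s, V s /\ ~ forces a (scons s e) q.
      by apply: NNPP => N; apply: K => s Vs; apply: NNPP => Fs; apply: N; exists s.
    have [q2 [qP2 [qq2 K2]]] : exists q2, q2 ∈ P /\ subset q q2 /\ forall r, r ∈ P -> subset q2 r -> ~ forces a (scons s e) r.
      apply: NNPP => N; apply: Fs; apply: forces_regular => //; first by case.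
      move=> q2 qP2 qq2; apply: NNPP => N'; apply: N.
      exists q2; split=> //; split=> // r rP qr Fr; apply: N'; by exists r.
    by exists q2; split=> //; split=> //; right; exists s.
  + move=> r [Gr [_ [K|[s [Vs N]]]]]; first by exists r.
    case: (f_ext Vs) => y v; have /(E s y Vs v) [q [Gq Fq]] : sat W (scons y x) a by apply: H; exists s.
    case: (gen_dir Gr Gq) => q' [Gq' [rq qq]]; case: (N q' (proj1 Gq') rq).
    by apply: (forces_mono (p := q)) => //; [case|case: Gq'].
Qed.

Lemma Go : G o.
Proof. by split=> // z /Ho. Qed.

Lemma W_trans : transitive_class W.
Proof.
move=> x y [s [Vs /val_iff [_ H]]] /H [t [p [A [_ v]]]]; exists t; split=> //.
by case: (app_in V_trans Vs A).
Qed.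

Lemma V_W x : V x -> W x.
Proof.
by move=> Vx; case: (chk_ex Vx) => s c; exists s; split; [case: (chk_in c)|apply: chk_val Go c].
Qed.

Lemma W_ne : exists x, W x.
Proof. by exists o; apply: V_W Vo. Qed.

Local Notation FW := (frame1 W_trans W_ne).

Lemma W_f : W f.
Proof.
case: fdot_ex => n [Vn Hn]; exists n; split=> //; apply: fdot_val => //; first exact: gen_ex.
by case: f_gen => _ [_ [_ H]].
Qed.

Lemma W_vals S : V S -> exists B, W B /\ (forall x, x ∈ B <-> exists s, s ∈ S /\ val G s x).
Proof.
move=> VS; case: (setn_ex VS) => n [Vn Hn]; case: (f_ext Vn) => B v; exists B; split; first by exists n.
by case: (setn_val Go VS Vn Hn v).
Qed.

(** Sets of the extension are obtained by separation from bounds, and the bounds are sets of values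
    of names. This is the basic one; it plays the part of the transitive closure. *)
Lemma W_bound x : W x -> exists S, V S /\ transitive_set S /\ exists B, W B /\ transitive_set B /\ x ∈ B /\
  forall y, y ∈ B <-> exists s, s ∈ S /\ val G s y.
Proof.
move=> [s [Vs v]]; case: (V_trans_ex Vs) => S [VS [TS sS]]; case: (W_vals VS) => B [WB HB].
exists S; split=> //; split=> //; exists B; split=> //; split; last by split=> //; apply/HB; exists s.
move=> y /HB [t [tS /val_iff [_ H]]] z /H [t' [p [[u [ut Pu]] [_ v']]]]; apply/HB; exists t'; split=> //.
by case: (pair_fst_mem Pu) => d [du td]; apply: (TS d) => //; apply: (TS u) => //; apply: (TS t).
Qed.

(** The new name pairs [t] with the conditions that extend a condition attached to [t] in [s] and
    force the formula. *)
Lemma W_separation phi e x : (forall n, W (e n)) -> W x ->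
  exists u, W u /\ forall z, W z -> (z ∈ u <-> z ∈ x /\ sat W (scons z e) phi).
Proof.
move=> We [s [Vs vs]].
have /choice [d Hd] : forall n, exists t, V t /\ val G t (e n) by move=> n; apply: We.
case: (V_union Vs) => s1 [V1 H1]; case: (V_union V1) => s2 [V2 H2]; case: (V_prod V2 VP) => T [VT HT].
case: (sep (x := T) (Q := fun u => exists t p, is_pair u t p /\ exists r, app s t r /\ (r ∈ P /\ subset r p) /\ forces phi (scons t d) p)) => //.
{ apply: d_ex_pair; first tm_solve. apply: d_ex_val; try tm_solve. apply: d_and; first by dsolve.
  pose T0 n := match n with 0 => fun (_ : ix FV) (e : nat -> U) => e 2 | S n => fun (_ : ix FV) (_ : nat -> U) => d n end.
  have HT0 n : tm (T0 n) by case: n => [|n]; [exact: (@tm_var U FV 2)|apply: tm_par; case: (Hd n)].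
  apply: d_ext (d_forces phi HT0 (@tm_var U FV 1)) => i0 e0 _.
  suff -> : scons (e0 2) d = fun n => T0 n i0 e0 by [].
  by apply: functional_extensionality; case. }
move=> n [Vn Hn]; case: (f_ext Vn) => u vu; exists u; split; first by exists n.
have An t p : app n t p <-> p ∈ P /\ exists r, app s t r /\ (r ∈ P /\ subset r p) /\ forces phi (scons t d) p.
{ split=> [[q [/Hn [/HT [t1 [p1 [_ [pP Pq1]]]] [t2 [p2 [Pq2 H]]]] Pq]]|[pP [r [A H]]]].
  - by case: (pair_inj Pq Pq1) => ? ?; case: (pair_inj Pq Pq2) => ? ?; subst.
  - have [Vt _] := app_in V_trans Vs A; case: (V_pair Vt (V_in VP pP)) => q [Vq Pq]; exists q; split=> //; apply/Hn.
    split; last by exists t, p; split=> //; exists r.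
    apply/HT; exists t, p; split=> //; case: A => v [vs0 Pv]; apply/H2; case: (pair_fst_mem Pv) => w [wv tw].
    by exists w; split=> //; apply/H1; exists v. }
have truth' t z : V t -> val G t z -> (sat W (scons z e) phi <-> exists p, G p /\ forces phi (scons t d) p).
{ move=> Vt v; apply: truth; case=> //= m; by case: (Hd m). }
move=> z Wz; case/val_iff: (vu) => U1 U2; case/val_iff: (vs) => S1 S2; split.
- move=> /U2 [t [p [/An [pP [r [A [[rP rp] F]]]] [Gp v]]]]; have [Vt Vr] := app_in V_trans Vs A.
  split; last by apply/(truth' t z Vt v); exists p.
  case: (S1 t r A (gen_down Gp rP rp)) => z' [zx v']; by rewrite (val_fun v v').
- move=> [/S2 [t [r [A [Gr v]]]]]; have [Vt Vr] := app_in V_trans Vs A; move=> /(truth' t z Vt v) [p [Gp F]].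
  case: (gen_dir Gp Gr) => q [Gq [pq rq]]; case: (U1 t q) => //.
    apply/An; split; first by case: Gq. exists r; split=> //; split; first by split=> //; case: Gr.
    by apply: (forces_mono (p := p)) => //; [case=> //= m; case: (Hd m)|case: Gq].
  by move=> z' [zu v']; rewrite (val_fun v v').
Qed.

Lemma W_sep x (Q : U -> Prop) : W x -> dfn (F := FW) (fun _ e => Q (e 0)) ->
  exists u, W u /\ forall z, z ∈ u <-> z ∈ x /\ Q z.
Proof. exact: (dfn_sep W_separation). Qed.

Lemma W_upair x y : W x -> W y -> exists z, W z /\ is_upair z x y.
Proof.
move=> [s [Vs vs]] [t [Vt vt]]; case: (upn_ex Vs Vt) => m [Vm Hm]; case: (f_ext Vm) => z vz; exists z.
by split; [exists m|apply: (upn_val Go Vs Vt Vm Hm vs vt vz)].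
Qed.

Lemma W_pair x y : W x -> W y -> exists z, W z /\ is_pair z x y.
Proof.
move=> Wx Wy; case: (W_upair Wx Wx) => s [Ws Hs]; case: (W_upair Wx Wy) => t [Wt Ht].
by case: (W_upair Ws Wt) => z [Wz Hz]; exists z; split=> //; exists s, t.
Qed.

Lemma d_opn t1 t2 t3 : tm (F := FV) t1 -> tm (F := FV) t2 -> tm (F := FV) t3 ->
  dfn (F := FV) (fun i e => opn (t1 i e) (t2 i e) (t3 i e)).
Proof. have Vo' := Vo; move=> H1 H2 H3; rewrite /opn /upn; dsolve. Qed.

Lemma W_prod x y : W x -> W y -> exists u, W u /\ forall z, z ∈ u <-> exists a b, a ∈ x /\ b ∈ y /\ is_pair z a b.
Proof.
move=> Wx Wy; case: (W_bound Wx) => S [VS [TS [B [WB [TB [xB HB]]]]]].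
case: (W_bound Wy) => S' [VS' [TS' [B' [WB' [TB' [yB' HB']]]]]].
case: (V_prod VS VS') => T [VT HT].
case: (collection (x := T) (Q := fun q n => exists s t, is_pair q s t /\ opn s t n)) => //.
  by apply: d_ex_pair; [tm_solve|apply: d_opn; tm_solve].
move=> N [VN [_ HN]]; case: (W_vals VN) => Z [WZ HZ].
case: (W_sep (x := Z) (Q := fun z => exists a, a ∈ x /\ exists b, b ∈ y /\ is_pair z a b)) => //; first by dsolve.
move=> u [Wu Hu]; exists u; split=> // z; rewrite Hu; split=> [[_ [a [ax [b [yb Pz]]]]]|[a [b [ax [yb Pz]]]]].
  by exists a, b.
split; last by exists a; split=> //; exists b.
case/HB: (TB x xB a ax) => s [sS vs]; case/HB': (TB' y yB' b yb) => t [tS vt].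
have Vs := V_in VS sS; have Vt := V_in VS' tS.
case: (V_pair Vs Vt) => q [Vq Pq]; case: (opn_ex Vs Vt) => n [Vn On].
case: (HN q n) => //; [by apply/HT; exists s, t|by exists s, t|].
move=> n' [nN [s' [t' [Pq' On']]]]; case: (pair_inj Pq Pq') => ? ?; subst s' t'; apply/HZ; exists n'; split=> //.
have Vn' := V_in VN nN; case: (f_ext Vn') => z' v'; by rewrite (pair_unique Pz (opn_val Go Vs Vt Vn' On' vs vt v')).
Qed.

(** Nice names: when [S] names all elements of [x], a subset with name [t] is also named by the set
    of pairs of some [s] in [S] and a condition forcing [s] into [t]. These names are subsets of one
    product. *)
Lemma W_power_names x : W x -> exists N, V N /\ forall y, W y -> subset y x -> exists s, s ∈ N /\ val G s y.
Proof.
move=> Wx; case: (W_bound Wx) => S [VS [TS [B [WB [TB [xB HB]]]]]].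
case: (V_prod VS VP) => T [VT HT]; case: (V_power VT) => N [VN HN].
exists N; split=> // y [t [Vt vt]] yx.
case: (sep (x := T) (Q := fun u => exists s p, is_pair u s p /\ fmem p s t)) => //.
  by apply: d_ex_pair; [tm_solve|apply: d_fmem; tm_solve].
move=> n [Vn Hn]; exists n; split; first by apply/HN; split=> // u /Hn [].
have An s p : app n s p <-> s ∈ S /\ p ∈ P /\ fmem p s t.
{ split=> [[q [/Hn [/HT [t1 [p1 [sS [pP Pq1]]]] [t2 [p2 [Pq2 H]]]] Pq]]|[sS [pP H]]].
  - by case: (pair_inj Pq Pq1) => ? ?; case: (pair_inj Pq Pq2) => ? ?; subst.
  - case: (V_pair (V_in VS sS) (V_in VP pP)) => q [Vq Pq]; exists q; split=> //; apply/Hn.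
    by split; [apply/HT; exists s, p|exists s, p]. }
have tr s z : V s -> val G s z -> (z ∈ y <-> exists p, G p /\ fmem p s t).
{ move=> Vs vs; apply: (truth (FMem 0 1) (e := fun n => match n with 0 => s | _ => t end)
    (x := fun n => match n with 0 => z | _ => y end)); by case. }
apply/val_iff; split=> [s p /An [sS [pP H]] Gp|z zy].
- have Vs := V_in VS sS; case: (f_ext Vs) => z v; exists z; split=> //; apply/(tr s z Vs v); by exists p.
- case/HB: (TB x xB z (yx z zy)) => s [sS v]; have Vs := V_in VS sS.
  case/(tr s z Vs v): zy => p [Gp H]; exists s, p; split=> //; apply/An; split=> //; split=> //; by case: Gp.
Qed.

Lemma W_power_bound x : W x -> exists Z, W Z /\ forall y, W y -> subset y x -> y ∈ Z.
Proof.
move=> /W_power_names [N [VN HN]]; case: (W_vals VN) => Z [WZ HZ]; exists Z; split=> // y Wy yx.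
by apply/HZ; apply: HN.
Qed.

(** The codomain is bounded in advance, so that separation from a product suffices. *)
Lemma W_func D B (Q : U -> U -> Prop) : W D -> W B -> dfn (F := FW) (fun _ e => Q (e 0) (e 1)) ->
  (forall d, d ∈ D -> exists b, b ∈ B /\ Q d b) -> (forall d b b', d ∈ D -> b ∈ B -> b' ∈ B -> Q d b -> Q d b' -> b = b') ->
  exists g, W g /\ maps g D W /\ forall d b, app g d b <-> d ∈ D /\ b ∈ B /\ Q d b.
Proof.
move=> WD WB dQ tot uniq; case: (W_prod WD WB) => DB [WDB HDB].
case: (W_sep (x := DB) (Q := fun z => exists d b, is_pair z d b /\ Q d b)) => //.
  by apply: d_ex_pair; [tm_solve|apply: (d_subst2 dQ); tm_solve].
move=> g [Wg Hg]; exists g; split=> //.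
have A d b : app g d b <-> d ∈ D /\ b ∈ B /\ Q d b.
{ split=> [[z [/Hg [/HDB [d1 [b1 [dD [bB Pz1]]]] [d2 [b2 [Pz2 q]]]] Pz]]|[dD [bB q]]].
  - by case: (pair_inj Pz Pz1) => ? ?; case: (pair_inj Pz Pz2) => ? ?; subst.
  - case: (W_pair (W_trans WD dD) (W_trans WB bB)) => z [Wz Pz]; exists z; split=> //; apply/Hg; split.
    + by apply/HDB; exists d, b.
    + by exists d, b. }
split=> //; split; first split.
- by move=> z /Hg [_ [d [b [Pz _]]]]; exists d, b.
- by move=> d b b' /A [dD [bB q]] /A [_ [bB' q']]; apply: (uniq d).
- split=> [d|d b /A [_ [bB _]]]; last exact: (W_trans WB bB).
  by split=> [dD|[b /A []//]]; case: (tot d dD) => b [bB q]; exists b; apply/A.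
Qed.

(** The valuation restricted to a transitive set of names is itself a set with a name, namely the
    set of names of the pairs formed by a check name of [s] and [s]. It is the source of all
    witnesses for [valrel]. *)
Lemma W_valset S : V S -> transitive_set S -> exists R, W R /\ valrel R P f /\
  (forall s x, app R s x <-> s ∈ S /\ val G s x).
Proof.
move=> VS TS.
case: (collection (x := S) (Q := fun s n => exists c, V c /\ chk s c /\ opn c s n)) => //.
  by repeat first [apply: d_chk; tm_solve | apply: d_opn; tm_solve | dstep].
move=> N0 [VN0 [_ HN0]].
case: (sep (x := N0) (Q := fun n => exists s, s ∈ S /\ exists c, V c /\ chk s c /\ opn c s n)) => //.
  by repeat first [apply: d_chk; tm_solve | apply: d_opn; tm_solve | dstep].
move=> N [VN HN]; case: (W_vals VN) => R [WR HR]; exists R; split=> //.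
have AR s x : app R s x <-> s ∈ S /\ val G s x.
{ split=> [[u [/HR [n [/HN [nN0 [s' [sS [c [Vc [cs On]]]]]] vn]] Pu]]|[sS v]].
  - have Vs := V_in VS sS; case: (f_ext Vs) => x' v'; have Vn := V_in VN0 nN0.
    have Pu' := opn_val Go Vc Vs Vn On (chk_val Go cs) v' vn.
    by case: (pair_inj Pu Pu') => ? ?; subst.
  - have Vs := V_in VS sS; case: (chk_ex Vs) => c cs; have [_ Vc] := chk_in cs; case: (opn_ex Vc Vs) => n0 [Vn0 On0].
    case: (HN0 s n0) => //; first by exists c.
    move=> n [nN0 [c' [Vc' [cs' On]]]]; have Vn := V_in VN0 nN0; case: (f_ext Vn) => u vn; exists u; split.
    + by apply/HR; exists n; split=> //; apply/HN; split=> //; exists s; split=> //; exists c'.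
    + exact: (opn_val Go Vc' Vs Vn On (chk_val Go cs') v vn). }
split=> // s x /AR [sS v]; case/val_iff: (v) => H1 H2.
have TA t p : app s t p -> t ∈ S.
{ move=> [u [us Pu]]; case: (pair_fst_mem Pu) => d [du td]; apply: (TS d) => //; apply: (TS u) => //; exact: (TS s). }
split=> [t p A pP pf|y /H2 [t [p [A [Gp vt]]]]].
- by case: (H1 t p A (conj pP pf)) => y [yx vy]; exists y; split=> //; apply/AR; split=> //; apply: TA A.
- by exists t, p; split=> //; split=> //; apply/AR; split=> //; apply: TA A.
Qed.

(** Names for the constants are chosen once and for all and elements of [V] enter by check names.
    The resulting relation is definable in [V], so that density arguments apply to relations of the
    extension. *)
Lemma forcing_pred (Q : U -> U -> Prop) : dfn (F := FW) (fun _ e => Q (e 0) (e 1)) ->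
  exists Fr : U -> U -> U -> Prop, dfn (F := FV) (fun _ e => Fr (e 0) (e 1) (e 2)) /\
    (forall p q s x, q ∈ P -> subset p q -> V s -> Fr p s x -> Fr q s x) /\
    (forall s x y, V s -> V x -> val G s y -> (Q y x <-> exists p, G p /\ Fr p s x)).
Proof.
move=> [phi [c [Hc H]]].
have /choice [d Hd] : forall n, exists t, V t /\ val G t (c n tt) by move=> n; apply: (Hc n).
pose en s c n := match n with 0 => s | S _ => c end : U.
exists (fun p s x => exists c, V c /\ chk x c /\ forces phi (mix (en s c) d) p); split.
{ apply: d_ex; apply: d_and; first by apply: d_chk; tm_solve.
  pose T := mix (fun n => match n with 0 => fun (_ : ix FV) (e : nat -> U) => e 2 | S _ => fun _ e => e 0 end)
    (fun n (_ : ix FV) (_ : nat -> U) => d n).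
  have HT n : tm (T n).
  { rewrite /T; case: (even_odd n) => k [->|->]; rewrite ?mix_even ?mix_odd.
    - by case: k => [|k]; [exact: (@tm_var U FV 2)|exact: (@tm_var U FV 0)].
    - by apply: tm_par; case: (Hd k). }
  apply: d_ext (d_forces phi HT (@tm_var U FV 1)) => i0 e0 _.
  suff -> : mix (en (e0 2) (e0 0)) d = fun n => T n i0 e0 by [].
  apply: functional_extensionality => n; rewrite /T; case: (even_odd n) => k [->|->]; rewrite ?mix_even ?mix_odd //.
  by case: k. }
have Ven s c0 n : V s -> V c0 -> V (mix (en s c0) d n).
{ move=> Vs Vc; case: (even_odd n) => k [->|->]; rewrite ?mix_even ?mix_odd; [by case: k|by case: (Hd k)]. }
split.
{ move=> p q s x qP pq Vs [c0 [Vc [cx F]]]; exists c0; split=> //; split=> //.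
  by apply: (forces_mono (p := p)) => // n; apply: Ven. }
move=> s x y Vs Vx v.
have tr c0 : chk x c0 -> (Q y x <-> exists p, G p /\ forces phi (mix (en s c0) d) p).
{ move=> cx; have [_ Vc] := chk_in cx.
  have := H tt (en y x); case; first by case=> [|n]; [exists s|apply: V_W].
  move=> K1 K2; have T : sat W (mix (en y x) (fun n => c n tt)) phi <-> exists p, G p /\ forces phi (mix (en s c0) d) p.
  { apply: truth => n; first exact: Ven.
    case: (even_odd n) => k [->|->]; rewrite ?mix_even ?mix_odd; last by case: (Hd k).
    by case: k => [|k] //=; apply: chk_val Go cx. }
  by rewrite -T; split. }
case: (chk_ex Vx) => c0 cx; rewrite (tr c0 cx); split=> [[p [Gp F]]|[p [Gp [c1 [Vc1 [cx1 F]]]]]].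
- by exists p; split=> //; exists c0; split=> //; case: (chk_in cx).
- by exists p; split=> //; rewrite (chk_fun cx cx1).
Qed.

End Generic.
End Forcing.
(** * Fast function forcing *)

(** A condition with [d] above [g] in its domain requires its value at [g] to lie below [d], and
    every inaccessible [d] may occur. The set [I] of inaccessibles is an argument so that the notion
    can be transferred along an embedding. *)
Definition legit_in k I g l a := l ∈ k /\ a ∈ k /\ forall d : U, d ∈ I -> g ∈ d -> (l ∈ d <-> a ∈ d).

Section Fast.
Context (kappa : U) (Vk : V kappa) (Ik : inaccessible V kappa).
Context (P : U) (PF : is_fast_forcing V kappa P).
Context (II : U) (VII : V II) (HII : forall d, d ∈ II <-> d ∈ kappa /\ inaccessible V d).
Context (o : U) (Ho : forall z, ~ z ∈ o) (Vo0 : V o).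

Let Ok : ordinal kappa := inacc_ordinal Ik.

Lemma VP : V P.
Proof. by case: PF. Qed.
Hint Resolve VP : dpar.

Definition restr p c v := v ∈ p /\ exists a b, is_pair v a b /\ a ∈ c.

(** Cardinality bounds become smallness of the condition and of its restrictions, which passes to
    subsets and unions easily. *)
Lemma P_iff p : p ∈ P <-> V p /\ is_function p /\
  (forall a b, app p a b -> a ∈ kappa /\ b ∈ kappa /\ inaccessible V a) /\
  small (fun v => v ∈ p) kappa /\
  (forall c b, app p c b -> (forall a b', a ∈ c -> app p a b' -> b' ∈ c) /\ small (restr p c) c).
Proof.
case: PF => _ ->; split.
- move=> [Vp [fp [dp [[d [Vd [Hd cd]]] rp]]]]; do 3 (split=> //); split.
  + apply: (small_image (Q := fun a y => y ∈ p /\ exists a' b, is_pair y a' b /\ a' = a) Vk _ _ _ (small_card Vd Vk cd)).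
    * dsolve.
    * move=> a y y' _ _ _ [yp [a1 [b [Py ?]]]] [yp' [a2 [b' [Py' ?]]]]; subst a1 a2.
      have E : b = b' by case: fp => _ /(_ a b b'); apply; [exists y|exists y'].
      by subst b'; apply: pair_unique Py Py'.
    * move=> y yp; split; first exact: V_in yp. case: (fp) => /(_ y yp) [a [b Py]] _; exists a.
      have Aab : app p a b by exists y.
      by split; [case: (app_in V_trans Vp Aab)|split; [apply/Hd; exists b|split=> //; exists a, b]].
  + move=> c b A; case: (rp c b A) => H1 [r [Vr [Hr cr]]]; split=> //.
    have Vc : V c by case: (app_in V_trans Vp A).
    by apply: small_sub (small_card Vr Vc cr) => v Hv; apply/Hr.
- move=> [Vp [fp [dp [sp rp]]]]; split=> //; split=> //; split=> //; split.
  + case: (V_union Vp) => p1 [V1 H1]; case: (V_union V1) => p2 [V2 H2].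
    case: (sep (x := p2) (Q := fun a => exists b, app p a b)) => //; first by dsolve.
    move=> d [Vd Hd]; exists d; split=> //.
    have Dd : is_dom d p.
    { move=> a; rewrite Hd; split=> [[]//|[b A]]; split; last by exists b.
      by case: A => v [vp Pv]; case: (pair_fst_mem Pv) => s [sv ax]; apply/H2; exists s; split=> //; apply/H1; exists v. }
    split=> //; apply: card_small => //.
    apply: (small_image (Q := fun y a => exists a' b, is_pair y a' b /\ a' = a) Vk _ _ _ sp).
    * dsolve.
    * move=> y a a' _ _ _ [a1 [b [Py ?]]] [a2 [b' [Py' ?]]]; subst a1 a2; by case: (pair_inj Py Py').
    * move=> a ad; split; first exact: V_in ad. case/Dd: ad => b [y [yp Py]]; exists y.
      by split; [apply: V_in yp|split=> //; exists a, b].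
  + move=> c b A; case: (rp c b A) => H1 sr; split=> //.
    have Vc : V c by case: (app_in V_trans Vp A).
    case: (sep (x := p) (Q := fun v => exists a b, is_pair v a b /\ a ∈ c)) => //; first by dsolve.
    move=> r [Vr Hr]; exists r; split=> //; split=> //; apply: card_small => //.
      by case: (dp c b A) => _ [_ /inacc_ordinal].
    by apply: small_sub sr => v /Hr.
Qed.

Lemma P_V p : p ∈ P -> V p.
Proof. by move=> /P_iff []. Qed.

Lemma P_fun p a b b' : p ∈ P -> app p a b -> app p a b' -> b = b'.
Proof. by move=> /P_iff [_ [[_ H] _]]; apply: H. Qed.

Lemma P_pair p x : p ∈ P -> x ∈ p -> exists a b, is_pair x a b.
Proof. by move=> /P_iff [_ [[H _] _]]; apply: H. Qed.

Lemma P_dom p a b : p ∈ P -> app p a b -> a ∈ kappa /\ b ∈ kappa /\ inaccessible V a.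
Proof. by move=> /P_iff [_ [_ [H _]]]; apply: H. Qed.

Lemma P_closed p c b a b' : p ∈ P -> app p c b -> a ∈ c -> app p a b' -> b' ∈ c.
Proof. by move=> /P_iff [_ [_ [_ [_ H]]]] A; case: (H c b A) => K _; apply: K. Qed.

Lemma P_restr p c b : p ∈ P -> app p c b -> small (restr p c) c.
Proof. by move=> /P_iff [_ [_ [_ [_ H]]]] A; case: (H c b A). Qed.

Lemma P_small p : p ∈ P -> small (fun v => v ∈ p) kappa.
Proof. by move=> /P_iff [_ [_ [_ [H _]]]]. Qed.

Lemma P_sub p q : p ∈ P -> V q -> subset q p -> q ∈ P.
Proof.
move=> pP Vq qp; apply/P_iff; split=> //; split; first split.
- by move=> x /qp; apply: P_pair.
- by move=> a b b' /(app_sub qp) A /(app_sub qp); apply: P_fun A.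
- split; first by move=> a b /(app_sub qp); apply: P_dom.
  split; first by apply: small_sub (P_small pP).
  move=> c b /(app_sub qp) A; split=> [a b' ac /(app_sub qp)|]; first exact: P_closed pP A ac.
  by apply: small_sub (P_restr pP A) => v [/qp vp H].
Qed.

Lemma P_o p : p ∈ P -> o ∈ P.
Proof. by move=> pP; apply: (P_sub pP) => // z /Ho. Qed.

Lemma P_single c b x : c ∈ kappa -> b ∈ kappa -> inaccessible V c -> is_pair x c b ->
  exists p, p ∈ P /\ forall z, z ∈ p <-> z = x.
Proof.
move=> ck bk Ic Px; have Vc := V_in Vk ck; have Vb := V_in Vk bk.
have Vx : V x by case: (V_pair Vc Vb) => x' [Vx' Px']; rewrite (pair_unique Px Px').
case: (V_single Vx) => p [Vp Hp]; exists p; split=> //.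
have A a b' : app p a b' -> a = c /\ b' = b by move=> [z [/Hp -> Pz]]; apply: pair_inj Pz Px.
apply/P_iff; split=> //; split; first split.
- by move=> z /Hp ->; exists c, b.
- by move=> a b1 b2 /A [_ ->] /A [_ ->].
- split; first by move=> a b' /A [-> ->].
  split; first by apply: small_sub (small_single Vk Ik Vx) => v /Hp.
  move=> c' b' /A [-> _]; split=> [a b1 ac /A [E _]|]; first by subst a; case: (mem_irrefl ac).
  by apply: small_sub (small_single Vc Ic Vx) => v [/Hp].
Qed.

Lemma P_cup p q : p ∈ P -> q ∈ P ->
  (forall a b b', app p a b -> app q a b' -> b = b') ->
  (forall c b, app p c b -> (forall a b', a ∈ c -> app q a b' -> b' ∈ c) /\ small (restr q c) c) ->
  (forall c b, app q c b -> (forall a b', a ∈ c -> app p a b' -> b' ∈ c) /\ small (restr p c) c) ->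
  exists r, r ∈ P /\ forall z, z ∈ r <-> z ∈ p \/ z ∈ q.
Proof.
move=> pP qP H Hp Hq; case: (V_cup (P_V pP) (P_V qP)) => r [Vr Hr]; exists r; split=> //.
have A a b : app r a b <-> app p a b \/ app q a b.
{ split=> [[x [/Hr [xp|xq] Px]]|[[x [xp Px]]|[x [xp Px]]]].
  - by left; exists x.
  - by right; exists x.
  - by exists x; split=> //; apply/Hr; left.
  - by exists x; split=> //; apply/Hr; right. }
apply/P_iff; split=> //; split; first split.
- by move=> x /Hr [/(P_pair pP)|/(P_pair qP)].
- move=> a b b' /A [A1|A1] /A [A2|A2]; [exact: P_fun A1 A2|exact: H A1 A2|symmetry; exact: H A2 A1|exact: P_fun A1 A2].
- split; first by move=> a b /A [/(P_dom pP)|/(P_dom qP)].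
  split; first by apply: small_sub (small_cup Vk Ik (P_small pP) (P_small qP)) => v /Hr.
  move=> c b /A [A1|A1].
  + have [ck [bk Ic]] := P_dom pP A1; have Vc := V_in Vk ck; case: (Hp c b A1) => K1 K2; split.
      by move=> a b' ac /A [A2|A2]; [apply: P_closed pP A1 ac A2|apply: K1 ac A2].
    apply: small_sub (small_cup Vc Ic (P_restr pP A1) K2) => v [/Hr [vp|vq] E]; [left|right]; by split.
  + have [ck [bk Ic]] := P_dom qP A1; have Vc := V_in Vk ck; case: (Hq c b A1) => K1 K2; split.
      by move=> a b' ac /A [A2|A2]; [apply: K1 ac A2|apply: P_closed qP A1 ac A2].
    apply: small_sub (small_cup Vc Ic K2 (P_restr qP A1)) => v [/Hr [vp|vq] E]; [left|right]; by split.
Qed.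

(** * Changing the generic function at one point *)

Definition legit g l a := legit_in kappa II g l a.

Definition md f f' g l a := is_function f /\ app f g l /\ app f' g a /\
  (forall x, x ∈ f' -> (x ∈ f /\ ~ is_pair x g l) \/ is_pair x g a) /\
  (forall x, x ∈ f -> is_pair x g l \/ x ∈ f').

Lemma legit_sym g l a : legit g l a -> legit g a l.
Proof. by move=> [H1 [H2 H3]]; split=> //; split=> // d dI gd; rewrite H3. Qed.

Lemma md_sym f f' g l a : md f f' g l a -> md f' f g a l.
Proof.
move=> [ff [A [A' [H1 H2]]]]; have [ff1 ff2] := ff.
have N x : x ∈ f -> is_pair x g a -> is_pair x g l.
  by move=> xf Px; have -> : l = a by apply: (ff2 g) => //; exists x.
have K x : x ∈ f' -> is_pair x g a \/ (x ∈ f /\ ~ is_pair x g l) by move=> /H1; tauto.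
split; first split.
- by move=> x /H1 [[/ff1]|Px] //; exists g, a.
- have B c d : app f' c d -> (c = g /\ d = a) \/ (app f c d /\ c <> g).
  { move=> [x [xf' Px]]; case: (H1 x xf') => [[xf Nx]|Px']; last by left; case: (pair_inj Px Px').
    right; split; first by exists x. move=> E; subst c; apply: Nx.
    by have -> : l = d by apply: (ff2 g) => //; exists x. }
  move=> c d d' /B [[-> ->]|[B1 N1]] /B [[E1 E2]|[B2 N2]] //; try by [].
  exact: ff2 B1 B2.
- split=> //; split=> //; split.
  + move=> x xf; case: (classic (is_pair x g l)) => [|Nx]; first by right.
    left; split; first by case: (H2 x xf). by move=> Px; apply: Nx; apply: N.
  + by move=> x /K [|[]]; [left|right].
Qed.

(* [sw g a l p p']: [p'] is [p] with the value [a] at [g], if present, replaced by [l]. *)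
Definition sw g a l p p' := (p' = p /\ ~ exists b, app p g b) \/
  (app p g a /\ app p' g l /\ (forall x, x ∈ p -> is_pair x g a \/ x ∈ p') /\
   (forall x, x ∈ p' -> is_pair x g l \/ x ∈ p)).

Lemma sw_sym g a l p p' : sw g a l p p' -> sw g l a p' p.
Proof. by move=> [[-> H]|[H1 [H2 [H3 H4]]]]; [left|right]. Qed.

(** The new value only has to lie in [kappa] and below the later elements of the domain. These are
    inaccessible and contain [a], hence they contain [l] by [legit]. *)
Lemma sw_tot g a l p : legit g l a -> p ∈ P -> (forall b, app p g b -> b = a) ->
  exists p', p' ∈ P /\ sw g a l p p'.
Proof.
move=> [lk [ak L]] pP H; case: (classic (exists b, app p g b)) => [[b A]|N]; last first.
  by exists p; split=> //; left.
have E := H b A; subst b; have [gk [_ Ig]] := P_dom pP A.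
have Vg := V_in Vk gk; have Va := V_in Vk ak; have Vl := V_in Vk lk; have Vp := P_V pP.
case: (V_pair Vg Va) => x0 [Vx0 Px0]; case: (V_pair Vg Vl) => x1 [Vx1 Px1].
case: (sep (x := p) (Q := fun x => x <> x0)) => //; first by dsolve.
move=> q [Vq Hq]; have qp : subset q p by move=> x /Hq [].
have qP := P_sub pP Vq qp.
have qg b : ~ app q g b.
{ move=> [x [/Hq [xp xN] Px]]; apply: xN; apply: (pair_unique Px).
  by have -> : b = a by apply: H; exists x. }
case: (P_single gk lk Ig Px1) => s [sP Hs].
have As c d : app s c d -> c = g /\ d = l by move=> [x [/Hs -> Px]]; apply: pair_inj Px Px1.
case: (P_cup qP sP).
{ by move=> c d d' A1 /As [E _]; subst c; case: (qg d). }
{ move=> c d Aq; have Ap := app_sub qp Aq; have [ck [_ Ic]] := P_dom pP Ap; split.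
    by move=> c' d' cc /As [? ?]; subst c' d'; apply/(L c) => //; [apply/HII|apply: P_closed pP Ap cc A].
  by apply: small_sub (small_single (V_in Vk ck) Ic Vx1) => v [/Hs]. }
{ move=> c d /As [? ?]; subst c d; split=> [c d cg /(app_sub qp)|]; first exact: P_closed pP A cg.
  by apply: small_sub (P_restr pP A) => v [/qp vp E]. }
move=> r [rP Hr]; exists r; split=> //; right; split=> //; split.
  by exists x1; split=> //; apply/Hr; right; apply/Hs.
split=> x.
- move=> xp; case: (classic (x = x0)) => [->|N]; [by left|by right; apply/Hr; left; apply/Hq].
- by move=> /Hr [/qp|/Hs ->]; [right|left].
Qed.

Lemma sw_mono g a l p p' r r' : p ∈ P -> sw g a l p p' -> sw g a l r r' -> subset p' r' ->
  app r g a -> subset p r.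
Proof.
move=> pP S S' pr A x xp.
case: S' => [[E N]|[_ [A2 [H3 H4]]]]; first by case: N; exists a.
case: S => [[E N]|[B1 [B2 [K3 K4]]]].
- subst p'; case: (H4 x (pr x xp)) => // Px; by case: N; exists l, x.
- case: (K3 x xp) => [Px|xp']; first exact: app_mem A Px.
  case: (H4 x (pr x xp')) => // Px; apply: (app_mem A).
  by have -> : a = l by apply: (P_fun pP B1); exists x.
Qed.

Lemma sw_back g a l p p' f f' : md f f' g l a -> p ∈ P -> sw g a l p p' -> subset p' f -> subset p f'.
Proof.
move=> M pP S pf x xp; case: (M) => ff [A [A' [H1 H2]]].
case: S => [[E N]|[B1 [B2 [K3 K4]]]].
- subst p'; case: (H2 x (pf x xp)) => // Px; by case: N; exists l, x.
- case: (K3 x xp) => [Px|xp']; first exact: app_mem A' Px.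
  case: (H2 x (pf x xp')) => // Px; apply: (app_mem A').
  by have -> : a = l by apply: (P_fun pP B1); exists x.
Qed.

Lemma sw_ex g a l p f f' : legit g l a -> md f f' g l a -> p ∈ P -> subset p f' ->
  exists p', p' ∈ P /\ sw g a l p p' /\ subset p' f.
Proof.
move=> L M pP pf; case: (md_sym M) => [[_ ff] [A _]].
case: (sw_tot L pP); first by move=> b B; apply: (ff g) => //; apply: app_sub B.
move=> p' [pP' S]; exists p'; split=> //; split=> //.
exact: (sw_back (md_sym M) pP' (sw_sym S) pf).
Qed.

Lemma d_sw (F : frame U) (t1 t2 t3 t4 t5 : ix F -> (nat -> U) -> U) : tm t1 -> tm t2 -> tm t3 -> tm t4 -> tm t5 ->
  dfn (F := F) (fun i e => sw (t1 i e) (t2 i e) (t3 i e) (t4 i e) (t5 i e)).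
Proof. move=> H1 H2 H3 H4 H5; rewrite /sw; dsolve. Qed.

Lemma generic_fun f : generic V P f -> is_function f.
Proof.
move=> Gf; have [_ [D [_ Hf]]] := Gf; split=> [x /Hf [p [[pP _] xp]]|a b b' [x [/Hf [p [Gp xp]] Px]] [x' [/Hf [p' [Gp' xp']] Px']]].
- exact: P_pair pP xp.
- case: (D p p' Gp Gp') => r [[rP _] [pr pr']]; exact: (P_fun rP (app_pair (pr _ xp) Px) (app_pair (pr' _ xp') Px')).
Qed.

(** The exchange is not total: it concerns conditions with the expected value at [g] or with none.
    Directedness and density are therefore transported below a condition [p0] that contains the pair
    [(g, l)]. *)
Lemma generic_md f f' g l a : generic V P f -> legit g l a -> md f f' g l a -> generic V P f'.
Proof.
move=> Gf L M; have [[_ ff] [A [A' [H1 H2]]]] := M; have [_ [D [_ Hf]]] := Gf.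
have [p0 [G0 Ap0]] : exists p0, filter_of P f p0 /\ app p0 g l.
  by case: A => x [/Hf [p [Gp xp]] Px]; exists p; split=> //; exists x.
have up r : filter_of P f r -> app r g l -> exists r', filter_of P f' r' /\ sw g a l r' r /\ app r' g a.
{ move=> [rP rf] Ar; case: (sw_ex (legit_sym L) (md_sym M) rP rf) => r' [rP' [S rf']]; exists r'; split=> //.
  split; first exact: sw_sym. by case: S => [[_ N]|[_ []]] //; case: N; exists l. }
have down p : filter_of P f' p -> exists p', filter_of P f p' /\ sw g a l p p'.
{ by move=> [pP pf]; case: (sw_ex L M pP pf) => p' [pP' [S pf']]; exists p'. }
split; first by case: (up p0 G0 Ap0) => r [Gr _]; exists r.
split.
{ move=> p q Gp Gq; case: (down p Gp) => p' [Gp' Sp]; case: (down q Gq) => q' [Gq' Sq].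
  case: (D p' q' Gp' Gq') => r1 [Gr1 [pr qr]]; case: (D r1 p0 Gr1 G0) => r [Gr [rr r0]].
  case: (up r Gr (app_sub r0 Ap0)) => r' [Gr' [Sr Ar']]; exists r'; split=> //; split.
  - by apply: (sw_mono (proj1 Gp) Sp Sr) => // x /pr /rr.
  - by apply: (sw_mono (proj1 Gq) Sq Sr) => // x /qr /rr. }
split; last first.
{ move=> x; split=> [xf'|[p [[_ pf] xp]]]; last exact: pf.
  case: (H1 x xf') => [[/Hf [p [Gp xp]] N]|Px].
  - case: (D p p0 Gp G0) => r [Gr [pr r0]]; case: (up r Gr (app_sub r0 Ap0)) => r' [Gr' [Sr Ar']]; exists r'; split=> //.
    case: Sr => [[E _]|[_ [_ [_ H4]]]]; first by subst r; apply: pr.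
    by case: (H4 x (pr x xp)).
  - case: (up p0 G0 Ap0) => r' [Gr' [Sr Ar']]; exists r'; split=> //; exact: app_mem Ar' Px. }
move=> D0 VD0 [DP Dd].
have Vg : V g by case: (app_in V_trans (P_V (proj1 G0)) Ap0).
have Vl : V l by case: (app_in V_trans (P_V (proj1 G0)) Ap0).
have Va : V a by case: L => _ [ak _]; apply: V_in Vk ak.
(* Such [r] are dense below [p0]: exchange the value, extend into [D0], and exchange back. *)
case: (gen_below VP Gf G0 (Q := fun r => exists p, p ∈ D0 /\ exists p', p' ∈ P /\ sw g a l p p' /\ subset p' r)).
- have VP' := VP; by repeat first [apply: d_sw; tm_solve | dstep].
- move=> q qP pq; have Aq := app_sub pq Ap0.
  case: (sw_tot (legit_sym L) qP); first by move=> b B; apply: P_fun qP B Aq.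
  move=> q1 [qP1 S1]; case: (Dd q1 qP1) => p [pD qp]; have pP := DP p pD.
  have A1 : app p g a by apply: (app_sub qp); case: S1 => [[_ N]|[_ []]] //; case: N; exists l.
  case: (sw_tot L pP); first by move=> b B; apply: P_fun pP B A1.
  move=> p' [pP' S2]; exists p'; split=> //; split; last by exists p; split=> //; exists p'; split=> //; split.
  apply: (sw_mono (a := l) (l := a) qP S1 (sw_sym S2) qp).
  by case: S2 => [[_ N]|[_ []]] //; case: N; exists a.
- move=> r [Gr [_ [p [pD [p' [pP' [S pr]]]]]]]; exists p; split=> //; split; first exact: DP.
  by apply: (sw_back M (DP p pD) S) => x /pr; case: Gr => _; apply.
Qed.

(* [R] translates names so that values with respect to [f'] become values with respect to [f]. *)
Definition tr g a l R := forall s s', app R s s' ->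
  (forall t q, app s t q -> q ∈ P -> forall q', q' ∈ P -> sw g a l q q' -> exists t', app s' t' q' /\ app R t t') /\
  (forall t' q', app s' t' q' -> exists t q, app s t q /\ q ∈ P /\ sw g a l q q' /\ app R t t').

Lemma d_tr t1 t2 t3 t4 : tm (F := FV) t1 -> tm (F := FV) t2 -> tm (F := FV) t3 -> tm (F := FV) t4 ->
  dfn (F := FV) (fun i e => tr (t1 i e) (t2 i e) (t3 i e) (t4 i e)).
Proof.
have VP' := VP; move=> H1 H2 H3 H4; rewrite /tr; by repeat first [apply: d_sw; tm_solve | dstep].
Qed.

Lemma tr_val g a l f f' R : legit g l a -> md f f' g l a -> tr g a l R ->
  forall s s', app R s s' -> forall x, val (filter_of P f') s x <-> val (filter_of P f) s' x.
Proof.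
move=> L M T; elim/(@below_ind U) => s IH s' A x; case: (T s s' A) => T1 T2.
have down q : filter_of P f' q -> exists q', filter_of P f q' /\ sw g a l q q'.
{ by move=> [pP pf]; case: (sw_ex L M pP pf) => p' [pP' [S pf']]; exists p'. }
have back q q' : q ∈ P -> sw g a l q q' -> filter_of P f q' -> filter_of P f' q.
{ by move=> qP S [_ qf]; split=> //; apply: (sw_back M qP S qf). }
split=> /val_iff [H1 H2]; apply/val_iff; split.
- move=> t' q' A' Gq'; case: (T2 t' q' A') => t [q [At [qP [S Rt]]]]; case: (H1 t q At (back q q' qP S Gq')) => y [yx v].
  by exists y; split=> //; apply/(IH t (app_below At) t' Rt).
- move=> y /H2 [t [q [At [Gq v]]]]; case: (down q Gq) => q' [Gq' S].
  case: (T1 t q At (proj1 Gq) q' (proj1 Gq') S) => t' [At' Rt]; exists t', q'; split=> //; split=> //.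
  by apply/(IH t (app_below At) t' Rt).
- move=> t q At Gq; case: (down q Gq) => q' [Gq' S].
  case: (T1 t q At (proj1 Gq) q' (proj1 Gq') S) => t' [At' Rt]; case: (H1 t' q' At' Gq') => y [yx v].
  by exists y; split=> //; apply/(IH t (app_below At) t' Rt).
- move=> y /H2 [t' [q' [At' [Gq' v]]]]; case: (T2 t' q' At') => t [q [At [qP [S Rt]]]]; exists t, q.
  by split=> //; split; [apply: back S Gq'|apply/(IH t (app_below At) t' Rt)].
Qed.

(** The clauses of [tr] only ask for further pairs in the relation, so unions of translations are
    translations. This glues the translations found for single names. *)
Lemma tr_union g a l B : V g -> V a -> V l -> V B ->
  exists R, V R /\ tr g a l R /\ forall s R0, s ∈ B -> V R0 -> tr g a l R0 -> (exists s', app R0 s s') ->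
    exists s', app R s s'.
Proof.
move=> Vg Va Vl VB.
case: (collection (x := B) (Q := fun s R => tr g a l R /\ exists s', app R s s')) => //.
  by apply: d_and; [apply: d_tr; tm_solve|dsolve].
move=> C [VC [_ HC]]; case: (sep (x := C) (Q := fun R => tr g a l R)) => //; first by apply: d_tr; tm_solve.
move=> C' [VC' HC']; case: (V_union VC') => R [VR HR]; exists R; split=> //.
have AR s s' R0 : R0 ∈ C' -> app R0 s s' -> app R s s'.
  by move=> RC [x [xR Px]]; exists x; split=> //; apply/HR; exists R0.
split.
- move=> s s' [x [/HR [R0 [RC xR]] Px]]; case/HC': (RC) => _ /(_ s s') []; first by exists x.
  move=> T1 T2; split=> [t q A qP q' qP' S|t' q' A].
  + by case: (T1 t q A qP q' qP' S) => t' [A' Rt]; exists t'; split=> //; apply: AR RC Rt.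
  + by case: (T2 t' q' A) => t [q [A' [qP [S Rt]]]]; exists t, q; do 3 (split=> //); apply: AR RC Rt.
- move=> s R0 sB VR0 T0 H; case: (HC s R0) => // R1 [RC [T1 [s' A]]]; exists s'.
  by apply: (AR s s' R1) => //; apply/HC'.
Qed.

Lemma tr_ex1 g a l : V g -> V a -> V l ->
  forall s, V s -> exists R, V R /\ tr g a l R /\ exists s', app R s s'.
Proof.
move=> Vg Va Vl; elim/(@below_ind U) => s IH Vs; have VP' := VP.
case: (V_union Vs) => s1 [V1 H1]; case: (V_union V1) => s2 [V2 H2].
case: (tr_union Vg Va Vl V2) => R [VR [TR HR]].
have RT t q : app s t q -> exists t', app R t t'.
{ move=> A; have [Vt _] := app_in V_trans Vs A; case: (IH t (app_below A) Vt) => R0 [VR0 [T0 K]].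
  apply: HR VR0 T0 K; case: A => u [us Pu]; case: (pair_fst_mem Pu) => d [du td]; apply/H2; exists d; split=> //.
  by apply/H1; exists u. }
case: (V_union VR) => R1 [VR1 HR1]; case: (V_union VR1) => R2 [VR2 HR2]; case: (V_prod VR2 VP) => RP [VRP HRP].
case: (sep (x := RP) (Q := fun u => exists t' q', is_pair u t' q' /\ exists t q, app s t q /\ q ∈ P /\ sw g a l q q' /\ app R t t')) => //.
  by repeat first [apply: d_sw; tm_solve | dstep].
move=> s' [Vs' Hs'].
have As' t' q' : app s' t' q' <-> q' ∈ P /\ exists t q, app s t q /\ q ∈ P /\ sw g a l q q' /\ app R t t'.
{ split=> [[u [/Hs' [/HRP [t1 [q1 [_ [qP Pu1]]]] [t2 [q2 [Pu2 H]]]] Pu]]|[qP H]].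
  - by case: (pair_inj Pu Pu1) => ? ?; case: (pair_inj Pu Pu2) => ? ?; subst.
  - case: (H) => t [q [A [_ [_ Rt]]]]; have [Vt Vt'] := app_in V_trans VR Rt.
    case: (V_pair Vt' (V_in VP qP)) => u [Vu Pu]; exists u; split=> //; apply/Hs'; split; last by exists t', q'.
    apply/HRP; exists t', q'; split=> //; case: Rt => v [vR Pv]; case: (pair_snd_mem Pv) => d [dv td]; apply/HR2.
    by exists d; split=> //; apply/HR1; exists v. }
case: (V_pair Vs Vs') => w [Vw Pw]; case: (V_adjoin VR Vw) => R' [VR' HR']; exists R'; split=> //.
have AR' t t' : app R t t' -> app R' t t' by move=> [x [xR Px]]; exists x; split=> //; apply/HR'; left.
split; last by exists s', w; split=> //; apply/HR'; right.
move=> x x' [u [/HR' [uR|->] Pu]].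
- case: (TR x x'); first by exists u. move=> T1 T2; split=> [t q A qP q' qP' S|t' q' A].
  + by case: (T1 t q A qP q' qP' S) => t' [A' Rt]; exists t'; split=> //; apply: AR'.
  + by case: (T2 t' q' A) => t [q [A' [qP [S Rt]]]]; exists t, q; do 3 (split=> //); apply: AR'.
- case: (pair_inj Pu Pw) => ? ?; subst x x'; split=> [t q A qP q' qP' S|t' q' A].
  + case: (RT t q A) => t' Rt; exists t'; split; last exact: AR'. apply/As'; split=> //; by exists t, q.
  + case/As': A => qP' [t [q [A [qP [S Rt]]]]]; exists t, q; do 3 (split=> //); exact: AR'.
Qed.

Lemma tr_ex g a l B : V g -> V a -> V l -> V B ->
  exists R, V R /\ tr g a l R /\ forall s, s ∈ B -> exists s', app R s s'.
Proof.
move=> Vg Va Vl VB; case: (tr_union Vg Va Vl VB) => R [VR [TR HR]]; exists R; split=> //; split=> // s sB.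
by case: (tr_ex1 Vg Va Vl (V_in VB sB)) => R0 [VR0 [T0 K]]; apply: HR VR0 T0 K.
Qed.

(** The triples of a point and two values form a set, so collection gives one set of translated
    names for all modifications at once. Only with such a bound in [V] can quantification over the
    translated names be carried along [j]. *)
Lemma tr_bound B : V B -> exists B', V B' /\ transitive_set B' /\ forall f f' g l a, legit g l a -> md f f' g l a ->
  g ∈ kappa -> forall s, s ∈ B -> exists s', s' ∈ B' /\ forall x, val (filter_of P f') s x <-> val (filter_of P f) s' x.
Proof.
move=> VB; case: (V_prod Vk Vk) => K2 [VK2 HK2]; case: (V_prod Vk VK2) => K3 [VK3 HK3].
case: (collection (x := K3) (Q := fun w R => exists g v, is_pair w g v /\ exists a l, is_pair v a l /\
  tr g a l R /\ forall s, s ∈ B -> exists s', app R s s')) => //.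
{ apply: d_ex_pair; first tm_solve. apply: d_ex_pair; first tm_solve.
  apply: d_and; [by apply: d_tr; tm_solve|dsolve]. }
move=> C [VC [TC HC]]; exists C; split=> //; split=> // f f' g l a L M gk s sB.
have [lk [ak _]] := L; have Vg := V_in Vk gk; have Va := V_in Vk ak; have Vl := V_in Vk lk.
case: (V_pair Va Vl) => v [Vv Pv]; case: (V_pair Vg Vv) => w [Vw Pw]; case: (tr_ex Vg Va Vl VB) => R [VR [TR HR]].
case: (HC w R) => //.
{ by apply/HK3; exists g, v; split=> //; split=> //; apply/HK2; exists a, l. }
{ by exists g, v; split=> //; exists a, l. }
move=> R' [RC [g' [v' [Pw' [a' [l' [Pv' [TR' HR']]]]]]]].
case: (pair_inj Pw Pw') => ? ?; subst g' v'; case: (pair_inj Pv Pv') => ? ?; subst a' l'.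
case: (HR' s sB) => s' A; exists s'; split; last by apply: (tr_val L M TR' A).
case: A => x [xR Px]; case: (pair_snd_mem Px) => d [dx sd]; apply: (TC d) => //; apply: (TC x) => //; exact: (TC R').
Qed.

Lemma generic_dom f g l : generic V P f -> app f g l -> g ∈ kappa /\ l ∈ kappa /\ inaccessible V g.
Proof.
by move=> [_ [_ [_ Hf]]] [x [/Hf [p [[pP _] xp]] Px]]; apply: (P_dom pP); exists x.
Qed.

Lemma extension_exists_md f f' g l a : generic V P f -> extension_exists V P f -> legit g l a -> md f f' g l a ->
  extension_exists V P f'.
Proof.
move=> Gf Ef L M s Vs; case: (V_single Vs) => B [VB HB]; case: (tr_bound VB) => B' [VB' [_ K]].
case: (K f f' g l a L M _ s); [by case: M => _ [A _]; case: (generic_dom Gf A)|exact/HB|].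
by move=> s' [sB E]; case: (Ef s' (V_in VB' sB)) => x v; exists x; apply/E.
Qed.

Lemma extension_md f f' g l a : generic V P f -> extension_exists V P f -> legit g l a -> md f f' g l a ->
  extension V P f' = extension V P f.
Proof.
move=> Gf Ef L M; have gk : g ∈ kappa by case: M => _ [A _]; case: (generic_dom Gf A).
apply: functional_extensionality => x; apply: propositional_extensionality; split=> [[s [Vs v]]|[s [Vs v]]];
  case: (V_single Vs) => B [VB HB]; case: (tr_bound VB) => B' [VB' [_ K]].
- case: (K f f' g l a L M gk s); first exact/HB.
  by move=> s' [sB E]; exists s'; split; [apply: V_in sB|apply/E].
- case: (K f' f g a l (legit_sym L) (md_sym M) gk s); first exact/HB.
  by move=> s' [sB E]; exists s'; split; [apply: V_in sB|apply/E].
Qed.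

(** A condition that forces [phi] still does so for the modified generic, which contains it and has
    the same extension. This is the source of the elementarity of the new embedding. *)
Lemma sat_md f phi (e x : nat -> U) : generic V P f -> extension_exists V P f ->
  (forall n, V (e n)) -> (forall n, val (filter_of P f) (e n) (x n)) -> sat (extension V P f) x phi ->
  exists p, filter_of P f p /\ forall f' g l a (x' : nat -> U), legit g l a -> md f f' g l a -> subset p f' ->
    (forall n, val (filter_of P f') (e n) (x' n)) -> sat (extension V P f) x' phi.
Proof.
move=> Gf Ef Ve vx /(truth VP Gf Ef phi Ve vx) [p [Gp F]]; exists p; split=> // f' g l a x' L M pf vx'.
rewrite -(extension_md Gf Ef L M).
have Gf' := generic_md Gf L M; have Ef' := extension_exists_md Gf Ef L M.
by apply/(truth VP Gf' Ef' phi Ve vx'); exists p; split=> //; split=> //; case: Gp.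
Qed.

Lemma val_rank (G : class U) s x alpha : ordinal alpha -> val G s x -> in_rank s alpha -> in_rank x alpha.
Proof.
move=> Oa; elim/(@below_ind U): s x alpha Oa => s IH x alpha Oa /val_iff [_ H] /in_rank_iff [beta [ba K]].
apply/in_rank_iff; exists beta; split=> // y /H [t [p [A [_ v]]]]; have Ob := ordinal_mem Oa ba.
apply: (IH t (app_below A) y beta Ob v); case: A => u [us Pu]; case: (pair_fst_mem Pu) => d [du td].
by apply: in_rank_mem td; [case: Ob|apply: in_rank_mem du; [case: Ob|apply: K]].
Qed.

(** ** Naming small sets below the next inaccessible cardinal *)

Section Naming.
Context (f : U) (f_gen : generic V P f) (f_ext : extension_exists V P f).
Context (g l : U) (fgl : app f g l).
Local Notation G := (filter_of P f).
Local Notation W := (extension V P f).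

Let gk : g ∈ kappa := proj1 (generic_dom f_gen fgl).
Let lk : l ∈ kappa := proj1 (proj2 (generic_dom f_gen fgl)).
Let Ig : inaccessible V g := proj2 (proj2 (generic_dom f_gen fgl)).
Let Vg : V g := V_in Vk gk.
Let Vl : V l := V_in Vk lk.
Let Og : ordinal g := inacc_ordinal Ig.

Let oP : o ∈ P.
Proof. by case: f_gen => [[p [pP _]] _]; apply: P_o pP. Qed.

Let Go0 : G o := Go Ho oP f.

(** The least inaccessible above [g] and [l]; admitting [kappa] itself as a candidate ensures that
    the minimum exists. *)
Lemma delta_ex : exists delta, V delta /\ inaccessible V delta /\ subset delta kappa /\ g ∈ delta /\ l ∈ delta /\
  forall d, d ∈ II -> g ∈ d -> l ∈ d -> subset delta d.
Proof.
case: (below_min (Q := fun d => V d /\ inaccessible V d /\ g ∈ d /\ l ∈ d /\ (d ∈ kappa \/ d = kappa))).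
  by exists kappa; do 4 (split=> //); right.
move=> d [[Vd [Id [gd [ld dk]]]] m]; exists d; split=> //; split=> //; split.
  by case: dk => [dk|->] // z; apply: ordinal_trans Ok dk.
split=> //; split=> // d' /HII [dk' Id'] gd' ld'.
apply: (ordinal_not_mem (inacc_ordinal Id) (inacc_ordinal Id')) => dd; apply: (m d' dd).
by split; [apply: V_in Vk dk'|do 3 (split=> //); left].
Qed.

Context (delta : U) (Vd : V delta) (Id : inaccessible V delta) (dk : subset delta kappa).
Context (gd : g ∈ delta) (ld : l ∈ delta).
Context (dleast : forall d, d ∈ II -> g ∈ d -> l ∈ d -> subset delta d).
Let Od : ordinal delta := inacc_ordinal Id.

(** Below the condition [(g, l)] the forcing factors. Lower conditions live on ordinals up to [g],
    and there are fewer than [delta] of them. Upper conditions have domain above both [g] and [l],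
    hence not below [delta], and allow unions of chains shorter than [delta]. *)
Definition lower q := q ∈ P /\ app q g l /\ forall a b, app q a b -> a ∈ g \/ a = g.
Definition upper t := t ∈ P /\ forall a b, app t a b -> g ∈ a /\ l ∈ a.
Definition isU r q t := subset q r /\ subset t r /\ forall z, z ∈ r -> z ∈ q \/ z ∈ t.

Lemma merge q t : lower q -> upper t -> exists r, r ∈ P /\ isU r q t.
Proof.
move=> [qP [Aq Dq]] [tP Dt]; case: (P_cup qP tP).
{ move=> a b b' /Dq [ag|->] /Dt [ga _]; by [case: (mem_asym ag)|case: (mem_irrefl ga)]. }
{ move=> c b A; have Hc := Dq _ _ A.
  have N a b' : a ∈ c -> ~ app t a b'.
  { move=> ac /Dt [ga _]; case: Hc => [cg|E]; last by subst c; case: (mem_asym ac).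
    exact: (mem_asym ga (ordinal_trans Og cg ac)). }
  have [ck [_ Ic]] := P_dom qP A; have Vc := V_in Vk ck; split; first by move=> a b' ac /(N _ _ ac).
  apply: small_sub (small_single Vc Ic Vo0) => v [vt [a [b' [Pv ac]]]]; case: (N a b' ac); by exists v. }
{ move=> c b A; have [gc lc] := Dt _ _ A; have [ck [_ Ic]] := P_dom tP A; have Vc := V_in Vk ck.
  have Oc := inacc_ordinal Ic; split.
  - move=> a b' ac A'; case: (Dq _ _ A') => [ag|E]; last by subst a; rewrite (P_fun qP A' Aq).
    exact: (ordinal_trans Oc gc (P_closed qP Aq ag A')).
  - case: (V_pair Vg Vl) => x [Vx Px].
    have S1 : small (restr q g) c by apply: small_le (P_restr qP Aq) => z; apply: ordinal_trans Oc gc.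
    apply: small_sub (small_cup Vc Ic S1 (small_single Vc Ic Vx)) => v [vq [a [b' [Pv ac]]]].
    have A' : app q a b' by exists v.
    case: (Dq _ _ A') => [ag|E]; first by left; split=> //; exists a, b'.
    subst a; right; rewrite (P_fun qP A' Aq) in Pv; exact: pair_unique Pv Px. }
move=> r [rP Hr]; exists r; split=> //; split; first by move=> z zq; apply/Hr; left.
by split=> z; [move=> zt; apply/Hr; right|move/Hr].
Qed.

(** No third part is left over: an element of the domain above [g] is closed under earlier values,
    so it is above [l] as well. *)
Lemma split_cond p : p ∈ P -> app p g l -> exists q t, lower q /\ upper t /\ isU p q t.
Proof.
move=> pP A; have Vp := P_V pP.
case: (sep (x := p) (Q := fun x => exists a b, is_pair x a b /\ (a ∈ g \/ a = g))) => //; first by dsolve.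
move=> q [Vq Hq]; have qp : subset q p by move=> z /Hq [].
case: (sep (x := p) (Q := fun x => exists a b, is_pair x a b /\ g ∈ a)) => //; first by dsolve.
move=> t [Vt Ht]; have tp : subset t p by move=> z /Ht [].
exists q, t; split.
  split; first exact: (P_sub pP Vq qp). split.
    by case: A => x [xp Px]; exists x; split=> //; apply/Hq; split=> //; exists g, l; split=> //; right.
  by move=> a b [x [/Hq [_ [a' [b' [Px H]]]] Px']]; case: (pair_inj Px Px') => <- _.
split.
  split; first exact: (P_sub pP Vt tp).
  move=> a b A'; have [ak [_ Ia]] := P_dom pP (app_sub tp A'); have ga : g ∈ a.
    by case: A' => x [/Ht [_ [a' [b' [Px H]]]] Px']; case: (pair_inj Px Px') => <- _.
  by split=> //; apply: (P_closed pP (app_sub tp A') ga A).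
split=> //; split=> // z zp; case: (P_pair pP zp) => a [b Pz].
have [ak [_ Ia]] : a ∈ kappa /\ b ∈ kappa /\ inaccessible V a by apply: (P_dom pP); exists z.
case: (ordinal_total (inacc_ordinal Ia) Og) => [H|[H|H]].
- by left; apply/Hq; split=> //; exists a, b; split=> //; left.
- by left; apply/Hq; split=> //; exists a, b; split=> //; right.
- by right; apply/Ht; split=> //; exists a, b.
Qed.

Lemma upper_sub t : upper t -> forall q z, lower q -> z ∈ t -> ~ z ∈ q.
Proof.
move=> [tP Dt] q z [qP [_ Dq]] zt zq; case: (P_pair tP zt) => a [b Pz].
have A1 : app t a b by exists z. have A2 : app q a b by exists z.
case: (Dt _ _ A1) => ga _; case: (Dq _ _ A2) => [ag|E]; first exact: (mem_asym ga ag).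
by subst a; case: (mem_irrefl ga).
Qed.

(** Every [c] in the domain of the union contains [delta], so the part below [c] is a union of fewer
    than [c] small pieces, and [c] is regular. *)
Lemma upper_chain i h t0 : i ∈ delta -> V h -> upper t0 ->
  (forall z w, app h z w -> z ∈ i /\ upper w /\ subset t0 w) ->
  (forall z z' w w', app h z w -> app h z' w' -> z ∈ z' -> subset w w') -> is_function h ->
  exists u, upper u /\ subset t0 u /\ forall z w, app h z w -> subset w u.
Proof.
move=> id Vh U0 Hh mono [_ fh]; have Vt0 := P_V (proj1 U0); have Oi := ordinal_mem Od id.
case: (app_union3 Vh) => b [Vb Hb]; case: (V_union Vb) => b2 [Vb2 Hb2]; case: (V_cup Vt0 Vb2) => b3 [Vb3 Hb3].
case: (sep (x := b3) (Q := fun x => x ∈ t0 \/ exists z w, app h z w /\ x ∈ w)) => //; first by dsolve.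
move=> u [Vu Hu'].
have Hu x : x ∈ u <-> x ∈ t0 \/ exists z w, app h z w /\ x ∈ w.
{ rewrite Hu'; split=> [[]//|H]; split=> //; apply/Hb3; case: H => [|[z [w [A xw]]]]; [by left|right].
  by apply/Hb2; exists w; split=> //; case: (Hb z w A). }
pose mem w := w = t0 \/ exists z, app h z w.
have memU w : mem w -> upper w /\ subset w u.
{ move=> [->|[z A]]; first by split=> // x xt; apply/Hu; left.
  by split; [case: (Hh z w A) => _ []|move=> x xw; apply/Hu; right; exists z, w]. }
have mtot w w' : mem w -> mem w' -> exists m, mem m /\ subset w m /\ subset w' m.
{ move=> [->|[z A]] [->|[z' A']].
  - by exists t0; split; [left|split].
  - by exists w'; split; [right; exists z'|split=> //; case: (Hh z' w' A') => _ []].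
  - by exists w; split; [right; exists z|split=> //; case: (Hh z w A) => _ []].
  - have O1 := ordinal_mem Oi (proj1 (Hh _ _ A)); have O2 := ordinal_mem Oi (proj1 (Hh _ _ A')).
    case: (ordinal_total O1 O2) => [H|[H|H]].
    + by exists w'; split; [right; exists z'|split=> //; apply: mono A A' H].
    + by subst z'; exists w; split; [right; exists z|rewrite (fh _ _ _ A A'); split].
    + by exists w; split; [right; exists z|split=> //; apply: mono A' A H]. }
have mu x : x ∈ u -> exists w, mem w /\ x ∈ w.
  by move=> /Hu [xt|[z [w [A xw]]]]; [exists t0; split=> //; left|exists w; split=> //; right; exists z].
have mu2 x x' : x ∈ u -> x' ∈ u -> exists w, mem w /\ x ∈ w /\ x' ∈ w.
{ move=> /mu [w [Mw xw]] /mu [w' [Mw' xw']]; case: (mtot w w' Mw Mw') => m [Mm [S S']].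
  by exists m; split=> //; split; [apply: S|apply: S']. }
have ap2 a a' c c' : app u a c -> app u a' c' -> exists w, mem w /\ app w a c /\ app w a' c'.
{ move=> [x [xu Px]] [x' [xu' Px']]; case: (mu2 x x' xu xu') => w [Mw [xw xw']]; exists w; split=> //.
  by split; [exists x|exists x']. }
have uP : u ∈ P.
{ apply/P_iff; split=> //; split; first split.
  - by move=> x /mu [w [Mw xw]]; case: (memU w Mw) => [[wP _] _]; apply: P_pair wP xw.
  - move=> a c c' A A'; case: (ap2 _ _ _ _ A A') => w [Mw [B B']]; case: (memU w Mw) => [[wP _] _].
    exact: P_fun wP B B'.
  - split.
      move=> a c A; case: (ap2 _ _ _ _ A A) => w [Mw [B _]]; case: (memU w Mw) => [[wP _] _]; exact: P_dom wP B.
    (* The piece [Q] is arbitrary, so that this applies to the whole union at [kappa] and to its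
       restriction below each [c]. *)
    have Smu (a : U) (Q : U -> Prop) : V a -> inaccessible V a -> i ∈ a -> dfn (F := FV) (fun _ e => Q (e 0)) ->
      (forall w, mem w -> small (fun x => x ∈ w /\ Q x) a) -> small (fun x => x ∈ u /\ Q x) a.
    { move=> Va Ia ia dQ Sw.
      have S1 := small_union Va Ia (X := fun z => z ∈ i) (Y := fun z x => (exists w, app h z w /\ x ∈ w) /\ Q x)
        (small_mem Va ia).
      have S2 : small (fun v => V v /\ exists j, j ∈ i /\ (exists w, app h j w /\ v ∈ w) /\ Q v) a.
      { apply: S1.
        - by move=> j ji; apply: V_in ji; apply: V_in Va ia.
        - by apply: d_and; [dsolve|apply: (d_subst dQ (T := fun _ _ e => e 1)) => n; exact: (@tm_var U FV 1)].
        - move=> j ji; case: (classic (exists w, app h j w)) => [[w A]|N].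
          + by apply: small_sub (Sw w (or_intror (ex_intro _ j A))) => v [_ [[w' [A' vw]] Qv]]; rewrite -(fh _ _ _ A' A).
          + by apply: small_sub (small_single Va Ia Vo0) => v [_ [[w [A _]] _]]; case: N; exists w. }
      apply: small_sub (small_cup Va Ia (Sw t0 (or_introl eq_refl)) S2) => x [/Hu [xt|[z [w [A xw]]]] Qx].
      - by left.
      - right; split; first by apply: (V_in (P_V (proj1 (proj1 (memU w (or_intror (ex_intro _ z A))))))).
        by exists z; split; [case: (Hh z w A)|split=> //; exists w]. }
    split.
    { have S := Smu kappa (fun _ => True) Vk Ik (dk id); apply: small_sub (S _ _) => //.
      + by apply: (d_ext (Q' := fun _ _ => ~ False)); [move=> ? ? _; tauto|dsolve].
      + move=> w Mw; case: (memU w Mw) => [[wP _] _]; by apply: small_sub (P_small wP) => v []. }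
    move=> c d A; case: (ap2 _ _ _ _ A A) => w0 [Mw0 [B0 _]]; case: (memU w0 Mw0) => [[wP0 D0] _].
    have [ck [_ Ic]] := P_dom wP0 B0; have Vc := V_in Vk ck; have [gc lc] := D0 _ _ B0; split.
      move=> a c' ac A'; case: (ap2 _ _ _ _ A A') => w [Mw [B B']]; case: (memU w Mw) => [[wP _] _].
      exact: P_closed wP B ac B'.
    have cI : c ∈ II by apply/HII.
    apply: (Smu c (fun x => exists a b, is_pair x a b /\ a ∈ c)) => //.
    + by apply: (dleast cI).
    + dsolve.
    + move=> w Mw; case: (mtot w w0 Mw Mw0) => m [Mm [S S0]]; case: (memU m Mm) => [[mP _] _].
      by apply: small_sub (P_restr mP (app_sub S0 B0)) => v [vw H]; split=> //; apply: S. }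
exists u; split; first split=> //.
- move=> a c A; case: (ap2 _ _ _ _ A A) => w [Mw [B _]]; case: (memU w Mw) => [[_ D] _]; exact: D B.
- by split=> [x xt|z w A x xw]; apply/Hu; [left|right; exists z, w].
Qed.

Lemma upper_set : exists T, V T /\ forall t, t ∈ T <-> upper t.
Proof.
have VP' := VP; case: (sep (x := P) (Q := fun t => forall a b, app t a b -> g ∈ a /\ l ∈ a)) => //; first by dsolve.
by move=> T [VT HT]; exists T.
Qed.

Lemma lower_set : exists T, V T /\ forall t, t ∈ T <-> lower t.
Proof.
have VP' := VP.
case: (sep (x := P) (Q := fun t => app t g l /\ forall a b, app t a b -> a ∈ g \/ a = g)) => //; first by dsolve.
by move=> T [VT HT]; exists T.
Qed.

(* The upper conditions are closed under increasing unions of length below delta. *)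
Lemma distributive i (D : U -> U -> Prop) t0 : i ∈ delta -> dfn (F := FV) (fun _ e => D (e 0) (e 1)) ->
  (forall xi t t', D xi t -> upper t -> upper t' -> subset t t' -> D xi t') ->
  (forall xi t, xi ∈ i -> upper t -> exists t', upper t' /\ subset t t' /\ D xi t') -> upper t0 ->
  exists t, upper t /\ subset t0 t /\ forall xi, xi ∈ i -> D xi t.
Proof.
move=> id dD opn dns U0; case: upper_set => T [VT HT]; case: (choice_function VT) => c [Vc [fc Hc]].
have Vt0 := P_V (proj1 U0); have Vi := V_in Vd id; have Oi := ordinal_mem Od id.
(* Candidates at stage [x] extend [t0] and all earlier choices and satisfy the requirement of index
   [x]; [upper_chain] ensures that there are some. *)
pose cand x h t := t ∈ T /\ subset t0 t /\ (forall z w, app h z w -> subset w t) /\ D x t.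
have dcand t1 t2 t3 : tm (F := FV) t1 -> tm (F := FV) t2 -> tm (F := FV) t3 ->
  dfn (F := FV) (fun i e => cand (t1 i e) (t2 i e) (t3 i e)).
{ move=> H1 H2 H3; rewrite /cand; apply: d_and; first by dsolve. apply: d_and; first by dsolve.
  by apply: d_and; [dsolve|apply: (d_subst2 dD)]. }
pose F (p x h y : U) := (exists Z, V Z /\ (forall t, V t -> (t ∈ Z <-> cand x h t)) /\ y ∈ Z /\ app c Z y) \/
  ((forall t, t ∈ T -> ~ cand x h t) /\ y = o).
case: (@recursion F).
{ rewrite /F; by repeat first [apply: dcand; tm_solve | dstep]. }
{ move=> p x h Vp Vx Vh; case: (sep (x := T) (Q := cand x h)) => //; first by apply: dcand; tm_solve.
  move=> Z [VZ HZ]; case: (classic (exists u, cand x h u)) => [[u bu]|N]; last first.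
    by exists o; split=> //; right; split=> // u _ bu; apply: N; exists u.
  case: (Hc Z VZ); [by move=> z /HZ []|by exists u; apply/HZ; split=> //; case: bu|].
  move=> y [yZ cy]; exists y; split; first exact: V_in yZ.
  left; exists Z; split=> //; split=> // v Vv; rewrite HZ; split=> [[]//|bv]; split=> //; by case: bv. }
{ move=> p x h y y' Vp Vx Vh Vy Vy' H H'.
  case: H H' => [[Z [VZ [HZ [yZ cZ]]]]|[N ->]] [[Z' [VZ' [HZ' [yZ' cZ']]]]|[N' ->]] //.
  - suff E : Z = Z' by subst Z'; case: fc => _; apply; eassumption.
    apply: mem_ext => z; split=> H; have Vz : V z by [apply: V_in VZ H|apply: V_in VZ' H].
    + by apply/HZ' => //; apply/HZ.
    + by apply/HZ => //; apply/HZ'.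
  - have b := proj1 (HZ y Vy) yZ; by case: (N' y) => //; case: b.
  - have b := proj1 (HZ' y' Vy') yZ'; by case: (N y') => //; case: b. }
move=> R [dR [Rtot [Rfun [Rin Req]]]].
have good xi : xi ∈ i -> forall y, R o xi y -> upper y /\ subset t0 y /\ D xi y /\
  forall z w, z ∈ xi -> R o z w -> subset w y.
{ elim/(well_founded_ind (@mem_wf U)): xi => xi IH xii y Ry; case: (Rin _ _ _ Ry) => Vxi Vy.
  case/(Req _ _ _ Vo0 Vxi Vy): Ry => h [Vh [fh [Eh Fh]]].
  have IH' z w : app h z w -> z ∈ xi /\ upper w /\ subset t0 w /\ forall z' w', z' ∈ z -> R o z' w' -> subset w' w.
  { move=> /Eh [zx Rz]; split=> //; case: (IH z zx (ordinal_trans Oi xii zx) w Rz) => H1 [H2 [_ H3]]; by split. }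
  case: (upper_chain (i := xi) (h := h) (t0 := t0)) => //.
  - exact: ordinal_trans Od id xii.
  - by move=> z w /IH' [? [? [? _]]].
  - move=> z z' w w' A A' zz; case: (IH' _ _ A') => _ [_ [_ K]]; apply: (K z) => //; by case/Eh: A.
  - move=> u [Uu [tu hu]]; case: (dns xi u xii Uu) => t [Ut [ut Dt]].
    have ct : cand xi h t.
      by split; [apply/HT|split; [move=> x /tu /ut|split=> // z w /hu wu x /wu /ut]].
    case: Fh => [[Z [VZ [HZ [yZ _]]]]|[N _]]; last by case: (N t) => //; apply/HT.
    case/(HZ y Vy): yZ => /HT Uy [ty [hy Dy]]; split=> //; split=> //; split=> // z w zx Rz; apply: (hy z); by apply/Eh. }
case: (V_func (x := i) (Q := fun al y => R o al y)) => //; first by apply: (d_subst3 dR); tm_solve.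
  by move=> al y y' _ _ _; apply: Rfun.
move=> h [Vh [fh Hh]]; case: (upper_chain (i := i) (h := h) (t0 := t0)) => //.
- by move=> z w /Hh [zi [_ Rz]]; case: (good z zi w Rz) => ? [? _].
- by move=> z z' w w' /Hh [zi [_ Rz]] /Hh [zi' [_ Rz']] zz; case: (good z' zi' w' Rz') => _ [_ [_ K]]; apply: (K z).
- move=> u [Uu [tu hu]]; exists u; split=> //; split=> // xi xii; case: (Rtot o xi Vo0 (V_in Vi xii)) => y Ry.
  case: (good xi xii y Ry) => Uy [_ [Dy _]]; apply: (opn xi y) => //; apply: (hu xi); apply/Hh; split=> //.
  by split=> //; case: (Rin _ _ _ Ry).
Qed.

Lemma gen_cond : exists p, G p /\ app p g l.
Proof.
by case: f_gen => _ [_ [_ Hf]]; case: fgl => x [/Hf [p [Gp xp]] Px]; exists p; split=> //; exists x.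
Qed.

(** A condition containing [(g, l)] is split, its upper part is extended to satisfy all
    requirements, and the result is merged with the lower part. By density one such upper condition
    is contained in [f]. *)
Lemma generic_upper X (D : U -> U -> Prop) : V X -> small (fun x => x ∈ X) delta ->
  dfn (F := FV) (fun _ e => D (e 0) (e 1)) ->
  (forall x t t', D x t -> upper t -> upper t' -> subset t t' -> D x t') ->
  (forall x t, x ∈ X -> upper t -> exists t', upper t' /\ subset t t' /\ D x t') ->
  exists t, upper t /\ subset t f /\ forall x, x ∈ X -> D x t.
Proof.
move=> VX [b [bd [h [Vh [fh [Dh Ch]]]]]] dD opn dns; case: upper_set => T [VT HT]; have VP' := VP.
case: gen_cond => p0 [Gp0 Ap0].
case: (gen_below VP f_gen Gp0 (Q := fun r => exists t, t ∈ T /\ subset t r /\ forall x, x ∈ X -> D x t)).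
- apply: d_bex; first tm_solve. apply: d_and; first by dsolve. apply: d_ball; first tm_solve.
  by apply: (d_subst2 dD); tm_solve.
- move=> q qP pq; case: (split_cond qP (app_sub pq Ap0)) => q1 [t0 [Lq [Ut0 [q1q [t0q Uq]]]]].
  case: (distributive (i := b) (D := fun xi t => forall x, app h xi x -> x ∈ X -> D x t) (t0 := t0)) => //.
  + apply: d_all_val; try tm_solve. by apply: d_imp; [dsolve|apply: (d_subst2 dD); tm_solve].
  + by move=> xi t t' H Ut Ut' tt x A xX; apply: (opn x t) => //; apply: H.
  + move=> xi t xib Ut; case: (classic (exists x, app h xi x /\ x ∈ X)) => [[x [A xX]]|N].
    * case: (dns x t xX Ut) => t' [Ut' [tt Dt]]; exists t'; split=> //; split=> // x' A' _.
      by have -> : x' = x by case: fh => _; apply; eassumption.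
    * by exists t; split=> //; split=> // x A xX; case: N; exists x.
  + move=> t [Ut [tt Dt]]; case: (merge Lq Ut) => r [rP [qr [tr Ur]]]; exists r; split=> //; split.
      by move=> z /Uq [/qr|/tt /tr].
    exists t; split; first exact/HT. split=> // x xX; case: (Ch x xX) => xi A; apply: (Dt xi) => //; exact: Dh A.
- move=> r [[rP rf] [_ [t [/HT Ut [tr Dt]]]]]; exists t; split=> //; split=> // z /tr; exact: rf.
Qed.

Lemma small_prod (X Y : U -> Prop) : small X delta -> small Y delta -> (forall x, X x -> V x) -> (forall x, Y x -> V x) ->
  small (fun z => exists x y, X x /\ Y y /\ is_pair z x y) delta.
Proof.
move=> SX [b [bd [h [Vh [fh [Dh Ch]]]]]] VX VY.
have := small_union Vd Id (X := X) (Y := fun x z => exists x' y, is_pair z x' y /\ x' = x /\ exists xi, app h xi y) SX VX.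
case.
- dsolve.
- move=> x Xx; have Vx := VX x Xx.
  apply: (small_image (Q := fun xi z => exists x' y, is_pair z x' y /\ x' = x /\ app h xi y) Vd _ _ _ (small_mem Vd bd)).
  + dsolve.
  + move=> xi z z' _ _ _ [x1 [y [Pz [? A]]]] [x2 [y' [Pz' [? A']]]]; subst x1 x2.
    have E : y = y' by case: fh => _; apply; eassumption.
    by subst y'; apply: pair_unique Pz Pz'.
  + move=> z [Vz [x' [y [Pz [E [xi A]]]]]]; split=> //; exists xi; split; first by case: (app_in V_trans Vh A).
    by split; [apply: Dh A|exists x', y].
- move=> m [md [k [Vk' [fk [Dk Ck]]]]]; exists m; split=> //; exists k; do 3 (split=> //).
  move=> z [x [y [Xx [Yy Pz]]]]; apply: Ck; split.
    by case: (V_pair (VX x Xx) (VY y Yy)) => z' [Vz' Pz']; rewrite (pair_unique Pz Pz').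
  by exists x; split=> //; exists x, y; split=> //; split=> //; apply: Ch.
Qed.

(** Lower conditions are subsets of the square of a fixed [m] in [delta] above [g] and [l], and
    [delta] is a strong limit. *)
Lemma small_lower : small lower delta.
Proof.
case: (inacc_limit Id gd) => g' [g'd gg']; case: (inacc_limit Id ld) => l' [l'd ll'].
case: (inacc_max Id g'd l'd) => m [md [gm lm]]; have Vm := V_in Vd md.
have Om := ordinal_mem Od md; have g_m : g ∈ m by apply: gm. have l_m : l ∈ m by apply: lm.
case: (V_prod Vm Vm) => M [VM HM].
have SM : small (fun v => v ∈ M) delta.
  by apply: small_sub (small_square Vd Id md) => v /HM.
apply: small_sub (small_power Vd Id VM SM) => q [qP [A D]]; split; first exact: P_V qP.
move=> z zq; case: (P_pair qP zq) => a [b Pz]; have A' : app q a b by exists z.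
apply/HM; exists a, b; case: (D _ _ A') => [ag|E].
- by split; [apply: ordinal_trans Om g_m ag|split=> //; apply: ordinal_trans Om g_m (P_closed qP A ag A')].
- by subst a; split=> //; split=> //; rewrite (P_fun qP A' A).
Qed.

(** The bound is strict, in contrast to [lower], because the value at [g] is going to change. *)
Definition low q := q ∈ P /\ forall a b, app q a b -> a ∈ g.

(* A name that mentions hereditarily only conditions with domain contained in [g]
   keeps its value when the generic is changed at [g]. *)
Definition good s := exists A, V A /\ s ∈ A /\
  forall s', s' ∈ A -> forall u, u ∈ s' -> exists t p, is_pair u t p /\ t ∈ A /\ low p.

Lemma d_good t : tm (F := FV) t -> dfn (F := FV) (fun i e => good (t i e)).
Proof. have VP' := VP; move=> H; rewrite /good /low; dsolve. Qed.

Lemma good_app s t p : V s -> good s -> app s t p -> good t /\ low p.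
Proof.
move=> Vs [A [VA [sA H]]] [u [us Pu]]; case: (H s sA u us) => t' [p' [Pu' [tA Lp]]].
by case: (pair_inj Pu Pu') => ? ?; subst; split=> //; exists A.
Qed.

Lemma good_val f' s : (forall p, low p -> (subset p f <-> subset p f')) -> V s -> good s ->
  forall x, val G s x -> val (filter_of P f') s x.
Proof.
move=> E; elim/(@below_ind U): s => s IH Vs gs x /val_iff [H1 H2]; apply/val_iff; split.
- move=> t p A [pP pf']; case: (good_app Vs gs A) => gt Lp; have [Vt _] := app_in V_trans Vs A.
  case: (H1 t p A); first by split=> //; apply/E.
  by move=> y [yx v]; exists y; split=> //; apply: IH v => //; apply: app_below A.
- move=> y /H2 [t [p [A [[pP pf] v]]]]; case: (good_app Vs gs A) => gt Lp; have [Vt _] := app_in V_trans Vs A.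
  exists t, p; split=> //; split; first by split=> //; apply/E.
  by apply: IH v => //; apply: app_below A.
Qed.

Lemma Sd_ex : exists S, V S /\ forall s, s ∈ S <-> V s /\ in_rank s delta /\ good s.
Proof.
case: (V_level Vd) => L [VL HL]; case: (sep (x := L) (Q := good)) => //; first by apply: d_good; tm_solve.
by move=> S [VS HS]; exists S; split=> // s; rewrite HS HL; tauto.
Qed.

Context (Sd : U) (VSd : V Sd) (HSd : forall s, s ∈ Sd <-> V s /\ in_rank s delta /\ good s).

Lemma Sd_app s t p : s ∈ Sd -> app s t p -> t ∈ Sd.
Proof.
move=> /HSd [Vs [rs gs]] A; apply/HSd; split; first by case: (app_in V_trans Vs A).
split; last by case: (good_app Vs gs A).
case: A => u [us Pu]; case: (pair_fst_mem Pu) => d [du td].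
have T : transitive_set delta by case: Od.
exact: (in_rank_mem T (in_rank_mem T (in_rank_mem T rs us) du) td).
Qed.

Lemma Sd_intro s : V s -> in_rank s delta -> (forall u, u ∈ s -> exists t p, is_pair u t p /\ t ∈ Sd /\ low p) -> s ∈ Sd.
Proof.
move=> Vs rs H; apply/HSd; split=> //; split=> //; case: (V_adjoin VSd Vs) => A [VA HA]; exists A; split=> //.
split; first by apply/HA; right.
move=> s' /HA [sS|->] u us.
- case/HSd: (sS) => Vs' [_ [B [VB [sB HB]]]]; case: (HB s' sB u us) => t [p [Pu [tB Lp]]]; exists t, p.
  by split=> //; split=> //; apply/HA; left; apply: (@Sd_app s' t p) => //; exists u.
- by case: (H u us) => t [p [Pu [tS Lp]]]; exists t, p; split=> //; split=> //; apply/HA; left.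
Qed.

(** Check names mention the empty condition only, which is low. *)
Lemma Sd_chk x s : V x -> in_rank x delta -> chk o x s -> s ∈ Sd.
Proof.
elim/(well_founded_ind (@mem_wf U)): x s => x IH s Vx rx c; have [_ Vs] := chk_in VP oP c.
have T : transitive_set delta by case: Od.
have El u : u ∈ s -> exists t z, is_pair u t o /\ z ∈ x /\ chk o z t /\ t ∈ Sd.
{ move=> us; case: (chk_rec VP oP) => _ [_ [_ [_ H]]]; case/(H x s c): us => Vu [z [w [zx [cz Pu]]]].
  exists w, z; split=> //; split=> //; split=> //; apply: (IH z zx) => //; [exact: V_in zx|exact: in_rank_mem T rx zx]. }
have low_o : low o by split=> // a b [z [/Ho]].
apply: Sd_intro => //; last by move=> u /El [t [z [Pu [_ [_ tS]]]]]; exists t, o.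
apply: (in_rank_small Vd Id) => //.
- move=> u /El [t [z [Pu [_ [_ tS]]]]]; have Vt := V_in VSd tS; apply: (in_rank_pair Vd Id Vt Vo0 _ _ Pu).
    by case/HSd: tS => _ [].
  by apply: in_rank_ordinal; [split=> z0 /Ho|apply: (inacc_zero Id)].
- apply: (small_image (Q := fun z u => exists t p, is_pair u t p /\ chk o z t /\ p = o) Vd _ _ _ (small_in_rank Vd Id Vx rx)).
  + apply: d_ex_pair; first tm_solve. apply: d_and; last by dsolve. by apply: (d_chk VP oP); tm_solve.
  + move=> z u u' _ _ _ [t [p [Pu [cz ?]]]] [t' [p' [Pu' [cz' ?]]]]; subst p p'.
    by rewrite (chk_fun VP oP cz cz') in Pu; apply: pair_unique Pu Pu'.
  + move=> u us; split; first exact: V_in us. case: (El u us) => t [z [Pu [zx [cz _]]]]; exists z.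
    by split; [apply: V_in zx|split=> //; exists t, o].
Qed.


Local Notation FW := (frame1 (@W_trans P f) (W_ne VP Ho oP f)).

Lemma low_set : exists T, V T /\ forall t, t ∈ T <-> low t.
Proof.
have VP' := VP; case: (sep (x := P) (Q := fun t => forall a b, app t a b -> a ∈ g)) => //; first by dsolve.
by move=> T [VT HT]; exists T.
Qed.

Lemma low_of_lower q : lower q -> exists p, low p /\ subset p q /\ (forall z, z ∈ q -> z ∈ p \/ is_pair z g l) /\
  V p /\ in_rank p delta.
Proof.
move=> [qP [A D]]; have Vq := P_V qP.
case: (sep (x := q) (Q := fun x => exists a b, is_pair x a b /\ a ∈ g)) => //; first by dsolve.
move=> p [Vp Hp]; have pq : subset p q by move=> z /Hp [].
exists p; split.
  split; first exact: (P_sub qP Vp pq).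
  by move=> a b [x [/Hp [_ [a' [b' [Px H]]]] Px']]; case: (pair_inj Px Px') => <- _.
split=> //; split.
  move=> z zq; case: (P_pair qP zq) => a [b Pz]; have A' : app q a b by exists z.
  case: (D _ _ A') => [ag|E]; first by left; apply/Hp; split=> //; exists a, b.
  by subst a; right; rewrite (P_fun qP A A').
split=> //; apply: (in_rank_small Vd Id) => //.
- move=> v /Hp [vq [a [b [Pv ag]]]]; have A' : app q a b by exists v.
  have bg := P_closed qP A ag A'.
  have od c : c ∈ g -> V c /\ in_rank c delta.
    by move=> cg; split; [apply: V_in cg|apply: in_rank_ordinal; [apply: ordinal_mem cg|apply: ordinal_trans Od gd cg]].
  by case: (od a ag) => Va ra; case: (od b bg) => Vb rb; apply: (in_rank_pair Vd Id Va Vb ra rb Pv).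
- have gsub : subset g delta by move=> z; apply: ordinal_trans Od gd.
  by apply: small_sub (small_le gsub (P_restr qP A)) => v /Hp.
Qed.

Lemma d_isU (F : frame U) (t1 t2 t3 : ix F -> (nat -> U) -> U) : tm t1 -> tm t2 -> tm t3 ->
  dfn (F := F) (fun i e => isU (t1 i e) (t2 i e) (t3 i e)).
Proof. move=> H1 H2 H3; rewrite /isU; dsolve. Qed.

(** The elements of [y] are listed along [m], and each has a name in [Sd]. There are fewer than
    [delta] questions, one for each index and lower condition, so one upper condition [t] in [f]
    decides them all. Given [t], the answers are found among names of bounded rank, and whether an
    answer applies depends only on the lower part of the generic. *)
Lemma name_step y m (Q : U -> U -> Prop) : m ∈ delta -> dfn (F := FW) (fun _ e => Q (e 0) (e 1)) ->
  (forall y' xi, xi ∈ m -> W y' -> Q y' xi -> y' ∈ y) ->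
  (forall y', y' ∈ y -> exists xi, xi ∈ m /\ Q y' xi) ->
  (forall y1 y2 xi, xi ∈ m -> Q y1 xi -> Q y2 xi -> y1 = y2) ->
  (forall y', y' ∈ y -> exists s, s ∈ Sd /\ val G s y') ->
  exists s, s ∈ Sd /\ val G s y.
Proof.
move=> md dQ H0 H1 H2 H3; have Vm := V_in Vd md; have VP' := VP.
case: (forcing_pred f_gen f_ext dQ) => Fr [dFr [Fr_mono Fr_truth]].
case: lower_set => Lo [VLo HLo]; case: upper_set => Up [VUp HUp]; case: low_set => Lw [VLw HLw].
case: (V_prod Vm VLo) => X [VX HX].
pose hit q t xi s := exists r, r ∈ P /\ isU r q t /\ Fr r s xi.
have dhit t1 t2 t3 t4 : tm (F := FV) t1 -> tm (F := FV) t2 -> tm (F := FV) t3 -> tm (F := FV) t4 ->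
  dfn (F := FV) (fun i e => hit (t1 i e) (t2 i e) (t3 i e) (t4 i e)).
{ move=> h1 h2 h3 h4; apply: d_bex; first tm_solve. apply: d_and; first by apply: d_isU; tm_solve.
  by apply: (d_subst3 dFr); tm_solve. }
have hit_mono q t t' xi s : lower q -> upper t' -> subset t t' -> s ∈ Sd -> hit q t xi s -> hit q t' xi s.
{ move=> Lq Ut' tt sS [r [rP [[qr [tr Ur]] Fs]]]; case: (merge Lq Ut') => r' [rP' [qr' [tr' Ur']]]; exists r'.
  split=> //; split=> //; apply: (Fr_mono r) => //; last exact: V_in sS.
  by move=> z /Ur [/qr'|/tt /tr']. }
(* The question [x] consists of an index [xi] and a lower [q]. Either some lower extension of [q]
   together with [t] forces a name in [Sd] to be the element of index [xi], or this remains
   impossible for all extensions of [t]. *)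
pose D x t := forall xi q, is_pair x xi q ->
  (exists q', q' ∈ Lo /\ subset q q' /\ exists s, s ∈ Sd /\ hit q' t xi s) \/
  (forall t', t' ∈ Up -> subset t t' -> forall q', q' ∈ Lo -> subset q q' -> forall s, s ∈ Sd -> ~ hit q' t' xi s).
case: (generic_upper (X := X) (D := D)) => //.
{ apply: small_sub (small_prod (X := fun x => x ∈ m) (Y := lower) (small_mem Vd md) small_lower _ _).
  - by move=> z /HX [x [q [xm [/HLo Lq Pz]]]]; exists x, q.
  - by move=> x; apply: V_in Vm.
  - by move=> q [qP _]; apply: P_V. }
{ rewrite /D; by repeat first [apply: dhit; tm_solve | dstep]. }
{ move=> x t t' Dx Ut Ut' tt xi q Px; case: (Dx xi q Px) => [[q' [qL [qq [s [sS h]]]]]|N].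
  - left; exists q'; split=> //; split=> //; exists s; split=> //; apply: (hit_mono _ t) => //; exact/HLo.
  - by right=> t1 tU1 tt1; apply: N => // z /tt /tt1. }
{ move=> x t /HX [xi0 [q0 [_ [_ Px0]]]] Ut.
  case: (classic (exists t' q' s, upper t' /\ subset t t' /\ lower q' /\ subset q0 q' /\ s ∈ Sd /\ hit q' t' xi0 s)).
  - move=> [t' [q' [s [Ut' [tt [Lq' [qq [sS h]]]]]]]]; exists t'; split=> //; split=> // xi q Px.
    case: (pair_inj Px Px0) => ? ?; subst; left; exists q'; split; first exact/HLo.
    by split=> //; exists s.
  - move=> N; exists t; split=> //; split=> // xi q Px; case: (pair_inj Px Px0) => ? ?; subst.
    right=> t' /HUp Ut' tt q' /HLo Lq' qq s sS h; apply: N; by exists t', q', s. }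
move=> t [Ut [tf Dt]]; have Vt := P_V (proj1 Ut); have Gt : G t by split=> //; case: Ut.
pose hitx x s := exists xi q, is_pair x xi q /\ hit q t xi s.
have dhitx t1 t2 : tm (F := FV) t1 -> tm (F := FV) t2 -> dfn (F := FV) (fun i e => hitx (t1 i e) (t2 i e)).
{ by move=> h1 h2; apply: d_ex_pair; [tm_solve|apply: dhit; tm_solve]. }
pose Nb x b := exists s, s ∈ Sd /\ in_rank s b /\ hitx x s.
have dNb t1 t2 : tm (F := FV) t1 -> tm (F := FV) t2 -> dfn (F := FV) (fun i e => Nb (t1 i e) (t2 i e)).
{ move=> h1 h2; apply: d_bex; first tm_solve. apply: d_and; first by dsolve. by apply: dhitx; tm_solve. }
have SX : small (fun x => x ∈ X) delta.
{ apply: small_sub (small_prod (X := fun x => x ∈ m) (Y := lower) (small_mem Vd md) small_lower _ _).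
  - by move=> z /HX [x [q [xm [/HLo Lq Pz]]]]; exists x, q.
  - by move=> x; apply: V_in Vm.
  - by move=> q [qP _]; apply: P_V. }
(* As there are fewer than [delta] questions, the least ranks of the answers are bounded by some [c]
   in [delta]. *)
case: (small_bound Vd Id (Q := fun x b => ordinal b /\ Nb x b /\ forall b', b' ∈ b -> ~ Nb x b') SX).
{ by repeat first [apply: dNb; tm_solve | dstep]. }
{ move=> x b1 b2 _ _ [O1 [N1 m1]] [O2 [N2 m2]]; case: (ordinal_total O1 O2) => [K|[//|K]].
  - by case: (m2 _ K).
  - by case: (m1 _ K). }
move=> c [cd Hc]; have Oc := ordinal_mem Od cd; have Vc := V_in Vd cd.
have bnd x s : x ∈ X -> s ∈ Sd -> hitx x s -> exists s', s' ∈ Sd /\ in_rank s' c /\ hitx x s'.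
{ move=> xX sS h; have [b [[bd Nx] mb]] : exists b, (b ∈ delta /\ Nb x b) /\ forall b', b' ∈ b -> ~ (b' ∈ delta /\ Nb x b').
  { apply: below_min; case/HSd: (sS) => Vs [/in_rank_iff [b [bd Hb]] _]; case: (inacc_limit Id bd) => b' [bd' bb].
    exists b'; split=> //; exists s; split=> //; split=> //; apply/in_rank_iff; by exists b. }
  have bc : b ∈ c.
  { apply: (Hc x) => //; split; first exact: ordinal_mem Od bd. split=> // b' bb' K; apply: (mb b' bb'); split=> //.
    exact: ordinal_trans Od bd bb'. }
  case: Nx => s' [sS' [rs' h']]; exists s'; split=> //; split=> //; apply: (in_rank_le rs').
  by case: Oc => T _; apply: T. }
case: (sep (x := Sd) (Q := fun s => in_rank s c)) => //; first by dsolve.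
move=> Sc [VSc HSc]; case: (V_prod VSc VLw) => Y [VY HY].
(* This is used with [p] low, so that [p] is [q] without the pair [(g, l)]. That pair belongs to
   [f], so [p] is contained in [f] exactly when [q] is, but only [p] may occur in a name in [Sd]. *)
pose minus p q := subset p q /\ forall z, z ∈ q -> z ∈ p \/ is_pair z g l.
case: (sep (x := Y) (Q := fun u => exists s p, is_pair u s p /\ in_rank p delta /\ exists q, q ∈ Lo /\ minus p q /\
   exists xi, xi ∈ m /\ hit q t xi s)) => //.
{ rewrite /minus; by repeat first [apply: dhit; tm_solve | dstep]. }
move=> sy [Vsy Hsy].
have As s p : app sy s p <-> s ∈ Sc /\ low p /\ in_rank p delta /\ exists q, lower q /\ minus p q /\
   exists xi, xi ∈ m /\ hit q t xi s.
{ split=> [[u [/Hsy [/HY [s1 [p1 [sS [/HLw Lp Pu1]]]] [s2 [p2 [Pu2 [rp [q [/HLo Lq H]]]]]]] Pu]]|[sS [Lp [rp [q [Lq H]]]]]].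
  - case: (pair_inj Pu Pu1) => ? ?; case: (pair_inj Pu Pu2) => ? ?; subst; split=> //; split=> //; split=> //; by exists q.
  - case: (V_pair (V_in VSc sS) (P_V (proj1 Lp))) => u [Vu Pu]; exists u; split=> //; apply/Hsy; split.
      by apply/HY; exists s, p; split=> //; split=> //; apply/HLw.
    by exists s, p; split=> //; split=> //; exists q; split=> //; apply/HLo. }
have Gr q r : subset q f -> r ∈ P -> isU r q t -> G r.
  by move=> qf rP [_ [_ Ur]]; split=> // z /Ur [/qf|/tf].
exists sy; split.
{ apply: Sd_intro => //.
  - apply: (in_rank_small Vd Id) => //.
    + move=> u /Hsy [/HY [s [p [sS [/HLw Lp Pu]]]] [s2 [p2 [Pu2 [rp _]]]]]; case: (pair_inj Pu Pu2) => ? ?; subst s2 p2.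
      apply: (in_rank_pair Vd Id (V_in VSc sS) (P_V (proj1 Lp)) _ rp Pu); by case/HSc: sS => /HSd [_ []].
    + have SSc : small (fun s => s ∈ Sc) delta.
        by apply: small_sub (small_level Vd Id cd) => s /HSc [/HSd [Vs _] rs].
      have SLw : small (fun p => V p /\ exists q, lower q /\ minus p q /\ ~ app p g l) delta.
      { apply: (small_image (Q := fun q p => minus p q /\ ~ app p g l) Vd _ _ _ small_lower).
        - by rewrite /minus; dsolve.
        - move=> q p p' _ _ _ [[pq Hp] Np] [[pq' Hp'] Np']; apply: mem_ext => z; split=> zp.
          + by case: (Hp' z (pq z zp)) => // Pz; case: Np; exists z.
          + by case: (Hp z (pq' z zp)) => // Pz; case: Np'; exists z.
        - move=> p [Vp [q [Lq H]]]; split=> //; exists q; split=> //; apply: P_V; by case: Lq. }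
      apply: small_sub (small_prod SSc SLw _ _).
      * move=> u /Hsy [/HY [s [p [sS [/HLw Lp Pu]]]] [s2 [p2 [Pu2 [rp [q [/HLo Lq [Mq _]]]]]]]].
        case: (pair_inj Pu Pu2) => ? ?; subst s2 p2; exists s, p; split=> //; split=> //.
        split; first exact: P_V (proj1 Lp). exists q; split=> //; split=> //.
        by move=> A; case: Lp => _ /(_ _ _ A) /mem_irrefl.
      * by move=> s; apply: V_in VSc.
      * by move=> p [].
  - by move=> u /Hsy [/HY [s [p [sS [/HLw Lp Pu]]]] _]; exists s, p; split=> //; split=> //; case/HSc: sS. }
apply/val_iff; split.
- move=> s p /As [sS [Lp [rp [q [Lq [[pq Mq] [xi [xm [r [rP [Ur Fs]]]]]]]]]]] [_ pf].
  have Vs := V_in VSc sS; case: (f_ext Vs) => y' v; exists y'; split=> //.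
  apply: (H0 y' xi) => //; first by exists s.
  apply/(Fr_truth s xi y' Vs (V_in Vm xm) v); exists r; split=> //; apply: (Gr q) => // z /Mq [/pf //|Pz].
  exact: app_mem fgl Pz.
- move=> y' yy; case: (H1 y' yy) => xi [xm Qy]; case: (H3 y' yy) => s [sS v].
  have Vs := V_in VSd sS; have Vxi := V_in Vm xm.
  case/(Fr_truth s xi y' Vs Vxi v): (Qy) => p1 [Gp1 F1]; case: gen_cond => p0 [Gp0 Ap0].
  case: (gen_dir f_gen Gp1 Gp0) => p2 [Gp2 [p12 p02]]; case: (gen_dir f_gen Gp2 Gt) => p3 [Gp3 [p23 tp3]].
  case: (gen_below VP f_gen Gp3 (Q := fun r => exists q', q' ∈ Lo /\ subset q' r /\ exists s', s' ∈ Sd /\ hit q' t xi s')).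
  + by repeat first [apply: dhit; tm_solve | dstep].
  + move=> r rP p3r; have Ar : app r g l by apply: (app_sub p3r); apply: (app_sub p23); apply: (app_sub p02).
    case: (split_cond rP Ar) => q [t1 [Lq [Ut1 Ur]]]; case: (Ur) => qr [t1r Hr].
    have tt1 : subset t t1.
      by move=> z zt; case: (Hr z); [apply/p3r/tp3|move=> zq; case: (upper_sub Ut Lq zt zq)|].
    case: (V_pair Vxi (P_V (proj1 Lq))) => x [Vx Px].
    have xX : x ∈ X by apply/HX; exists xi, q; split=> //; split=> //; apply/HLo.
    (* The negative alternative is refuted by [r] itself, which extends the condition [p1] forcing
       [s] to be the element of index [xi]. *)
    case: (Dt x xX xi q Px) => [[q' [/HLo Lq' [qq [s' [sS' h]]]]]|N].
    * case: (merge Lq' Ut1) => r' [rP' [qr' [t1r' _]]]; exists r'; split=> //; split.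
        by move=> z /Hr [/qq /qr'|/t1r'].
      exists q'; split; first exact/HLo. by split=> //; exists s'.
    * case: (N t1 _ tt1 q _ _ s sS); [exact/HUp|exact/HLo|by []|].
      exists r; split=> //; split=> //; apply: (Fr_mono p1) => // z /p12 /p23 /p3r; by [].
  + move=> r [[rP rf] [_ [q' [/HLo Lq' [qr [s' [sS' h]]]]]]].
    case: (V_pair Vxi (P_V (proj1 Lq'))) => x [Vx Px].
    have xX : x ∈ X by apply/HX; exists xi, q'; split=> //; split=> //; apply/HLo.
    case: (bnd x s' xX sS'); first by exists xi, q'.
    move=> s2 [sS2 [rs2 [xi2 [q2 [Px2 h2]]]]]; case: (pair_inj Px Px2) => ? ?; subst xi2 q2.
    case: (low_of_lower Lq') => p [Lp [pq [Mp [Vp rp]]]].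
    have qf : subset q' f by move=> z /qr /rf.
    exists s2, p; split.
      apply/As; split; first exact/HSc. split=> //; split=> //; exists q'; split=> //; split=> //; by exists xi.
    split; first by split; [case: Lp|move=> z /pq /qf].
    have Vs2 := V_in VSd sS2; case: (f_ext Vs2) => z vz.
    have Qz : Q z xi.
    { apply/(Fr_truth s2 xi z Vs2 Vxi vz); case: h2 => r2 [rP2 [Ur2 F2]]; exists r2; split=> //; exact: (Gr q'). }
    by rewrite (H2 y' z xi xm Qy Qz).
Qed.

(** A bijection with a smaller ordinal would list [delta], giving it a name in [Sd]. But the values
    of names of rank below [delta] have rank below [delta]. *)
Lemma delta_cardinal : cardinal W delta.
Proof.
split=> // a ad [h [Wh [[fh [Dh Rh]] [inj sur]]]].
case: (name_step (y := delta) (m := a) (Q := fun y xi => app h xi y)) => //.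
- dsolve.
- by move=> y xi _ _; apply: Rh.
- by move=> y /sur [xi A]; exists xi; split=> //; apply/Dh; exists y.
- by move=> y1 y2 xi _ A A'; case: fh => _; apply; eassumption.
- move=> y yd; have Vy := V_in Vd yd; case: (chk_ex VP oP Vy) => s c; exists s; split; last exact: (chk_val VP oP Go0 c).
  by apply: (Sd_chk Vy _ c); apply: in_rank_ordinal => //; apply: ordinal_mem yd.
- move=> s [/HSd [_ [rs _]] v]; exact: (in_rank_irrefl (val_rank Od v rs)).
Qed.

(** The successor of [l] in the extension is at most [delta], which is still a cardinal there. So
    the transitive closure of [z] is listed in length below [delta], and [name_step] applies along
    membership. *)
Lemma hereditary_named lp z : is_succ_card W l lp -> hereditary W lp z -> exists s, s ∈ Sd /\ val G s z.
Proof.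
move=> [Wlp [[Olp _] [llp least]]] [Wz [c [Wc [[zc [Tc _]] [b [blp [h [Wh [[fh [Dh Rh]] [inj sur]]]]]]]]]].
have bd : b ∈ delta.
{ have Ob := ordinal_mem Olp blp; apply: NNPP => N.
  have dlp : delta ∈ lp.
    case: (ordinal_total Ob Od) => [//|[E|H]]; first by subst b. exact: ordinal_trans Olp blp H.
  case: (least delta (V_W VP Ho oP f Vd) delta_cardinal ld) => [E|H]; first by subst lp; case: (mem_irrefl dlp).
  exact: (mem_asym dlp H). }
have step y : W y -> subset y c -> (forall y', y' ∈ y -> exists s, s ∈ Sd /\ val G s y') -> exists s, s ∈ Sd /\ val G s y.
{ move=> Wy yc H; apply: (name_step (y := y) (m := b) (Q := fun y' xi => y' ∈ y /\ app h y' xi)) => //.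
  - dsolve.
  - by move=> y' xi _ _ [].
  - by move=> y' yy; case/Dh: (yc y' yy) => xi A; exists xi; split=> //; apply: Rh A.
  - by move=> y1 y2 xi _ [_ A1] [_ A2]; apply: inj A1 A2. }
have all y : y ∈ c -> exists s, s ∈ Sd /\ val G s y.
{ elim/(well_founded_ind (@mem_wf U)): y => y IH yc; apply: step; [exact: (W_trans Wc yc)|exact: Tc|].
  by move=> y' yy; apply: IH => //; apply: (Tc y). }
by apply: step => // y' /zc; apply: all.
Qed.

Definition code h a b s := exists v, app h a v /\ exists x w, is_pair v x w /\ is_pair x b s.

(* Cantor's diagonal argument: not all the codes of [((l, s), w)] with [w] contained in [l] lie below [l]. *)
Lemma code_ex h s : V h -> is_function h ->
  (forall d x, V d -> inaccessible V d -> subset d kappa -> V x -> in_rank x d -> exists a, a ∈ d /\ app h a x) ->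
  V s -> in_rank s delta -> exists a, legit g l a /\ code h a l s.
Proof.
move=> Vh [_ fh] enum Vs rs; have Ol := ordinal_mem Od ld.
case: (sep (x := l) (Q := fun xi => exists v, app h xi v /\ exists x w, is_pair v x w /\ is_pair x l s /\ ~ xi ∈ w)) => //.
  by dsolve.
move=> w0 [Vw0 Hw0].
have rl := in_rank_ordinal Ol ld; have rw0 : in_rank w0 delta by apply: (in_rank_sub rl) => z /Hw0 [].
case: (V_pair Vl Vs) => x0 [Vx0 Px0]; case: (V_pair Vx0 Vw0) => v0 [Vv0 Pv0].
have rx0 := in_rank_pair Vd Id Vl Vs rl rs Px0; have rv0 := in_rank_pair Vd Id Vx0 Vw0 rx0 rw0 Pv0.
case: (enum delta v0) => // a [ad A]; exists a; split; last by exists v0; split=> //; exists x0, w0.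
have Oa := ordinal_mem Od ad.
have Na : ~ a ∈ l.
{ move=> al; have K : a ∈ w0 <-> ~ a ∈ w0.
  { split=> [/Hw0 [_ [v [A' [x [w [Pv [Px N]]]]]]]|N].
    - by rewrite (fh _ _ _ A' A) in Pv; case: (pair_inj Pv Pv0) => _ <-.
    - by apply/Hw0; split=> //; exists v0; split=> //; exists x0, w0. }
  tauto. }
split=> //; split; first exact: dk.
(* An inaccessible above [g] and [l] contains [delta] and therefore [a]; conversely, [a] is not
   below [l]. *)
move=> d dI gd'; split=> [ld'|ad']; first exact: dleast dI gd' ld' a ad.
have Od' : ordinal d by case/HII: dI => _ /inacc_ordinal.
case: (ordinal_total Ol Oa) => [H|[-> //|//]]; exact: ordinal_trans Od' ad' H.
Qed.

End Naming.

Lemma md_ex f g l a : generic V P f -> extension_exists V P f -> app f g l -> legit g l a ->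
  exists f', extension V P f f' /\ md f f' g l a.
Proof.
move=> Gf Ef A L; have oP : o ∈ P by case: Gf => [[p [pP _]] _]; apply: P_o pP.
have [gk [lk _]] := generic_dom Gf A; have ak : a ∈ kappa by case: L => _ [].
have Wk := V_W VP Ho oP f Vk; have Wf := W_f VP Ho oP Gf.
case: (W_prod VP Ho oP Gf Ef Wk Wk) => K [WK HK].
have VW x : x ∈ kappa -> extension V P f x by move=> xk; apply: (W_trans Wk xk).
have Wg := VW g gk; have Wl := VW l lk; have Wa := VW a ak.
case: (W_sep (VP := VP) (Ho := Ho) (oP := oP) Gf Ef (Q := fun x => (x ∈ f /\ ~ is_pair x g l) \/ is_pair x g a) WK).
  by dsolve.
move=> f' [Wf' Hf']; exists f'; split=> //; split; first exact: generic_fun Gf.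
split=> //; split.
  case: (W_pair VP Ho oP Ef Wg Wa) => x [Wx Px]; exists x; split=> //; apply/Hf'; split; last by right.
  by apply/HK; exists g, a.
split=> x; first by move=> /Hf' [].
move=> xf; case: (classic (is_pair x g l)) => [|N]; [by left|right; apply/Hf'; split; last by left].
case: (generic_fun Gf) => /(_ x xf) [c [d Px]] _; apply/HK; exists c, d.
by have [? [? _]] : c ∈ kappa /\ d ∈ kappa /\ inaccessible V c by apply: (generic_dom Gf); exists x.
Qed.

(** The name [s] is chosen for [f], before [a] and [f']. Since it is good, its value is the same at
    [f'], although [f'] is built from a code of [s]. *)
Lemma naming h f g l lp z : V h -> is_function h ->
  (forall d x, V d -> inaccessible V d -> subset d kappa -> V x -> in_rank x d -> exists a, a ∈ d /\ app h a x) ->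
  generic V P f -> extension_exists V P f -> app f g l ->
  is_succ_card (extension V P f) l lp -> hereditary (extension V P f) lp z ->
  exists a f' s, extension V P f f' /\ legit g l a /\ md f f' g l a /\ code h a l s /\ V s /\ val (filter_of P f') s z.
Proof.
move=> Vh fh enum Gf Ef A Hl Hz.
case: (delta_ex Gf A) => d [Vd [Id [dk [gd [ld least]]]]].
case: (Sd_ex Gf A Vd) => Sd [VSd HSd].
case: (hereditary_named Gf Ef A Vd Id dk gd ld least VSd HSd Hl Hz) => s [sS v].
case/HSd: (sS) => Vs [rs gs].
case: (code_ex Gf A Vd Id dk ld least Vh fh enum Vs rs) => a [L C].
case: (md_ex Gf Ef A L) => f' [Wf' M]; exists a, f', s; do 5 (split=> //).
apply: (good_val (f := f) (g := g) (s := s)) => // p [pP Dp]; case: M => [_ [_ [_ [M1 M2]]]].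
split=> pf x xp; case: (P_pair pP xp) => c [e Px]; have cg : c ∈ g by [apply: (Dp c e); exists x].
- case: (M2 x (pf x xp)) => // Px'; case: (pair_inj Px Px') => E _; subst c; by case: (mem_irrefl cg).
- case: (M1 x (pf x xp)) => [[]//|Px']; case: (pair_inj Px Px') => E _; subst c; by case: (mem_irrefl cg).
Qed.

(** ** The Laver function *)

(** A name for the value of whichever name is coded by [f(g)]: the condition [p] has to decide the
    code and to extend the condition [q] that accompanies [t] in the coded name. *)
Definition lgam h g n := forall u, V u -> (u ∈ n <-> exists t p, is_pair u t p /\ p ∈ P /\
  exists a, app p g a /\ exists b, V b /\ exists s, V s /\ code h a b s /\ exists q, app s t q /\ q ∈ P /\ subset q p).

Lemma lgam_ex h g : V h -> V g -> exists n, V n /\ lgam h g n.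
Proof.
move=> Vh Vg; have VP' := VP; case: (V_trans_ex Vh) => T [VT [TT hT]]; case: (V_prod VT VP) => TP [VTP HTP].
case: (sep (x := TP) (Q := fun u => exists t p, is_pair u t p /\ p ∈ P /\
  exists a, app p g a /\ exists b, V b /\ exists s, V s /\ code h a b s /\ exists q, app s t q /\ q ∈ P /\ subset q p)) => //.
  by rewrite /code; dsolve.
move=> n [Vn Hn]; exists n; split=> // u Vu; rewrite Hn; split=> [[]//|H]; split=> //.
case: H => t [p [Pu [pP [a [_ [b [_ [s [_ [[v [[x [xh Px]] [y [w [Pv Py]]]]] [q [[z [zs Pz]] _]]]]]]]]]]]].
have up c d : d ∈ T -> c ∈ d -> c ∈ T by move=> dT; apply: TT.
have fst c d e : c ∈ T -> is_pair c d e -> d ∈ T /\ e ∈ T.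
{ move=> cT Pc; case: (pair_fst_mem Pc) => k [kc dk]; case: (pair_snd_mem Pc) => k' [kc' ek].
  by split; [exact: (up _ _ (up _ _ cT kc) dk)|exact: (up _ _ (up _ _ cT kc') ek)]. }
case: (fst _ _ _ (up _ _ hT xh) Px) => _ vT; case: (fst _ _ _ vT Pv) => yT _; case: (fst _ _ _ yT Py) => _ sT.
case: (fst _ _ _ (up _ _ sT zs) Pz) => tT _; apply/HTP; by exists t, p.
Qed.

Lemma lgam_unique h g n n' : V n -> V n' -> lgam h g n -> lgam h g n' -> n = n'.
Proof.
move=> Vn Vn' H H'; apply: mem_ext => u; split=> K.
- by apply/H'; [apply: V_in K|apply/H => //; apply: V_in K].
- by apply/H; [apply: V_in K|apply/H' => //; apply: V_in K].
Qed.

Lemma d_lgam t1 t2 t3 : tm (F := FV) t1 -> tm (F := FV) t2 -> tm (F := FV) t3 ->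
  dfn (F := FV) (fun i e => lgam (t1 i e) (t2 i e) (t3 i e)).
Proof. have VP' := VP; move=> H1 H2 H3; rewrite /lgam /code; dsolve. Qed.

Lemma lgam_app h g n t p : V n -> lgam h g n -> (app n t p <-> V t /\ p ∈ P /\
  exists a, app p g a /\ exists b s, V b /\ V s /\ code h a b s /\ exists q, app s t q /\ q ∈ P /\ subset q p).
Proof.
move=> Vn H; split=> [[u [un Pu]]|[Vt [pP [a [A [b [s [Vb [Vs K]]]]]]]]].
- have Vu := V_in Vn un; case/(H u Vu): un => t' [p' [Pu' [pP [a [A [b [Vb [s [Vs K]]]]]]]]].
  case: (pair_inj Pu Pu') => ? ?; subst t' p'; split; first by case: (pair_in V_trans Vu Pu).
  split=> //; exists a; split=> //; by exists b, s.
- case: (V_pair Vt (P_V pP)) => u [Vu Pu]; exists u; split=> //; apply/H => //; exists t, p; split=> //; split=> //.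
  by exists a; split=> //; exists b; split=> //; exists s.
Qed.

Lemma code_fun h a b b' s s' : is_function h -> code h a b s -> code h a b' s' -> b = b' /\ s = s'.
Proof.
move=> [_ fh] [v [A [x [w [Pv Px]]]]] [v' [A' [x' [w' [Pv' Px']]]]]; rewrite (fh _ _ _ A' A) in Pv'.
by case: (pair_inj Pv' Pv) => ? _; subst x'; case: (pair_inj Px Px').
Qed.

Lemma lgam_val h g n f x : is_function h -> generic V P f -> V n -> lgam h g n -> val (filter_of P f) n x ->
  (forall a b s x', app f g a -> code h a b s -> V b -> V s -> val (filter_of P f) s x' -> x = x') /\
  ((forall a b s, V b -> V s -> app f g a -> ~ code h a b s) -> forall y, ~ y ∈ x).
Proof.
move=> fh Gf Vn Hn /val_iff [X1 X2]; have [_ ff] := generic_fun Gf; split; last first.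
  move=> N y /X2 [t [p [/(lgam_app _ _ Vn Hn) [_ [pP [a [A [b [s [Vb [Vs [C _]]]]]]]]] [[_ pf] _]]]].
  exact: (N a b s Vb Vs (app_sub pf A)).
move=> a b s x' A C Vb Vs /val_iff [Y1 Y2]; apply: mem_ext => y; split.
- move=> /X2 [t [p [/(lgam_app _ _ Vn Hn) [_ [pP [a' [A' [b' [s' [Vb' [Vs' [C' [q [Aq [qP qp]]]]]]]]]]]] [[_ pf] v]]]].
  have E := ff _ _ _ A (app_sub pf A'); subst a'; case: (code_fun fh C C') => ? ?; subst b' s'.
  case: (Y1 t q Aq); first by split=> // z /qp /pf.
  by move=> y' [yx v']; rewrite (val_fun v v').
- move=> /Y2 [t [q [Aq [Gq v]]]]; case: (Gf) => _ [D [_ Hf]]; case: A => z [/Hf [p0 [Gp0 zp]] Pz].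
  case: (D q p0 Gq Gp0) => p [Gp [qp p0p]]; case: (X1 t p) => //.
    apply/(lgam_app _ _ Vn Hn); split; first by case: (app_in V_trans Vs Aq). split; first by case: Gp.
    exists a; split; first by exists z; split=> //; apply: p0p.
    by exists b, s; do 3 (split=> //); exists q; do 2 (split=> //); case: Gq.
  by move=> y' [yx v']; rewrite (val_fun v v').
Qed.

(** One name serves for all generics. So the function computed from a modification is the value of
    the same name there, and the value of [j nd] at the modified [j(f)] is the image of the function
    under the new embedding. *)
Lemma laver h : V h -> is_function h -> (forall a y, app h a y -> a ∈ kappa /\ in_rank y kappa) -> o ∈ P ->
  exists n, V n /\ forall f, generic V P f -> forall L, val (filter_of P f) n L ->
    extension_exists V P f ->
    maps L kappa (fun x => extension V P f x /\ in_rank x kappa) /\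
    forall g a b s x, app f g a -> code h a b s -> V b -> V s -> val (filter_of P f) s x -> app L g x.
Proof.
move=> Vh fh Hh oP; have VP' := VP.
pose lname g m := exists c, V c /\ chk o g c /\ exists k, V k /\ lgam h g k /\ opn o c k m.
have dln t1 t2 : tm (F := FV) t1 -> tm (F := FV) t2 -> dfn (F := FV) (fun i e => lname (t1 i e) (t2 i e)).
{ move=> H1 H2; apply: d_ex; apply: d_and; first by apply: (d_chk VP oP); tm_solve.
  apply: d_ex; apply: d_and; first by apply: d_lgam; tm_solve. by apply: (d_opn VP oP); tm_solve. }
case: (collection (x := kappa) (Q := lname)) => //; first by apply: dln; tm_solve.
move=> M0 [VM0 [_ HM0]].
case: (sep (x := M0) (Q := fun m => exists g, g ∈ kappa /\ lname g m)) => //.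
  by apply: d_bex; [tm_solve|apply: dln; tm_solve].
move=> M [VM HM]; case: (setn_ex VP oP VM) => n [Vn Hn]; exists n; split=> // f Gf L vL Ef.
have Go0 : filter_of P f o by split=> // z /Ho.
case: (setn_val VP oP Go0 VM Vn Hn vL) => HL _.
have AL g x : app L g x <-> g ∈ kappa /\ exists k, V k /\ lgam h g k /\ val (filter_of P f) k x.
{ split=> [[u [/HL [m [/HM [mM0 [g' [gk [c [Vc [cg [k [Vk' [Hk Om]]]]]]]]] vm]] Pu]]|[gk [k [Vk' [Hk vk]]]]].
  - have Vm := V_in VM0 mM0; case: (Ef k Vk') => x' vk.
    have Pu' := opn_val VP oP Go0 Vc Vk' Vm Om (chk_val VP oP Go0 cg) vk vm.
    case: (pair_inj Pu Pu') => ? ?; subst g' x'; split=> //; by exists k.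
  - have Vg := V_in Vk gk; case: (chk_ex VP oP Vg) => c cg; have [_ Vc] := chk_in VP oP cg.
    case: (opn_ex VP oP Vc Vk') => m0 [Vm0 Om0]; case: (HM0 g m0) => //; first by exists c; do 2 (split=> //); exists k.
    move=> m [mM0 Lm]; have Vm := V_in VM0 mM0; case: (Lm) => c' [Vc' [cg' [k' [Vk'' [Hk' Om]]]]].
    rewrite -(lgam_unique Vk' Vk'' Hk Hk') in Om; case: (Ef m Vm) => u vm; exists u; split.
      by apply/HL; exists m; split=> //; apply/HM; split=> //; exists g.
    exact: (opn_val VP oP Go0 Vc' Vk' Vm Om (chk_val VP oP Go0 cg') vk vm). }
split; last first.
  move=> g a b s x A C Vb Vs v; have [gk _] := generic_dom Gf A; apply/AL; split=> //.
  case: (lgam_ex Vh (V_in Vk gk)) => k [Vk' Hk]; exists k; split=> //; split=> //; case: (Ef k Vk') => x' vk.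
  by case: (lgam_val fh Gf Vk' Hk vk) => K _; rewrite -(K a b s x).
split; first split.
- move=> u /HL [m [/HM [mM0 [g' [gk [c [Vc [cg [k [Vk' [Hk Om]]]]]]]]] vm]].
  have Vm := V_in VM0 mM0; case: (Ef k Vk') => x' vk; exists g', x'.
  exact: (opn_val VP oP Go0 Vc Vk' Vm Om (chk_val VP oP Go0 cg) vk vm).
- move=> g x x' /AL [_ [k [Vk1 [Hk vk]]]] /AL [_ [k' [Vk2 [Hk' vk']]]].
  rewrite -(lgam_unique Vk1 Vk2 Hk Hk') in vk'; exact: val_fun vk vk'.
- split.
    move=> g; split=> [gk|[x /AL []//]]; case: (lgam_ex Vh (V_in Vk gk)) => k [Vk' Hk]; case: (Ef k Vk') => x vk.
    by exists x; apply/AL; split=> //; exists k.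
  move=> g x /AL [gk [k [Vk' [Hk vk]]]]; split; first by exists k.
  case: (lgam_val fh Gf Vk' Hk vk) => K1 K2; have T : transitive_set kappa by case: Ok.
  (* Values of [h] have rank below [kappa], hence so do the coded name and its value. If nothing is
     coded, the value is the empty set. *)
  case: (classic (exists a b s, V b /\ V s /\ app f g a /\ code h a b s)) => [[a [b [s [Vb [Vs [A C]]]]]]|N].
  + case: (Ef s Vs) => x' v; rewrite (K1 a b s x' A C Vb Vs v); apply: (val_rank Ok v).
    case: C => v0 [A0 [y [w [Pv Py]]]]; case: (Hh _ _ A0) => _ r0.
    case: (pair_fst_mem Pv) => d [dv yd]; case: (pair_snd_mem Py) => e [ey se].
    exact: (in_rank_mem T (in_rank_mem T (in_rank_mem T (in_rank_mem T r0 dv) yd) ey) se).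
  + apply: in_rank_ordinal; last apply: (inacc_zero Ik).
    * split=> y yx; case: (K2 _ y yx) => a b s Vb Vs A C; apply: N; by exists a, b, s.
    * move=> y yx; case: (K2 _ y yx) => a b s Vb Vs A C; apply: N; by exists a, b, s.
Qed.

(** By regularity. When [kappa] is the critical point of [j], it follows that the domain of [j p] is
    still bounded below [kappa]. *)
Lemma P_bounded p : p ∈ P -> exists xi, xi ∈ kappa /\ forall a b, app p a b -> a ∈ xi.
Proof.
move=> pP; case: (small_bound Vk Ik (Q := fun y a => exists a' b, is_pair y a' b /\ a' = a) (P_small pP)).
- dsolve.
- by move=> y a a' _ _ [a1 [b [Py ?]]] [a2 [b' [Py' ?]]]; subst a1 a2; case: (pair_inj Py Py').
- move=> c [ck H]; exists c; split=> // a b A; case: (A) => y [yp Py]; apply: (H y) => //; last by exists a, b.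
  by case: (P_dom pP A).
Qed.

(** * Facts about all modifications in transferable form *)

Section Mods.
Context (f : U) (Gf : generic V P f) (Ef : extension_exists V P f).
Local Notation W := (extension V P f).

Lemma oP_gen : o ∈ P.
Proof. by case: Gf => [[p [pP _]] _]; apply: P_o pP. Qed.
Let oP := oP_gen.

(** The valuation at [f'] is witnessed by a set of the common extension and can thus be expressed by
    a formula. *)
Lemma mod_val g l a f' s x : legit g l a -> md f f' g l a -> V s -> val (filter_of P f') s x ->
  exists R, W R /\ valrel R P f' /\ app R s x.
Proof.
move=> L M Vs v; case: (V_trans_ex Vs) => S [VS [TS sS]].
case: (W_valset VP Ho oP (extension_exists_md Gf Ef L M) VS TS) => R [WR [vR HR]].
by rewrite (extension_md Gf Ef L M) in WR; exists R; split=> //; split=> //; apply/HR.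
Qed.

Lemma mod_total g l a f' s : legit g l a -> md f f' g l a -> V s ->
  exists x, W x /\ val (filter_of P f') s x.
Proof.
move=> L M Vs; case: (extension_exists_md Gf Ef L M Vs) => x v; exists x; split=> //.
by rewrite -(extension_md Gf Ef L M); exists s.
Qed.

Lemma mod_check x : V x -> exists c, V c /\ forall f', val (filter_of P f') c x.
Proof.
move=> Vx; case: (chk_ex VP oP Vx) => c cx; exists c; split; first by case: (chk_in VP oP cx).
by move=> f'; apply: (chk_val VP oP _ cx); split=> // z /Ho.
Qed.

Lemma mod_generic : exists fd, V fd /\ forall f', generic V P f' -> val (filter_of P f') fd f'.
Proof.
case: (fdot_ex VP oP) => fd [Vfd Hfd]; exists fd; split=> // f' [ex [_ [_ Hf]]].
exact: (fdot_val VP Ho oP Vfd Hfd ex Hf).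
Qed.

Lemma mod_bound B : V B -> exists B', V B' /\ forall g l a f', legit g l a -> md f f' g l a ->
  forall s, s ∈ B -> exists s' x, s' ∈ B' /\ W x /\ val (filter_of P f) s x /\ val (filter_of P f') s' x.
Proof.
move=> VB; case: (tr_bound VB) => B' [VB' [_ H]]; exists B'; split=> // g l a f' L M s sB.
have gk : g ∈ kappa by case: M => _ [A _]; case: (generic_dom Gf A).
case: (H f' f g a l (legit_sym L) (md_sym M) gk s sB) => s' [sB' E].
case: (Ef (V_in VB sB)) => x v; exists s', x; split=> //; split; first by exists s; split=> //; apply: V_in sB.
by split=> //; apply/E.
Qed.

Lemma mod_naming h nd lam lp g z : V h -> is_function h ->
  (forall d x, V d -> inaccessible V d -> subset d kappa -> V x -> in_rank x d -> exists a, a ∈ d /\ app h a x) ->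
  V nd -> (forall f, generic V P f -> forall L, val (filter_of P f) nd L -> extension_exists V P f ->
    maps L kappa (fun x => extension V P f x /\ in_rank x kappa) /\
    forall g a b s x, app f g a -> code h a b s -> V b -> V s -> val (filter_of P f) s x -> app L g x) ->
  app f g lam -> is_succ_card W lam lp -> hereditary W lp z ->
  exists a f' s R L, W a /\ W f' /\ W s /\ W R /\ W L /\ legit g lam a /\ md f f' g lam a /\ code h a lam s /\
    valrel R P f' /\ app R nd L /\ app L g z.
Proof.
move=> Vh fh enum Vnd Hnd A Hl Hz.
case: (naming Vh fh enum Gf Ef A Hl Hz) => a [f' [s [Wf' [L [M [C [Vs v]]]]]]].
case: (mod_total L M Vnd) => ell [Well vell]; case: (mod_val L M Vnd vell) => R [WR [vR AR]].
have VW x : V x -> W x by apply: (V_W VP Ho oP f).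
exists a, f', s, R, ell; split; first by apply/VW; case: L => _ [ak _]; apply: V_in Vk ak.
do 2 (split; [by [|apply: VW]|]); do 2 (split=> //); do 3 (split=> //); split=> //; split=> //.
case: (Hnd f' (generic_md Gf L M) ell vell (extension_exists_md Gf Ef L M)) => _; apply; [|exact: C| |exact: Vs|exact: v].
- by case: M => _ [_ []].
- by case: L => lk _; apply: V_in Vk lk.
Qed.

End Mods.

(** * The modified embedding *)

Section Embedding.
Context (f : U) (Gf : generic V P f) (Ef : extension_exists V P f).
Local Notation W := (extension V P f).
Local Notation G := (filter_of P f).
Context (j : U -> U).
Local Notation M := (image_class V j).
Local Notation N := (extension M (j P) (j f)).
Context (TN : transitive_class N) (El : elementary W N j) (Cr : critical_point W j kappa).

Let oP := oP_gen Gf.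
Local Notation F2 := (frame2 (@W_trans P f) TN (W_ne VP Ho oP f) (proj1 El)).
Local Notation CC := (cl F2).

Hint Resolve par_pick_intro : dpar.

Lemma V_W' x : V x -> W x.
Proof. exact: (V_W VP Ho oP f). Qed.

Let Wk := V_W' Vk.
Let WP := V_W' VP.
Let WII := V_W' VII.
Let Wf : W f := W_f VP Ho oP Gf.

Lemma j_in x : W x -> N (j x).
Proof. exact: (proj1 El). Qed.

Lemma j_sub x y : W x -> W y -> subset x y -> subset (j x) (j y).
Proof.
move=> Wx Wy S.
have T := transfer (TW := @W_trans P f) (TN := TN) (ne := W_ne VP Ho oP f) (El := El)
  (Q := fun i => subset (pick j x i) (pick j y i)).
by apply: (proj1 (T _) S); dsolve.
Qed.

Lemma M_intro B x : V B -> x ∈ j B -> M x.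
Proof.
move=> VB xB; case: (V_rank VB) => al [Val [Oal rB]]; case: (V_level Val) => v [Vv Hv]; exists al, v.
do 4 (split=> //); apply: (j_sub (V_W' VB) (V_W' Vv)) xB => y yB; apply/Hv; split; first exact: V_in yB.
by case: Oal => T _; apply: in_rank_mem T rB yB.
Qed.

Lemma M_elim x : M x -> exists v, V v /\ transitive_set v /\ x ∈ j v.
Proof.
move=> [al [v [Val [Oal [Vv [Hv xv]]]]]]; exists v; split=> //; split=> // y /Hv [Vy ry] z zy; apply/Hv.
split; first exact: V_in zy. by case: Oal => T _; apply: in_rank_mem T ry zy.
Qed.

(** * The embedding given by a modification of [j(f)] *)

Section Star.
Context (lam al fs : U) (Nal : N al) (Nfs : N fs) (Alam : app (j f) kappa lam).
Context (Lst : legit_in (j kappa) (j II) kappa lam al) (Mst : md (j f) fs kappa lam al).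
Local Notation Gs := (filter_of (j P) fs).

(** Since [kappa] is not in the range of [j], nothing about [fs] can be transferred directly. A
    property of all modifications of [f] holds in the target for all modifications of [j(f)], and
    [fs] is one of them. *)
Lemma star (Q : bool -> U -> Prop) : dfn (F := F2) (fun i e => Q i (e 0)) ->
  (forall g l a f', W f' -> legit g l a -> md f f' g l a -> Q true f') -> Q false fs.
Proof.
move=> dQ H.
have T := transfer (TW := @W_trans P f) (TN := TN) (ne := W_ne VP Ho oP f) (El := El)
  (Q := fun i => forall g, CC i g -> forall l, CC i l -> forall a, CC i a -> forall f', CC i f' ->
    legit_in (pick j kappa i) (pick j II i) g l a -> md (pick j f i) f' g l a -> Q i f').
have [Nk Nl] := app_in TN (j_in Wf) Alam; refine (proj1 (T _) _ kappa Nk lam Nl al Nal fs Nfs Lst Mst).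
- rewrite /legit_in /md; do 4 (apply d_all); cbv beta.
  by apply d_imp; [dsolve|apply d_imp; [dsolve|exact dQ]].
- by move=> g _ l _ a _ f' Wf' L M'; apply: (H g l a).
Qed.

Lemma star_valrel s : V s -> exists y, N y /\ exists R, N R /\ valrel R (j P) fs /\ app R (j s) y.
Proof.
move=> Vs; have Ws := V_W' Vs.
case: (star (Q := fun i f' => exists R, CC i R /\ exists x, CC i x /\ valrel R (pick j P i) f' /\ app R (pick j s i) x)).
- by rewrite /valrel; dsolve.
- move=> g l a f' Wf' L M'; case: (mod_total Gf Ef L M' Vs) => x [Wx v].
  by case: (mod_val Gf Ef L M' Vs v) => R [WR [vR A]]; exists R; split=> //; exists x.
- by move=> R [NR [x [Nx [vR A]]]]; exists x; split=> //; exists R.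
Qed.

Lemma star_val s : V s -> exists y, N y /\ val Gs (j s) y.
Proof.
by move=> /star_valrel [y [Ny [R [_ [vR A]]]]]; exists y; split=> //; apply: valrel_sound vR A.
Qed.

Lemma star_check x : V x -> exists c, V c /\ val G c x /\ val Gs (j c) (j x).
Proof.
move=> Vx; have Wx := V_W' Vx; case: (mod_check Gf Vx) => c [Vc vc]; have Wc := V_W' Vc.
exists c; split=> //; split=> //.
case: (star (Q := fun i f' => exists R, CC i R /\ valrel R (pick j P i) f' /\ app R (pick j c i) (pick j x i))).
- by rewrite /valrel; dsolve.
- move=> g l a f' Wf' L M'; case: (mod_val Gf Ef L M' Vc (vc f')) => R [WR [vR A]]; by exists R.
- by move=> R [NR [vR A]]; apply: valrel_sound vR A.
Qed.

Lemma star_generic_name : exists fd, V fd /\ val G fd f /\ val Gs (j fd) fs.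
Proof.
case: (mod_generic Gf) => fd [Vfd Hfd]; have Wfd := V_W' Vfd; exists fd; split=> //; split; first exact: Hfd.
case: (star (Q := fun i f' => exists R, CC i R /\ valrel R (pick j P i) f' /\ app R (pick j fd i) f')).
- by rewrite /valrel; dsolve.
- move=> g l a f' Wf' L M'; have Gf' := generic_md Gf L M'.
  case: (mod_val Gf Ef L M' Vfd (Hfd f' Gf')) => R [WR [vR A]]; by exists R.
- by move=> R [NR [vR A]]; apply: valrel_sound vR A.
Qed.

(** A dense set of [M] belongs to [j v] for some [v] in [V]. Restricted to the dense sets in [v],
    genericity is expressible by a formula. *)
Lemma star_generic : generic M (j P) fs.
Proof.
have dense_met D : M D -> dense (j P) D -> exists p, p ∈ D /\ Gs p.
{ move=> MD dD; case: (M_elim MD) => v [Vv [_ Dv]]; have Wv := V_W' Vv.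
  suff K : forall D, D ∈ pick j v false -> subset D (pick j P false) ->
    (forall p, p ∈ pick j P false -> exists d, d ∈ D /\ subset p d) ->
    exists p, p ∈ D /\ p ∈ pick j P false /\ subset p fs.
  { by case: dD => D1 D2; case: (K D Dv D1 D2) => p [pD [pP pf]]; exists p. }
  apply: (star (Q := fun i f' => forall D, D ∈ pick j v i -> subset D (pick j P i) ->
    (forall p, p ∈ pick j P i -> exists d, d ∈ D /\ subset p d) ->
    exists p, p ∈ D /\ p ∈ pick j P i /\ subset p f')); first by dsolve.
  move=> g l a f' Wf' L M' D0 D0v D1 D2; case: (generic_md Gf L M') => _ [_ [K _]].
  by case: (K D0 (V_in Vv D0v) (conj D1 D2)) => p [pD [pP pf]]; exists p. }
have K : (exists p, p ∈ pick j P false /\ subset p fs) /\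
  (forall p, p ∈ pick j P false -> subset p fs -> forall q, q ∈ pick j P false -> subset q fs ->
    exists r, r ∈ pick j P false /\ subset r fs /\ subset p r /\ subset q r) /\
  (forall x, x ∈ fs -> exists p, p ∈ pick j P false /\ subset p fs /\ x ∈ p).
{ apply: (star (Q := fun i f' => (exists p, p ∈ pick j P i /\ subset p f') /\
  (forall p, p ∈ pick j P i -> subset p f' -> forall q, q ∈ pick j P i -> subset q f' ->
    exists r, r ∈ pick j P i /\ subset r f' /\ subset p r /\ subset q r) /\
  (forall x, x ∈ f' -> exists p, p ∈ pick j P i /\ subset p f' /\ x ∈ p))); first by dsolve.
  move=> g l a f' Wf' L M'; case: (generic_md Gf L M') => K1 [K2 [_ K3]]; split; first by case: K1 => p; exists p.
  split=> [p pP pf q qP qf|x /K3 [p [[pP pf] xp]]]; last by exists p.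
  by case: (K2 p q (conj pP pf) (conj qP qf)) => r [[rP rf] H]; exists r. }
case: K => [[p [pP pf]] [K2 K3]]; split; first by exists p.
split.
  by move=> p1 p2 [pP1 pf1] [pP2 pf2]; case: (K2 p1 pP1 pf1 p2 pP2 pf2) => r [rP [rf H]]; exists r.
split=> // x; split=> [/K3 [p1 [pP1 [pf1 xp]]]|[p1 [[_ pf1] xp]]]; [by exists p1|exact: pf1].
Qed.

(** Names in [M] are bounded by [j B] with [B] in [V]. One inclusion is the totality of the
    valuation at [fs]; the other uses the uniform bound on translated names. *)
Lemma star_extension : extension M (j P) fs = N.
Proof.
apply: functional_extensionality => x; apply: propositional_extensionality; split=> [[s [Ms v]]|[s [Ms v]]];
  case: (M_elim Ms) => B [VB [TB sB]]; have WB := V_W' VB.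
- have K : forall s, s ∈ pick j B false -> exists x, CC false x /\ exists R, CC false R /\
    valrel R (pick j P false) fs /\ app R s x.
  { apply: (star (Q := fun i f' => forall s, s ∈ pick j B i -> exists x, CC i x /\ exists R, CC i R /\
      valrel R (pick j P i) f' /\ app R s x)); first by rewrite /valrel; dsolve.
    move=> g l a f' Wf' L M' s0 sB0; have Vs0 := V_in VB sB0; case: (mod_total Gf Ef L M' Vs0) => y [Wy vy].
    by case: (mod_val Gf Ef L M' Vs0 vy) => R [WR [vR A]]; exists y; split=> //; exists R. }
  by case: (K s sB) => y [Ny [R [NR [vR A]]]]; rewrite (val_fun v (valrel_sound vR A)).
- case: (mod_bound Gf Ef VB) => B' [VB' HB']; have WB' := V_W' VB'.
  case: (W_valset VP Ho oP Ef VB TB) => RB [WRB [vRB HRB]].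
  have K : forall s, s ∈ pick j B false -> exists s', s' ∈ pick j B' false /\ exists x, CC false x /\
    app (pick j RB false) s x /\ exists R, CC false R /\ valrel R (pick j P false) fs /\ app R s' x.
  { apply: (star (Q := fun i f' => forall s, s ∈ pick j B i -> exists s', s' ∈ pick j B' i /\ exists x, CC i x /\
      app (pick j RB i) s x /\ exists R, CC i R /\ valrel R (pick j P i) f' /\ app R s' x)).
      by rewrite /valrel; dsolve.
    move=> g l a f' Wf' L M' s0 sB0; case: (HB' g l a f' L M' s0 sB0) => s' [y [sB' [Wy [vy vy']]]].
    exists s'; split=> //; exists y; split=> //; split; first exact/HRB.
    by case: (mod_val Gf Ef L M' (V_in VB' sB') vy') => R [WR [vR A]]; exists R. }
  have vRBj : valrel (pick j RB false) (pick j P false) (pick j f false).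
  { have T := transfer (TW := @W_trans P f) (TN := TN) (ne := W_ne VP Ho oP f) (El := El)
      (Q := fun i => valrel (pick j RB i) (pick j P i) (pick j f i)).
    by apply: (proj1 (T _) vRB); rewrite /valrel; dsolve. }
  case: (K s sB) => s' [sB' [y [Ny [A [R [NR [vR A']]]]]]]; exists s'; split; first exact: M_intro VB' sB'.
  by rewrite (val_fun v (valrel_sound vRBj A)); apply: valrel_sound vR A'.
Qed.

(** A true formula is forced by some [p] and so holds of the values at every modification containing
    [p]. Quantified over the values of the finitely many names involved, this transfers to [fs],
    provided that [fs] contains [j p]. *)
Lemma star_sat phi (e x y : nat -> U) : (forall n, V (e n)) -> (forall n, val G (e n) (x n)) ->
  (forall n, val Gs (j (e n)) (y n)) -> sat W x phi -> sat N y phi.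
Proof.
move=> Ve vx vy; have We n := V_W' (Ve n); case/(sat_md Gf Ef Ve vx) => p [[pP pf] Hp].
have Vp := P_V pP; have Wp := V_W' Vp; case: (P_bounded pP) => xi [xik Hxi]; have Wxi := W_trans Wk xik.
pose val2 i f' k z := exists R, CC i R /\ valrel R (pick j P i) f' /\ app R (pick j (e k) i) z.
have dval2 (t1 t2 : ix F2 -> (nat -> U) -> U) k : tm t1 -> tm t2 -> dfn (F := F2) (fun i e => val2 i (t1 i e) k (t2 i e)).
{ by move=> H1 H2; have Wek := We k; rewrite /val2 /valrel; dsolve. }
have K : subset (pick j p false) fs -> alln (CC false) (val2 false fs) phi (fbound phi) (fun _ => pick j P false).
{ apply: (star (Q := fun i f' => subset (pick j p i) f' -> alln (CC i) (val2 i f') phi (fbound phi) (fun _ => pick j P i))).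
  - apply d_imp; first by dsolve.
    apply: (@d_alln U F2 (fun i e k z => val2 i (e 0) k z) phi (fbound phi) (fun m => m) (fun _ i _ => pick j P i)).
    + by move=> n; tm_solve.
    + move=> n r; apply: dval2; tm_solve.
  - move=> g l a f' Wf' L M' pf'; apply: alln_intro => x' Hx'.
    (* Variables beyond the bound of [phi] receive the values of their names. *)
    have /choice [x2 Hx2] : forall n, exists z, val (filter_of P f') (e n) z /\ (n < fbound phi -> z = x' n).
    { move=> n; case: (classic (n < fbound phi)) => [lt|ge].
      - by exists (x' n); split=> //; case: (Hx' n lt) => _ [R [_ [vR A]]]; apply: valrel_sound vR A.
      - by case: (mod_total Gf Ef L M' (Ve n)) => z [_ v]; exists z. }
    have S : sat W x2 phi by apply: (Hp f' g l a) => // n; case: (Hx2 n).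
    apply: (proj1 (sat_bound _ _) S) => n lt; case: (Nat.ltb_spec n (fbound phi)) => [_|]; last lia.
    by case: (Hx2 n) => _ ->. }
have {}K : alln N (val2 false fs) phi (fbound phi) (fun _ => j P).
(* An element of [j p] lies in [j f], and it can be missing from [fs] only if it is the pair of
   [kappa] and [lam]. Then [kappa] would belong to [j xi], which is [xi]. *)
{ apply: K => z zp; have zf := j_sub Wp Wf pf zp; case: Mst => _ [_ [_ [_ H]]]; case: (H z zf) => // Pz.
  have T := transfer (TW := @W_trans P f) (TN := TN) (ne := W_ne VP Ho oP f) (El := El)
    (Q := fun i => forall a b, app (pick j p i) a b -> a ∈ pick j xi i).
  have {}T : forall a b, app (pick j p false) a b -> a ∈ pick j xi false.
    by apply: (proj1 (T _) Hxi); dsolve.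
  have /T : app (pick j p false) kappa lam by exists z.
  have -> : pick j xi false = xi by case: Cr => _ [_ [_]]; apply.
  by move=> kxi; case: (mem_asym kxi). }
apply: (proj1 (sat_bound _ _) (alln_elim K (x := y) _)).
- by move=> n lt; case: (Nat.ltb_spec n (fbound phi)) => [_|] //; lia.
- move=> k _; case: (star_valrel (Ve k)) => z [Nz [R [NR [vR A]]]].
  have -> : y k = z by apply: (val_fun (vy k) (valrel_sound vR A)).
  by split=> //; exists R.
Qed.

(** Independence of the name is the case of an equality in [star_sat]; see [js_eq]. Outside [V[f]]
    the value is arbitrary. *)
Definition js x := epsilon (inhabits kappa) (fun y => exists s, V s /\ val G s x /\ val Gs (j s) y).

Lemma js_eq s x y : V s -> val G s x -> val Gs (j s) y -> js x = y.
Proof.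
move=> Vs vx vy; have /(epsilon_spec (inhabits kappa)) : exists y, exists s, V s /\ val G s x /\ val Gs (j s) y.
  by exists y, s.
rewrite -/(js x) => [[s' [Vs' [vx' vy']]]].
apply: (star_sat (phi := FEq 0 1) (e := fun n => match n with 0 => s' | _ => s end) (x := fun _ => x)
  (y := fun n => match n with 0 => js x | _ => y end)) => //; by case.
Qed.

Lemma js_V x : V x -> js x = j x.
Proof. by move=> /star_check [c [Vc [v v']]]; apply: js_eq Vc v v'. Qed.

Lemma js_f : js f = fs.
Proof. by case: star_generic_name => fd [Vfd [v v']]; apply: js_eq Vfd v v'. Qed.

Lemma js_elementary : elementary W N js.
Proof.
split=> [x [s [Vs v]]|phi e We]; first by case: (star_val Vs) => y [Ny vy]; rewrite (js_eq Vs v vy).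
have /choice [d Hd] : forall n, exists s, V s /\ val G s (e n) by move=> n; apply: We.
have Vd n : V (d n) by case: (Hd n). have vd n : val G (d n) (e n) by case: (Hd n).
have vjs n : val Gs (j (d n)) (js (e n)) by case: (star_val (Vd n)) => y [_ v]; rewrite (js_eq (Vd n) (vd n) v).
split=> [|H]; first exact: (star_sat Vd vd vjs).
(* The converse is the direct implication for the negation of [phi]. *)
by apply: NNPP => K; apply: (star_sat (phi := FImp phi FBot) Vd vd vjs).
Qed.

(** * The ultrapower by the new measure *)

Section Ultrapower.
Context (eta a D D0 : U) (clp : U -> U).
Local Notation Fn g := (W g /\ maps g D0 W).
Context (Ueta : ultrafilter W D0 eta).
Context (cl_in : forall g, Fn g -> N (clp g)).
Context (cl_sur : forall y, N y -> exists g, Fn g /\ clp g = y).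
Context (cl_eq : forall g h, Fn g -> Fn h -> (clp g = clp h <->
  exists X, X ∈ eta /\ forall x, x ∈ X <-> x ∈ D0 /\ exists b, app g x b /\ app h x b)).
Context (cl_mem : forall g h, Fn g -> Fn h -> (clp g ∈ clp h <->
  exists X, X ∈ eta /\ forall x, x ∈ X <-> x ∈ D0 /\ exists b c, app g x b /\ app h x c /\ b ∈ c)).
Context (cl_const : forall x, W x -> exists c, Fn c /\ (forall d, d ∈ D0 -> app c d x) /\ clp c = j x).
Context (cl_id : exists i, Fn i /\ (forall d, d ∈ D0 -> app i d d) /\ clp i = a).

Local Notation FW := (frame1 (@W_trans P f) (W_ne VP Ho oP f)).

Let WD0 : W D0.
Proof. by case: Ueta. Qed.
Let Weta : W eta.
Proof. by case: Ueta => _ []. Qed.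

Lemma fn_fun g x b b' : Fn g -> app g x b -> app g x b' -> b = b'.
Proof. by move=> [_ [[_ H] _]]; apply: H. Qed.

Lemma fn_tot g x : Fn g -> x ∈ D0 -> exists b, app g x b.
Proof. by move=> [_ [_ [H _]]] /H. Qed.

(** Compare the identity with the constant function [X]. Membership in the measure thus becomes
    membership of [a] in an image under [j], to which transfer applies. *)
Lemma eta_iff X : W X -> subset X D0 -> (X ∈ eta <-> a ∈ j X).
Proof.
move=> WX XD; case: cl_id => i [Fi [Hi <-]]; case: (cl_const WX) => c [Fc [Hc <-]].
have E x : x ∈ X <-> x ∈ D0 /\ exists b d, app i x b /\ app c x d /\ b ∈ d.
{ split=> [xX|[xD [b [d [A [B bd]]]]]].
  - by split; [apply: XD|exists x, X; split; [apply/Hi/XD|split=> //; apply/Hc/XD]].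
  - by rewrite (fn_fun Fi A (Hi x xD)) (fn_fun Fc B (Hc x xD)) in bd. }
rewrite (cl_mem Fi Fc); split=> [H|[Y [Yeta HY]]]; first by exists X.
by have -> : X = Y by apply: mem_ext => x; rewrite E HY.
Qed.

Lemma W_Eq g h : Fn g -> Fn h -> exists X, W X /\ forall x, x ∈ X <-> x ∈ D0 /\ exists b, app g x b /\ app h x b.
Proof.
move=> [Wg _] [Wh _].
by apply: (W_sep (VP := VP) (Ho := Ho) (oP := oP) Gf Ef (Q := fun x => exists b, app g x b /\ app h x b)) => //; dsolve.
Qed.

Lemma W_In g h : Fn g -> Fn h ->
  exists X, W X /\ forall x, x ∈ X <-> x ∈ D0 /\ exists b c, app g x b /\ app h x c /\ b ∈ c.
Proof.
move=> [Wg _] [Wh _].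
case: (W_sep (VP := VP) (Ho := Ho) (oP := oP) Gf Ef (x := D0)
  (Q := fun x => exists b, app g x b /\ exists c, app h x c /\ b ∈ c)) => //; first by dsolve.
move=> X [WX HX]; exists X; split=> // x; rewrite HX; split=> [[xD [b [A [c [B bc]]]]]|[xD [b [c [A [B bc]]]]]]; split=> //.
- by exists b, c.
- by exists b; split=> //; exists c.
Qed.

Lemma cl_eq_iff g h X : Fn g -> Fn h -> W X -> (forall x, x ∈ X <-> x ∈ D0 /\ exists b, app g x b /\ app h x b) ->
  (clp g = clp h <-> a ∈ j X).
Proof.
move=> Fg Fh WX HX; rewrite -eta_iff // => [x /HX []//|]; rewrite (cl_eq Fg Fh); split=> [[Y [Ye HY]]|H]; last by exists X.
by have -> : X = Y by apply: mem_ext => x; rewrite HX HY.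
Qed.

Lemma cl_mem_iff g h X : Fn g -> Fn h -> W X ->
  (forall x, x ∈ X <-> x ∈ D0 /\ exists b c, app g x b /\ app h x c /\ b ∈ c) ->
  (clp g ∈ clp h <-> a ∈ j X).
Proof.
move=> Fg Fh WX HX; rewrite -eta_iff // => [x /HX []//|]; rewrite (cl_mem Fg Fh); split=> [[Y [Ye HY]]|H]; last by exists X.
by have -> : X = Y by apply: mem_ext => x; rewrite HX HY.
Qed.

(** Every element of the class of [t] is itself the class of a function, by surjectivity, so the
    membership clause can be checked pointwise; the disjunction is handled by transferring the
    statement that [X] is the union of [Y] and [Z]. *)
Lemma cl_upair p q t : Fn p -> Fn q -> Fn t ->
  (forall x u v w, app p x u -> app q x v -> app t x w -> is_upair w u v) -> is_upair (clp t) (clp p) (clp q).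
Proof.
move=> Fp Fq Ft H z.
have K w : Fn w -> (clp w ∈ clp t <-> clp w = clp p \/ clp w = clp q).
{ move=> Fw; case: (W_In Fw Ft) => X [WX HX]; case: (W_Eq Fw Fp) => Y [WY HY]; case: (W_Eq Fw Fq) => Z [WZ HZ].
  rewrite (cl_mem_iff Fw Ft WX HX) (cl_eq_iff Fw Fp WY HY) (cl_eq_iff Fw Fq WZ HZ).
  have E x : x ∈ X <-> x ∈ Y \/ x ∈ Z.
  { rewrite HX HY HZ; split=> [[xD [b [c [A [B bc]]]]]|].
    - case: (fn_tot Fp xD) => u Au; case: (fn_tot Fq xD) => v Av; case/(H x u v c Au Av B): bc => ?; subst b.
      + by left; split=> //; exists u.
      + by right; split=> //; exists v.
    - case=> [[xD [b [A B]]]|[xD [b [A B]]]]; split=> //; case: (fn_tot Ft xD) => c C; exists b, c; do 2 (split=> //).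
      + by case: (fn_tot Fq xD) => v Av; apply/(H x b v c) => //; left.
      + by case: (fn_tot Fp xD) => v Av; apply/(H x v b c) => //; right. }
  have T := transfer (TW := @W_trans P f) (TN := TN) (ne := W_ne VP Ho oP f) (El := El)
    (Q := fun i => (forall x, x ∈ pick j X i -> x ∈ pick j Y i \/ x ∈ pick j Z i) /\
      (forall x, x ∈ pick j Y i -> x ∈ pick j X i) /\ (forall x, x ∈ pick j Z i -> x ∈ pick j X i)).
  have [T1 [T2 T3]] : (forall x, x ∈ j X -> x ∈ j Y \/ x ∈ j Z) /\
      (forall x, x ∈ j Y -> x ∈ j X) /\ (forall x, x ∈ j Z -> x ∈ j X).
  { apply: (proj1 (T _)); first by dsolve. by split=> [x /E //|]; split=> x xY; apply/E; [left|right]. }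
  by split=> [/T1 //|[/T2|/T3]]. }
split=> [zt|].
- case: (cl_sur (TN (cl_in Ft) zt)) => w [Fw E]; rewrite -E in zt *; exact/K.
- by case=> ->; apply/K => //; [left|right].
Qed.

Lemma fn_upair p q : Fn p -> Fn q -> exists t, Fn t /\
  forall x u v w, app p x u -> app q x v -> app t x w -> is_upair w u v.
Proof.
move=> Fp Fq; have [Wp _] := Fp; have [Wq _] := Fq; case: (W_pair VP Ho oP Ef Wp Wq) => pq [Wpq Ppq].
case: (W_bound VP Ho oP Ef Wpq) => S [_ [_ [B [WB [TB [pqB _]]]]]].
have ran r x u : r = p \/ r = q -> app r x u -> u ∈ B.
{ move=> Hr [z [zr Pz]]; have rB : r ∈ B.
    by case: Hr => ->; [case: (pair_fst_mem Ppq)|case: (pair_snd_mem Ppq)] => d [dpq xd]; apply: (TB d) => //; apply: (TB pq).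
  by case: (pair_snd_mem Pz) => d [dz ud]; apply: (TB d) => //; apply: (TB z) => //; apply: (TB r). }
case: (W_power_bound VP Ho oP Gf Ef WB) => Z [WZ HZ].
case: (W_func (VP := VP) (Ho := Ho) (oP := oP) Gf Ef (D := D0) (B := Z)
  (Q := fun x w => exists u, app p x u /\ exists v, app q x v /\ is_upair w u v)) => //.
- by dsolve.
- move=> x xD; case: (fn_tot Fp xD) => u Au; case: (fn_tot Fq xD) => v Av.
  have uB : u ∈ B by apply: (ran p x u) => //; left. have vB : v ∈ B by apply: (ran q x v) => //; right.
  case: (W_upair VP Ho oP Ef (W_trans WB uB) (W_trans WB vB)) => w [Ww Hw]; exists w; split.
    by apply: HZ => // z /Hw [->|->].
  by exists u; split=> //; exists v.
- move=> x w w' _ _ _ [u [A [v [B' H]]]] [u' [A' [v' [B'' H']]]].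
  rewrite -(fn_fun Fp A A') -(fn_fun Fq B' B'') in H'; exact: upair_unique H H'.
- move=> t [Wt [mt At]]; exists t; split=> // x u v w A B' /At [_ [_ [u' [A' [v' [B'' H]]]]]].
  by rewrite (fn_fun Fp A A') (fn_fun Fq B' B'').
Qed.

(* The identity [[g] = j(g)([id])], without the full theorem of Los. *)
Lemma cl_value g : Fn g -> app (j g) a (clp g).
Proof.
move=> Fg; case: cl_id => i [Fi [Hi Ei]]; have Wg := proj1 Fg.
case: (fn_upair Fi Fi) => s [Fs Hs]; case: (fn_upair Fi Fg) => t [Ft Ht]; case: (fn_upair Fs Ft) => q [Fq Hq].
exists (clp q); split; last first.
  rewrite -Ei; exists (clp s), (clp t); split; first exact: cl_upair.
  by split; exact: cl_upair.
case: (cl_const Wg) => c [Fc [Hc <-]]; case: (W_In Fq Fc) => X [WX HX]; apply/(cl_mem_iff Fq Fc WX HX).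
have -> : X = D0.
{ apply: mem_ext => x; rewrite HX; split=> [[]//|xD]; split=> //.
  case: (fn_tot Fs xD) => us As; case: (fn_tot Ft xD) => ut At; case: (fn_tot Fq xD) => uq Aq.
  case: (fn_tot Fg xD) => ug Ag; exists uq, g; split=> //; split; first exact: Hc.
  apply: (app_mem Ag); exists us, ut; split; first exact: (Hs x x x us (Hi x xD) (Hi x xD) As).
  split; first exact: (Ht x x ug ut (Hi x xD) Ag At). exact: (Hq x us ut uq As At Aq). }
by apply/eta_iff => //; case: Ueta => _ [_ []].
Qed.

Lemma rep_j y : N y -> exists g, Fn g /\ app (j g) a y.
Proof. by move=> /cl_sur [g [Fg <-]]; exists g; split=> //; apply: cl_value. Qed.

Local Notation Els := js_elementary.
Local Notation F2s := (frame2 (@W_trans P f) TN (W_ne VP Ho oP f) (proj1 Els)).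
Local Notation CS := (cl F2s).

Lemma transfer_js (Q : bool -> Prop) : dfn (F := F2s) (fun i _ => Q i) -> Q true -> Q false.
Proof.
by move=> dQ; apply: (proj1 (transfer (TW := @W_trans P f) (TN := TN) (ne := W_ne VP Ho oP f) (El := Els) dQ)).
Qed.

Lemma js_sub x y : W x -> W y -> subset x y -> subset (js x) (js y).
Proof. by move=> Wx Wy; apply: (transfer_js (Q := fun i => subset (pick js x i) (pick js y i))); dsolve. Qed.

(** The target is also generated by [fs], so [y] has a name in [j S] for some [S] in [V]; then [B]
    is the set of the values at [f] of the names in [S]. *)
Lemma js_cover y : N y -> exists B, W B /\ y ∈ js B.
Proof.
rewrite -star_extension => [[s [Ms v]]]; case: (M_elim Ms) => S [VS [_ sS]].
case: (setn_ex VP oP VS) => n [Vn Hn]; case: (Ef Vn) => B vB; exists B; split; first by exists n.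
case: (star_val Vn) => B' [NB' vB']; rewrite (js_eq Vn vB vB'); case/val_iff: vB' => H _.
have WS := V_W' VS; have Wn := V_W' Vn; have Wo := V_W' Vo0.
have T := transfer (TW := @W_trans P f) (TN := TN) (ne := W_ne VP Ho oP f) (El := El)
  (Q := fun i => (forall s, s ∈ pick j S i -> app (pick j n i) s (pick j o i)) /\
     pick j o i ∈ pick j P i /\ forall z, z ∈ pick j o i -> False).
have [T1 [T2 T3]] : (forall s, s ∈ j S -> app (j n) s (j o)) /\ j o ∈ j P /\ forall z, z ∈ j o -> False.
{ apply: (proj1 (T _)); first by dsolve. split=> // s1 sS1; case: (V_pair (V_in VS sS1) Vo0) => u [Vu Pu].
  by exists u; split=> //; apply/Hn => //; exists s1. }
case: (H s (j o) (T1 s sS)); first by split=> // z /T3.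
by move=> y' [yB v']; rewrite (val_fun v v').
Qed.

Context (VD : V D) (Deta : D ∈ eta).

Let DD0 : subset D D0.
Proof. by case: Ueta => _ [_ [_ [H _]]]; apply: H. Qed.

(** Here concentration on a set in [V] enters: on [D] the two embeddings agree, while the underlying
    set [D0] of the measure is only known to be in [V[f]]. *)
Lemma a_js_D : a ∈ js D.
Proof. by rewrite js_V //; apply/eta_iff => //; apply: V_W'. Qed.

Lemma a_js_D0 : a ∈ js D0.
Proof. exact: (js_sub (V_W' VD) WD0 DD0 a_js_D). Qed.

Lemma Na : N a.
Proof. exact: (TN (proj1 Els _ WD0) a_js_D0). Qed.

(** An object definable from [a] and parameters in the range of [js] is a value at [a] of some
    [js g]: the defining condition, read in [V[f]], is turned into a function on [D0]. *)
Lemma rep_js y (Q : bool -> U -> U -> Prop) : N y -> dfn (F := F2s) (fun i e => Q i (e 0) (e 1)) ->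
  Q false a y -> (forall y', N y' -> Q false a y' -> y' = y) -> exists g, Fn g /\ app (js g) a y.
Proof.
move=> Ny dQ Qy uy; case: (js_cover Ny) => B [WB yB].
have dQW := d_proj dQ; have Wo := V_W' Vo0.
(* Uniqueness within [B] is part of the condition, so that it defines a partial function even at
   points [d] where [Q] does not; elsewhere the value of [g] is [o]. *)
pose best i d b := Q i d b /\ forall b', b' ∈ pick js B i -> Q i d b' -> b' = b.
have dbest : dfn (F := F2s) (fun i e => best i (e 0) (e 1)).
{ apply: d_and => //; apply: d_ball; first by tm_solve. apply: d_imp; last by dsolve.
  exact: (d_subst dQ (T := fun n _ e => match n with 0 => e 1 | _ => e 0 end)
    (fun n => match n with 0 => @tm_var U F2s 1 | _ => @tm_var U F2s 0 end)). }
have dbW := d_proj dbest.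
case: (W_upair VP Ho oP Ef WB Wo) => X [WX HX].
case: (W_bound VP Ho oP Ef WX) => S [_ [_ [B1 [WB1 [TB1 [XB1 _]]]]]].
have oB1 : o ∈ B1 by apply: (TB1 X) => //; apply/HX; right.
have BB1 : subset B B1 by move=> z zB; apply: (TB1 B) => //; apply: (TB1 X) => //; apply/HX; left.
case: (W_func (VP := VP) (Ho := Ho) (oP := oP) Gf Ef (D := D0) (B := B1)
  (Q := fun d b => (b ∈ B /\ best true d b) \/ (~ (exists b, b ∈ B /\ best true d b) /\ b = o))) => //.
{ apply: d_or; first by apply: d_and; [dsolve|exact: dbW]. apply: d_and; last by dsolve.
  apply: d_not; apply: d_bex; first by tm_solve.
  exact: (d_subst dbW (T := fun n _ e => match n with 0 => e 1 | _ => e 0 end)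
    (fun n => match n with 0 => @tm_var U FW 1 | _ => @tm_var U FW 0 end)). }
{ move=> d dD; case: (classic (exists b, b ∈ B /\ best true d b)) => [[b [bB H]]|H].
  - by exists b; split; [apply: BB1|left].
  - by exists o; split=> //; right. }
{ move=> d b b' _ _ _ [[bB H]|[H ->]] [[bB' H']|[H' ->]] //.
  - exact: (proj2 H' b bB (proj1 H)).
  - by case: H'; exists b.
  - by case: H; exists b'. }
move=> g [Wg [mg Ag]]; exists g; split=> //.
have T : forall d, d ∈ pick js D0 false -> forall b, b ∈ pick js B false -> best false d b -> app (pick js g false) d b.
{ apply: (transfer_js (Q := fun i => forall d, d ∈ pick js D0 i -> forall b, b ∈ pick js B i -> best i d b -> app (pick js g i) d b)).
  - apply: d_ball; first by tm_solve. apply: d_ball; first by tm_solve. apply: d_imp; last by dsolve.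
    exact: (d_subst dbest (T := fun n _ e => match n with 0 => e 1 | _ => e 0 end)
      (fun n => match n with 0 => @tm_var U F2s 1 | _ => @tm_var U F2s 0 end)).
  - by move=> d dD b bB H; apply/Ag; split=> //; split; [apply: BB1|left]. }
apply: (T a a_js_D0 y yB); split=> // y' yB' Qy'; apply: uy => //; exact: (TN (proj1 Els _ WB) yB').
Qed.

(** The map [js] need not be available in [V[f]], but the old measure is. Since [fs] is the value of
    some [j Fs] at [a], the statement that [a] belongs to [js X] is decided by [eta] and a name of
    [X]. *)
Lemma js_measure : exists eta', W eta' /\ forall X, X ∈ eta' <-> W X /\ subset X D0 /\ a ∈ js X.
Proof.
case: (rep_j Nfs) => Fs [[WFs mFs] AFs].
case: (W_power_names VP Ho oP Gf Ef WD0) => SN [VSN HSN]; case: (W_power_bound VP Ho oP Gf Ef WD0) => Z [WZ HZ].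
case: (V_trans_ex VSN) => S [VS [TS SNS]]; case: (W_valset VP Ho oP Ef VS TS) => RS [WRS [vRS HRS]].
have WSN := V_W' VSN.
(* [Phi] says that [d] belongs to the value of the name [s] at the function [F(d)]. At [d = a] in
   the target, with [j Fs] for [F], this is the value of [j s] at [fs]. *)
pose Phi C (F : U) P' d s := exists f1, app F d f1 /\ exists R, C R /\ valrel R P' f1 /\ exists x, app R s x /\ d ∈ x.
case: (W_sep (VP := VP) (Ho := Ho) (oP := oP) Gf Ef (x := Z) (Q := fun X => subset X D0 /\ exists s, s ∈ SN /\ app RS s X /\
  exists Y, Y ∈ eta /\ forall d, d ∈ D0 -> (d ∈ Y <-> Phi W Fs P d s))) => //.
{ by rewrite /Phi /valrel; dsolve. }
move=> eta' [We He]; exists eta'; split=> //.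
have key s X : s ∈ SN -> val G s X -> exists Y, W Y /\ (forall d, d ∈ Y <-> d ∈ D0 /\ Phi W Fs P d s) /\ (a ∈ js X <-> Y ∈ eta).
{ move=> sS v; have Vs := V_in VSN sS; have Ws := V_W' Vs.
  case: (W_sep (VP := VP) (Ho := Ho) (oP := oP) Gf Ef (x := D0) (Q := fun d => Phi W Fs P d s)) => //.
    by rewrite /Phi /valrel; dsolve.
  move=> Y [WY HY]; exists Y; split=> //; split=> //; rewrite eta_iff // => [d /HY []//|].
  have T := transfer (TW := @W_trans P f) (TN := TN) (ne := W_ne VP Ho oP f) (El := El)
    (Q := fun i => (forall d, d ∈ pick j Y i -> d ∈ pick j D0 i /\ Phi (CC i) (pick j Fs i) (pick j P i) d (pick j s i)) /\
       forall d, d ∈ pick j D0 i -> Phi (CC i) (pick j Fs i) (pick j P i) d (pick j s i) -> d ∈ pick j Y i).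
  have [T1 T2] : (forall d, d ∈ j Y -> d ∈ j D0 /\ Phi N (j Fs) (j P) d (j s)) /\
    forall d, d ∈ j D0 -> Phi N (j Fs) (j P) d (j s) -> d ∈ j Y.
  { apply: (proj1 (T _)); first by rewrite /Phi /valrel; dsolve.
    by split=> [d /HY //|d dD H]; apply/HY. }
  case: (star_valrel Vs) => x0 [Nx0 [R0 [NR0 [vR0 A0]]]].
  rewrite (js_eq Vs v (valrel_sound vR0 A0)).
  have fjFs : is_function (j Fs).
  { have T' := transfer (TW := @W_trans P f) (TN := TN) (ne := W_ne VP Ho oP f) (El := El)
      (Q := fun i => is_function (pick j Fs i)).
    by apply: (proj1 (T' _)); [dsolve|case: mFs]. }
  split=> [ax|/T1 [_ [f1 [Af1 [R [NR [vR [x [A ax]]]]]]]]].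
  - apply: T2; last by exists fs; split=> //; exists R0; split=> //; split=> //; exists x0.
    by apply/eta_iff => //; case: Ueta => _ [_ []].
  - have E : f1 = fs by case: fjFs => _; apply; eassumption.
    subst f1; by rewrite (val_fun (valrel_sound vR0 A0) (valrel_sound vR A)). }
move=> X; rewrite He; split.
- move=> [XZ [XD [s [sS [/HRS [_ v] [Y [Ye HY]]]]]]]; split; first exact: (W_trans WZ XZ). split=> //.
  case: (key s X sS v) => Y' [WY' [HY' ->]]; have -> : Y' = Y; last by [].
  apply: mem_ext => d; rewrite HY'; split=> [[dD H]|dY]; first exact/HY.
  have dD : d ∈ D0 by case: Ueta => _ [_ [_ [H _]]]; apply: H dY.
  by split=> //; apply/HY.
- move=> [WX [XD aX]]; split; first exact: HZ. split=> //; case: (HSN X WX XD) => s [sS v]; exists s; split=> //.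
  case: (key s X sS v) => Y [WY [HY E]]; split; first by apply/HRS; split=> //; apply: (TS SN).
  by exists Y; split; [apply/E|move=> d dD; rewrite HY; tauto].
Qed.

Context (h s0 : U) (Vh : V h) (fh : is_function h) (Ch : code (j h) al lam s0) (Ns0 : N s0).
Context (phi0 : fm) (e0 : nat -> U) (Ve0 : forall n, V (e0 n)).
Context (Hst : forall x, N x -> (sat N (scons x (scons a (fun n => j (e0 n)))) phi0 <-> x = kappa)).

Lemma md_fun f1 f2 f3 g l b : md f1 f2 g l b -> md f1 f3 g l b -> f2 = f3.
Proof.
move=> [_ [_ [A2 [H1 H2]]]] [_ [_ [A3 [K1 K2]]]]; apply: mem_ext => x; split=> H.
- case: (H1 x H) => [[xf Np]|Px]; [by case: (K2 x xf)|exact: app_mem A3 Px].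
- case: (K1 x H) => [[xf Np]|Px]; [by case: (H2 x xf)|exact: app_mem A2 Px].
Qed.

(** Any [y] is the value at [a] of some [j F], and [j F] is the value at [j f] of the image of a
    name of [F]. So it suffices to define [j f] from [a] and parameters in the range of [js], which
    is done by undoing the modification. *)
Lemma rep_all y : N y -> exists g, Fn g /\ app (js g) a y.
Proof.
move=> Ny; case: (rep_j Ny) => F [[WF mF] AF]; case: (WF) => Fd [VFd vFd].
have WFd := V_W' VFd; have Wh := V_W' Vh; have We0 n := V_W' (Ve0 n).
have [Nk Nlam] := app_in TN (j_in Wf) Alam.
case: (V_trans_ex VFd) => S [VS [TS FdS]]; case: (W_valset VP Ho oP Ef VS TS) => RS [WRS [vRS HRS]].
have T := transfer (TW := @W_trans P f) (TN := TN) (ne := W_ne VP Ho oP f) (El := El)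
  (Q := fun i => valrel (pick j RS i) (pick j P i) (pick j f i) /\ app (pick j RS i) (pick j Fd i) (pick j F i) /\
    is_function (pick j h i) /\ is_function (pick j F i)).
have [vRj [ARj [fjh fjF]]] : valrel (j RS) (j P) (j f) /\ app (j RS) (j Fd) (j F) /\ is_function (j h) /\ is_function (j F).
{ apply: (proj1 (T _)); first by rewrite /valrel; dsolve.
  split=> //; split; first by apply/HRS. by split=> //; case: mF. }
have vF := valrel_sound vRj ARj.
(* At [d = a] in the target, [g] is the critical point given by [phi0], [b] the code found there in
   [fs], [l] the value it stores, [f1] the restored function, and [F0] the value at [f1] of the
   image of the name [Fd]. *)
pose Q i d y := exists g, CS i g /\ sat (CS i) (scons g (scons d (fun n => pick js (e0 n) i))) phi0 /\
  exists b, CS i b /\ app (pick js f i) g b /\ exists l, CS i l /\ exists s, CS i s /\ code (pick js h i) b l s /\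
  exists f1, CS i f1 /\ md (pick js f i) f1 g b l /\ exists R, CS i R /\ valrel R (pick js P i) f1 /\
  exists F0, CS i F0 /\ app R (pick js Fd i) F0 /\ app F0 d y.
have Epick x : V x -> pick js x false = j x by apply: js_V.
have Ee0 : (fun n => pick js (e0 n) false) = fun n => j (e0 n).
  by apply: functional_extensionality => n; apply: Epick.
have Ef0 : pick js f false = fs := js_f.
have Ms := md_sym Mst.
apply: (rep_js (Q := Q)) => //.
- apply: d_ex; apply: d_and.
    apply: d_ext (d_sat phi0 (F := F2s) (T := fun n => match n with 0 => fun _ e => e 0 | 1 => fun _ e => e 1
      | S (S n) => fun i _ => pick js (e0 n) i end) _) => [i e _|[|[|n]]]; last 3 first.
      exact: (@tm_var U F2s 0). exact: (@tm_var U F2s 1). by have W0 := We0 n; tm_solve.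
    by apply: sat_ext => [[|[|n]]].
  rewrite /code /md /valrel; dsolve.
- exists kappa; split=> //; rewrite Ee0; split; first exact/Hst.
  exists al; split=> //; rewrite Ef0; split; first by case: Mst => _ [_ []].
  exists lam; split=> //; exists s0; split=> //; rewrite (Epick h Vh); split=> //.
  exists (j f); split; first exact: j_in. split=> //; exists (j RS); split; first exact: j_in.
  rewrite (Epick P VP) (Epick Fd VFd); split=> //; exists (j F); split; first exact: j_in.
  by split.
- move=> y' Ny' [g [Ng [Sg [b [Nb [Ab [l [Nl [s [Ns [C' [f1 [Nf1 [M' [R [NR [vR [F0 [NF0 [AR AF0]]]]]]]]]]]]]]]]]]]].
  rewrite Ee0 in Sg; have E := proj1 (Hst Ng) Sg; subst g; rewrite Ef0 in Ab M'.
  have E : b = al by case: (Ms) => [[_ H] [Aal _]]; apply: H Ab Aal.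
  subst b; rewrite (Epick h Vh) in C'; case: (code_fun fjh C' Ch) => E _; subst l.
  have E := md_fun M' Ms; subst f1; rewrite (Epick P VP) in vR; rewrite (Epick Fd VFd) in AR.
  have E := val_fun (valrel_sound vR AR) vF; subst F0; by case: fjF => _; apply; eassumption.
Qed.

Lemma js_ultrapower : exists eta', is_ultrapower W N js eta' a /\ D ∈ eta' /\
  (forall X, V X -> (X ∈ eta' <-> X ∈ eta)).
Proof.
case: js_measure => eta' [We' He']; exists eta'; split; last first.
{ have K X : V X -> (X ∈ eta' <-> X ∈ eta).
  { move=> VX; have WX := V_W' VX; rewrite He' js_V //; split=> [[_ [XD aX]]|Xe]; first exact/eta_iff.
    have XD : subset X D0 by case: Ueta => _ [_ [_ [H _]]]; apply: H.
    by split=> //; split=> //; apply/eta_iff. }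
  by split=> //; apply/K. }
have tot g : Fn g -> exists y, app (js g) a y.
{ move=> Fg; have Wg := proj1 Fg.
  apply: (transfer_js (Q := fun i => forall d, d ∈ pick js D0 i -> exists y, app (pick js g i) d y)) a_js_D0; first by dsolve.
  by move=> d dD; apply: fn_tot. }
have uniq g y y' : Fn g -> app (js g) a y -> app (js g) a y' -> y = y'.
{ move=> Fg; have Wg := proj1 Fg.
  have [_ H] : is_function (js g).
  { apply: (transfer_js (Q := fun i => is_function (pick js g i))); first by dsolve. by case: Fg => _ []. }
  exact: H. }
(* The class of [g] is collapsed to the value of [js g] at [a]; by [rep_all] these values exhaust
   the target. *)
pose cls g := epsilon (inhabits a) (fun y => app (js g) a y).
have clsP g : Fn g -> app (js g) a (cls g) by move=> /tot /(epsilon_spec (inhabits a)).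
have clsE g y : Fn g -> app (js g) a y -> cls g = y by move=> Fg; apply: uniq => //; apply: clsP.
have aD0 := a_js_D0.
exists D0, cls; split.
{ split=> //; split=> //; split; first by apply/He'; split=> //; split.
  split; first by move=> X /He' [_ []].
  split.
  { move=> X /He' [WX [_ aX]]; apply: NNPP => K.
    apply: (transfer_js (Q := fun i => forall x, x ∈ pick js X i -> False)) aX; first by dsolve.
    by move=> x xX; apply: K; exists x. }
  split.
  { move=> X Y /He' [WX [_ aX]] WY XY YD; apply/He'; split=> //; split=> //; exact: (js_sub WX WY XY). }
  split.
  { move=> X Y Z /He' [WX [XD aX]] /He' [WY [_ aY]] HZ.
    have WZ : W Z.
    { case: (W_sep (VP := VP) (Ho := Ho) (oP := oP) Gf Ef (x := X) (Q := fun x => x ∈ Y)) => //; first by dsolve.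
      by move=> Z' [WZ' HZ']; have -> : Z = Z' by apply: mem_ext => x; rewrite HZ HZ'. }
    apply/He'; split=> //; split; first by move=> x /HZ [/XD].
    apply: (transfer_js (Q := fun i => forall x, x ∈ pick js X i -> x ∈ pick js Y i -> x ∈ pick js Z i)) aX aY; first by dsolve.
    by move=> x xX xY; apply/HZ. }
  move=> X Y WX XD HY.
  have WY : W Y.
  { case: (W_sep (VP := VP) (Ho := Ho) (oP := oP) Gf Ef (x := D0) (Q := fun x => ~ x ∈ X)) => //; first by dsolve.
    by move=> Z' [WZ' HZ']; have -> : Y = Z' by apply: mem_ext => x; rewrite HY HZ'. }
  have : a ∈ js X \/ a ∈ js Y.
  { apply: (transfer_js (Q := fun i => forall x, x ∈ pick js D0 i -> x ∈ pick js X i \/ x ∈ pick js Y i)) aD0; first by dsolve.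
    by move=> x xD; case: (classic (x ∈ X)) => [|H]; [left|right; apply/HY]. }
  by case=> H; [left|right]; apply/He'; split=> //; split=> // x /HY []. }
split; first by move=> g Fg; case: (app_in TN (proj1 Els _ (proj1 Fg)) (clsP g Fg)).
split; first by move=> y /rep_all [g [Fg A]]; exists g; split=> //; apply: clsE.
split.
{ move=> g k Fg Fk; have [Wg _] := Fg; have [Wk' _] := Fk; case: (W_Eq Fg Fk) => X [WX HX].
  have XD : subset X D0 by move=> x /HX [].
  have -> : (exists X, X ∈ eta' /\ forall x, x ∈ X <-> x ∈ D0 /\ exists b, app g x b /\ app k x b) <-> a ∈ js X.
  { split=> [[Y [/He' [_ [_ aY]] HY]]|aX]; last by exists X; split=> //; apply/He'.
    by have -> : X = Y by apply: mem_ext => x; rewrite HX HY. }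
  split=> [E|].
  - have A := clsP g Fg; have B := clsP k Fk; rewrite -E in B.
    apply: (transfer_js (Q := fun i => forall d, d ∈ pick js D0 i -> forall b, app (pick js g i) d b ->
      app (pick js k i) d b -> d ∈ pick js X i)) A B => //; first by dsolve.
    by move=> d dD b A B; apply/HX; split=> //; exists b.
  - move=> aX; have [b [A B]] : exists b, app (js g) a b /\ app (js k) a b.
    { apply: (transfer_js (Q := fun i => forall d, d ∈ pick js X i -> exists b, app (pick js g i) d b /\
        app (pick js k i) d b)) aX; first by dsolve. by move=> d /HX []. }
    by rewrite (clsE g b) // (clsE k b). }
split.
{ move=> g k Fg Fk; have [Wg _] := Fg; have [Wk' _] := Fk; case: (W_In Fg Fk) => X [WX HX].
  have XD : subset X D0 by move=> x /HX [].
  have -> : (exists X, X ∈ eta' /\ forall x, x ∈ X <-> x ∈ D0 /\ exists b c, app g x b /\ app k x c /\ b ∈ c) <-> a ∈ js X.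
  { split=> [[Y [/He' [_ [_ aY]] HY]]|aX]; last by exists X; split=> //; apply/He'.
    by have -> : X = Y by apply: mem_ext => x; rewrite HX HY. }
  split=> [E|].
  - have A := clsP g Fg; have B := clsP k Fk.
    apply: (transfer_js (Q := fun i => forall d, d ∈ pick js D0 i -> forall b, app (pick js g i) d b ->
      forall c, app (pick js k i) d c -> b ∈ c -> d ∈ pick js X i)) A _ B E => //; first by dsolve.
    by move=> d dD b A c B bc; apply/HX; split=> //; exists b, c.
  - move=> aX; have [b [A [c [B bc]]]] : exists b, app (js g) a b /\ exists c, app (js k) a c /\ b ∈ c.
    { apply: (transfer_js (Q := fun i => forall d, d ∈ pick js X i -> exists b, app (pick js g i) d b /\
        exists c, app (pick js k i) d c /\ b ∈ c)) aX; first by dsolve.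
      by move=> d /HX [_ [b [c [A [B bc]]]]]; exists b; split=> //; exists c. }
    by rewrite (clsE g b) // (clsE k c). }
split.
{ move=> x Wx; case: (cl_const Wx) => c [Fc [Hc _]]; have Wc := proj1 Fc; exists c; split=> //; split=> //; apply: clsE => //.
  by apply: (transfer_js (Q := fun i => forall d, d ∈ pick js D0 i -> app (pick js c i) d (pick js x i))) aD0; first by dsolve. }
case: cl_id => i [Fi [Hi _]]; have Wi := proj1 Fi; exists i; split=> //; split=> //; apply: clsE => //.
have T : forall d, d ∈ js D0 -> app (js i) d d.
  by refine (transfer_js (Q := fun t => forall d, d ∈ pick js D0 t -> app (pick js i t) d d) _ Hi); dsolve.
exact: T.
Qed.

(** The same formula works: its parameters come from elements of [V], where the two embeddings
    agree, and [a] is unchanged. *)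
Lemma js_standard : standard V W N js a.
Proof.
have [Nk _] := app_in TN (j_in Wf) Alam.
exists kappa; split.
  case: Cr => _ [_ [ne fix_]]; split=> //; split=> //; split; first by rewrite js_V.
  by move=> b bk; rewrite js_V; [apply: V_in Vk bk|apply: fix_].
split=> //; exists phi0, e0; split=> // x Nx.
have -> : (fun n => js (e0 n)) = fun n => j (e0 n) by apply: functional_extensionality => n; apply: js_V.
exact: Hst.
Qed.

End Ultrapower.

End Star.

Lemma embedding_main h nd ell : V h -> is_function h ->
  (forall d x, V d -> inaccessible V d -> subset d kappa -> V x -> in_rank x d -> exists a, a ∈ d /\ app h a x) ->
  V nd -> (forall f, generic V P f -> forall L, val (filter_of P f) nd L -> extension_exists V P f ->
    maps L kappa (fun x => extension V P f x /\ in_rank x kappa) /\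
    forall g a b s x, app f g a -> code h a b s -> V b -> V s -> val (filter_of P f) s x -> app L g x) ->
  val G nd ell ->
  forall lam lp z, app (j f) kappa lam -> is_succ_card N lam lp -> hereditary N lp z ->
  exists j', elementary W (extension M (j' P) (j' f)) j' /\ generic M (j' P) (j' f) /\ app (j' ell) kappa z /\
    (forall x, extension M (j' P) (j' f) x <-> N x) /\ (forall x, V x -> j' x = j x) /\
    (forall eta a D, is_ultrapower W N j eta a -> standard V W N j a -> V D -> D ∈ eta ->
      exists eta', is_ultrapower W (extension M (j' P) (j' f)) j' eta' a /\
        standard V W (extension M (j' P) (j' f)) j' a /\ D ∈ eta' /\ (forall X, V X -> (X ∈ eta' <-> X ∈ eta))).
Proof.
move=> Vh fh enum Vnd Hnd vell lam lp z A Hl Hz; have Wh := V_W' Vh; have Wnd := V_W' Vnd.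
have T := transfer (TW := @W_trans P f) (TN := TN) (ne := W_ne VP Ho oP f) (El := El)
  (Q := fun i => forall g, CC i g -> forall lam, CC i lam -> forall lp, CC i lp -> forall z, CC i z ->
    app (pick j f i) g lam -> is_succ_card (CC i) lam lp -> hereditary (CC i) lp z ->
    exists a, CC i a /\ exists f', CC i f' /\ exists s, CC i s /\ exists R, CC i R /\ exists L, CC i L /\
    legit_in (pick j kappa i) (pick j II i) g lam a /\ md (pick j f i) f' g lam a /\ code (pick j h i) a lam s /\
    valrel R (pick j P i) f' /\ app R (pick j nd i) L /\ app L g z).
have [Nk Nlam] := app_in TN (j_in Wf) A.
have Nlp : N lp by case: Hl. have Nz : N z by case: Hz.
have [al [Nal [fs [Nfs [s0 [Ns0 [R [NR [L [NL [Lst [Mst [Ch [vR [AR AL]]]]]]]]]]]]]]] :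
  exists a, N a /\ exists f', N f' /\ exists s, N s /\ exists R, N R /\ exists L, N L /\
    legit_in (j kappa) (j II) kappa lam a /\ md (j f) f' kappa lam a /\ code (j h) a lam s /\
    valrel R (j P) f' /\ app R (j nd) L /\ app L kappa z.
{ refine (proj1 (T _) _ kappa Nk lam Nlam lp Nlp z Nz A Hl Hz).
  - rewrite /legit_in /md /code /valrel; dsolve.
  - move=> g _ l _ lp' _ z' _ A' Hl' Hz'.
    case: (mod_naming Gf Ef Vh fh enum Vnd Hnd A' Hl' Hz') => a [f' [s [R [L [Wa [Wf' [Ws [WR [WL H]]]]]]]]].
    exists a; split=> //; exists f'; split=> //; exists s; split=> //; exists R; split=> //; by exists L. }
exists (js fs); rewrite (js_f Nal Nfs A Lst Mst) (js_V Nal Nfs A Lst Mst VP) (star_extension Nal Nfs A Lst Mst).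
split; first exact: (js_elementary Nal Nfs A Lst Mst).
split; first exact: (star_generic Nal Nfs A Lst Mst).
split; first by rewrite (js_eq Nal Nfs A Lst Mst Vnd vell (valrel_sound vR AR)).
split=> //; split; first by move=> x; apply: (js_V Nal Nfs A Lst Mst).
move=> eta a D [D0 [clp [Ueta [c1 [c2 [c3 [c4 [c5 c6]]]]]]]] [c [Crc [Nc [phi0 [e0 [Ve0 Hst]]]]]] VD De.
(* [standard] provides a critical point of its own, but [j] has only one. *)
have E : c = kappa.
{ case: Crc => _ [Oc [jc fixc]]; case: Cr => _ [_ [jk fixk]].
  by case: (ordinal_total Oc Ok) => [H|[//|H]]; [case: jc; apply: fixk|case: jk; apply: fixc]. }
subst c.
case: (js_ultrapower Nal Nfs A Lst Mst Ueta c1 c2 c3 c4 c5 c6 VD De Vh fh Ch Ns0 Ve0 Hst) => eta' [H1 [H2 H3]].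
exists eta'; split=> //; split=> //; exact: (js_standard Nal Nfs A Lst Mst Ve0 Hst).
Qed.

End Embedding.

End Fast.

End Model.

Theorem theorem2p2 (U : universe) (V : class U)
    (V_trans : transitive_class V) (V_ZFC : ZFC V)
    (kappa : U) (V_kappa : V kappa) (kappa_inacc : inaccessible V kappa)
    (P : U) (P_fast : is_fast_forcing V kappa P)
    (f : U) (f_generic : generic V P f) (f_ext : extension_exists V P f) :
  let Vf := extension V P f in
  exists l : U,
    Vf l /\ maps l kappa (fun x => Vf x /\ in_rank x kappa) /\
    forall j : U -> U,
      let M := image_class V j in
      let Mjf := extension M (j P) (j f) in
      transitive_class Mjf -> elementary Vf Mjf j -> critical_point Vf j kappa ->
      forall lambda lambda_plus z : U,
        app (j f) kappa lambda ->
        is_succ_card Mjf lambda lambda_plus ->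
        hereditary Mjf lambda_plus z ->
        exists j' : U -> U,
          let Mj'f := extension M (j' P) (j' f) in
          elementary Vf Mj'f j' /\
          generic M (j' P) (j' f) /\
          app (j' l) kappa z /\
          (forall x, Mj'f x <-> Mjf x) /\
          (forall x, V x -> j' x = j x) /\
          (forall eta a D : U,
             is_ultrapower Vf Mjf j eta a -> standard V Vf Mjf j a ->
             V D -> D ∈ eta ->
             exists eta' : U,
               is_ultrapower Vf Mj'f j' eta' a /\ standard V Vf Mj'f j' a /\
               D ∈ eta' /\
               (forall X, V X -> (X ∈ eta' <-> X ∈ eta))).
Proof.
move=> Vf; case: (V_empty V_trans V_ZFC) => o [Vo Ho].
(* The inaccessibles below [kappa] are collected into a set, so that [legit_in] transfers with its
   image under [j]. *)
have [II [VII HII]] : exists II, V II /\ forall d, d ∈ II <-> d ∈ kappa /\ inaccessible V d.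
  by apply: (sep (V_trans := V_trans) (V_ZFC := V_ZFC) (Q := inaccessible V)) => //; dsolve.
case: (enumeration V_trans V_ZFC V_kappa kappa_inacc) => h [Vh [fh [hk enum]]].
have oP := oP_gen V_trans V_ZFC V_kappa kappa_inacc P_fast Ho Vo f_generic.
case: (laver V_trans V_ZFC V_kappa kappa_inacc P_fast Ho Vh fh hk oP) => nd [Vnd Hnd].
case: (f_ext nd Vnd) => l vl; exists l; split; first by exists nd.
split; first by case: (Hnd f f_generic l vl f_ext).
move=> j M N TN El Cr lam lp z A Hl Hz.
exact: (embedding_main V_trans V_ZFC V_kappa kappa_inacc P_fast VII HII Ho Vo f_generic f_ext TN El Cr
  Vh fh enum Vnd Hnd vl A Hl Hz).
Qed.
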